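(* Let $S_t=t\wedge\tau_{\mathfrak{C}}$. Assume: - $t\mapsto S_t$ is right lower semicontinuous for $\mathbb{P}^\mu$-a.e. $\omega$, the predictable projection of $S$ is left lower semicontinuous, and $S$ is bounded below; - $X$ is a stationary Feller process, and $\phi^{\mathrm{re}}\in C_b(O_{\mathfrak{C}})$ for every $\phi\in C_b(O_{\mathfrak{C}})$; - (Poincaré inequality) there is $C_p>0$ with $\mathcal{E}(u,u)\ge C_p^{-1}\int_O|u(x)|^2m(dx)$ for all $u\in\mathcal{H}$; - (continuity/variational equivalence) for every $h\in LSC_b(O)\cap L^2(O;m)$: $\psi\in LSC_b(O)$ satisfies $\Delta\psi\le h$ in the viscosity sense if and only if $\psi\in\mathcal{H}$ is bounded above and satisfies $\Delta\psi\le h$ in the weak sense; - there is $D\ge0$ such that, for all $t\ge 0$ and $\sigma\in\mathcal{S}_t$, $\mathbb{P}^\mu$-a.s. $\mathbb{E}^{\mathbb{P}^\mu}[S_\sigma|\mathcal{F}_t]-S_t\le\mathbb{E}^{\mathbb{P}^\mu}[D(\sigma-t)|\mathcal{F}_t]$; - $\mu\in\mathcal{H}^*$ and $\mu\prec\nu$. Then there is a unique function (up to an additive constant) $h\in\mathcal{H}_0$ with $\Delta h=1$ in the weak sense on $O$ such that for any $\bar{\mathbb{P}}\in\mathcal{T}(\mu,\nu)$, $$\mathbb{E}^{\bar{\mathbb{P}}}[T]=\int_Oh(x)\,\nu(dx)-\int_Oh(x)\,\mu(dx).$$ In particular, any such $\bar{\mathbb{P}}$ is optimal for the cost $S_t=t\wedge\tau_{\mathfrak{C}}$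 (that is, it attains $\mathcal{P}_S(\mu,\nu)$), and the dual problem $\mathcal{D}_S(\mu,\nu)$ is solved by $\psi=h$ and $M_t=G^h_t=h(X_t)-S_t$.
   Context: Setting. $\mathbb{R}^+=[0,\infty)$. $O$ is a complete metric space and $O_{\mathfrak{C}}=O\cup\{\mathfrak{C}\}$, where the cemetery state $\mathfrak{C}$ has distance $1$ from every other point. $(\Omega,\mathbb{F}=(\mathcal{F}_t)_{t\in\mathbb{R}^+},\mathbb{P}^\mu)$ is a filtered probability space with $\Omega$ Polish, $\mathbb{P}^\mu$ a Borel probability measure, $\mathbb{F}$ right continuous and $\mathcal{F}_0$ containing the $\mathbb{P}^\mu$-null sets. $X:\Omega\to D(\mathbb{R}^+;O_{\mathfrak{C}})$ is a continuous map into the Skorokhod space of càdlàg paths, and $X$ is adapted to $\mathbb{F}$. $\mathcal{S}$ is the set of ($\mathbb{R}^+$-valued) $\mathbb{F}$-stopping times and $\mathcal{S}_t=\{\sigma\in\mathcal{S}:\sigma\ge t\}$. $\mu$ is a Borel probability measure on $O$ and is the law of $X_0$ under $\mathbb{P}^\mu$; $\nu$ is a Borel probability measure on $O_{\mathfrak{C}}$. $\tau_{\mathfrak{C}}=\inf\{t:X_t=\mathfrak{C}\}$; it is assumed that $\mathbb{E}^{\mathbb{P}^\mu}[\tau_{\mathfrak{C}}]<\infty$ and that $\mathbb{P}^\mu$-a.s. $X_t=\mathfrak{C}$ for $t\ge\tau_{\mathfrak{C}}$. For every nonempty open $Q\subset O$ there is $\sigma\in\mathcal{S}$ with $\mathbb{P}^\mu(X_\sigma\in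 Q)>0$. $C_b$: bounded continuous functions; $LSC_b$: bounded lower semicontinuous functions. $B(\bar\Omega)$, with $\bar\Omega=\mathbb{R}^+\times\Omega$, is the set of real processes $Z$ that are jointly measurable (Borel on $\mathbb{R}^+$, $\mathbb{P}^\mu$-completed Borel on $\Omega$) with $\{Z_\sigma:\sigma\in\mathcal{S}\}$ uniformly integrable. Randomized stopping times. On $\bar\Omega$ put $T(\tau,\omega)=\tau$, $X_T(\tau,\omega)=X_\tau(\omega)$, $S_T(\tau,\omega)=S_\tau(\omega)$. $\mathcal{T}(\mu,\nu)$ is the set of probability measures $\bar{\mathbb{P}}$ on $\bar\Omega$ whose projection on $\Omega$ is $\mathbb{P}^\mu$, such that for each $t$ the conditional probability of $\{T\le t\}$ given $\omega$ is $\mathcal{F}_t$-measurable, $T\le\tau_{\mathfrak{C}}$ a.s., and $X_T\sim_{\bar{\mathbb{P}}}\nu$. $\mathcal{P}_S(\mu,\nu)=\inf_{\bar{\mathbb{P}}\in\mathcal{T}(\mu,\nu)}\mathbb{E}^{\bar{\mathbb{P}}}[S_T]$. Dual problem. $\mathcal{A}_S$ is the set of $(\psi,M)\in C_b(O_{\mathfrak{C}})\times B(\bar\Omega)$ such that $M$ is an $(\Omega,\mathbb{F},\mathbb{P}^\mu)$-martingale and $\psi(X_\sigma)-M_\sigma\le S_\sigma$ $\mathbb{P}^\mu$-a.s. for all $\sigma\in\mathcal{S}$. $\mathcal{D}_S(\mu,\nu)=\sup_{(\psi,M)\in\mathcal{A}_S}\{\int_{O_{\mathfrak{C}}}\psi\,d\nu-\mathbb{E}^{\mathbb{P}^\mu}[M_0]\}$;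 a pair solves the dual problem if it attains this supremum. Value process: $G^\psi_t=\sup_{\sigma\in\mathcal{S}_t}\mathbb{E}^{\mathbb{P}^\mu}[\psi(X_\sigma)-S_\sigma|\mathcal{F}_t]$ (essential supremum). Feller process. $X$ is a stationary Feller process if there is a probability transition semigroup $P(t,x,\cdot)$ on $O_{\mathfrak{C}}$, with $P(t,x,\cdot)=\int_{O_{\mathfrak{C}}}P(t-s,y,\cdot)P(s,x,dy)$ for $0<s<t$, such that $P(t,x,\cdot)$ is the law of $X_t$ given $X_0=x$, $X$ is (time-homogeneous) Markov with respect to $\mathbb{F}$ with this semigroup, and $\int f(y)P(t,\cdot,dy)\to f$ uniformly as $t\to0$ for all $f\in C_b(O_{\mathfrak{C}})$. $\mathbb{E}^x,\mathcal{S}^x$: expectation and (nonrandomized) stopping times for the process started at $x$. Réduite: $\psi^{\mathrm{re}}(x)=\sup_{\sigma\in\mathcal{S}^x}\mathbb{E}^x[\psi(X_\sigma)]$. $\mu\prec\nu$ means $\int_{O_{\mathfrak{C}}}\psi\,d\nu\le\int_{O_{\mathfrak{C}}}\psi\,d\mu$ whenever $\psi=\psi^{\mathrm{re}}$ ($\psi\in LSC_b(O_{\mathfrak{C}})$). Dirichlet form. $m$ is a positive finite Borel measure on $O$; functions on $O$ are extended by $0$ at $\mathfrak{C}$. $\mathcal{E}$ is a symmetric semi-definite (Dirichlet) form on $L^2(O;m)$, $\mathcal{H}=\{u\in L^2(O;m):\mathcal{E}(u,u)<\infty\}$, which under the Poincaré inequality is a Hilbert space with inner product $\mathcal{E}$.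 A measure $\rho$ belongs to $\mathcal{H}^*$ if there is $U^\rho\in\mathcal{H}$ with $\int_Of\,d\rho=\mathcal{E}(f,U^\rho)$ for all $f\in C_b(O)\cap\mathcal{H}$. $\Delta$ is the generator of $\mathcal{E}$, and $\mathcal{H}_0=\{f\in C_b(O)\cap\mathcal{H}:\Delta f\in C_b(O)\cap L^2(O;m)\}$, so $\mathcal{E}(f,g)=\int_Og(-\Delta f)\,dm$ for $f\in\mathcal{H}_0$, $g\in\mathcal{H}$. $\Delta$ generates $X$: $f(x)=\mathbb{E}^x[f(X_\sigma)-\int_0^\sigma\Delta f(X_t)dt]$ for $f\in\mathcal{H}_0$, $\sigma\in\mathcal{S}^x$. Viscosity sense: $g\in LSC_b(O)$ satisfies $\Delta g\le h$ ($h\in LSC_b(O)$) if whenever $f\in\mathcal{H}_0$, $f(x)=g(x)$ and $f\le g$ on $O$, then $\Delta f(x)\le h(x)$. Weak sense: $g\in\mathcal{H}$ satisfies $\Delta g\le h$ ($h\in L^2(O;m)$) if $\mathcal{E}(f,g)\ge-\int_Ohf\,dm$ for all $f\in\mathcal{H}_0$ with $f\ge0$; $\Delta g=h$ weakly means equality for all $f\in\mathcal{H}_0$. *)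

(* Defs.v *)
From HB Require Import structures.
From mathcomp Require Import all_boot all_order all_algebra.
From mathcomp Require Import all_classical all_reals all_analysis measurable_realfun.

Set Implicit Arguments.
Unset Strict Implicit.
Unset Printing Implicit Defensive.
Import Order.TTheory GRing.Theory Num.Theory.
Import numFieldNormedType.Exports.

Local Open Scope classical_set_scope.
Local Open Scope ring_scope.

(* Measurable types of the library are pointed, so complete metric spaces are
   nonempty here; all of them carry a probability measure below. *)
#[short(type="completeMetricType")]
HB.structure Definition CompleteMetric (K : numFieldType) :=
  { T of Metric K T & Uniform_isComplete T & isPointed T }.

Notation borel T := (g_sigma_algebraType (@open T)).

(* The Caratheodory sigma-algebra of the outer measure of a finite measure P is
   the P-completion, and [completed P] is the completed measure on it. *)
Notation completed_type P := (caratheodory_type (P^*)%mu).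
Notation completed P := (@completed_measure_extension _ _ _ P).

Section cemetery.
Context {R : realType} (O : completeMetricType R).

Definition cem : Type := option O.

HB.instance Definition _ := Choice.on cem.
HB.instance Definition _ := isPointed.Build cem None.

(* The cemetery None is at distance 1 from every other point, hence isolated. *)
Definition cem_open (A : set cem) := open (Some @^-1` A : set O).

Let cem_openT : cem_open setT.
Proof. by rewrite /cem_open preimage_setT; exact: openT. Qed.

Let cem_openI : setI_closed cem_open.
Proof. by move=> A B oA oB; rewrite /cem_open preimage_setI; exact: openI. Qed.

Let cem_open_bigcup (I : Type) (f : I -> set cem) :
  (forall i, cem_open (f i)) -> cem_open (\bigcup_i f i).
Proof.
by move=> of_; rewrite /cem_open preimage_bigcup; apply: bigcup_open => i _;
  exact: of_.
Qed.

HB.instance Definition _ :=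
  isOpenTopological.Build cem cem_openT cem_openI cem_open_bigcup.

Definition cem_dist (x y : cem) : R :=
  match x, y with
  | Some a, Some b => mdist a b
  | None, None => 0
  | _, _ => 1
  end.

Definition ext0 (f : O -> R) (x : cem) : R := if x is Some a then f a else 0.

End cemetery.

Section function_classes.
Context {R : realType} {T : topologicalType}.
Implicit Type f : T -> R.

Definition Cb f := continuous f /\ exists c : R, forall x, `|f x| <= c.

Definition LSCb f :=
  lower_semicontinuous (EFin \o f) /\ exists c : R, forall x, `|f x| <= c.

End function_classes.

(* Time is R^+ = [0, +oo[: processes and paths are indexed by R, but only their
   values at nonnegative times are ever used. *)
Section paths.
Context {R : realType} {T : ptopologicalType}.

Definition cadlag (p : R -> T) :=
  (forall t, 0 <= t -> p s @[s --> t^'+] --> p t) /\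
  (forall t, 0 < t -> exists l : T, p s @[s --> t^'-] --> l).

Record cadlag_path :=
  CadlagPath { path_fun :> R -> T ; path_cadlag : cadlag path_fun }.

Lemma cadlag_cst (x : T) : cadlag (fun=> x).
Proof. by split=> [t _|t _]; [|exists x]; exact: cvg_cst. Qed.

HB.instance Definition _ := gen_eqMixin cadlag_path.
HB.instance Definition _ := gen_choiceMixin cadlag_path.
HB.instance Definition _ :=
  isPointed.Build cadlag_path (CadlagPath (cadlag_cst point)).

Definition cylinders_upto (s : \bar R) : set (set cadlag_path) :=
  [set C | exists t (B : set (borel T)), [/\ 0 <= t, (t%:E <= s)%E, measurable B
    & C = [set p : cadlag_path | B (p t)]]].

End paths.
Arguments cadlag_path R T : clear implicits.
Arguments cylinders_upto {R T} s.

Notation path_space R T := (g_sigma_algebraType (@cylinders_upto R T +oo%E)).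

Section skorokhod.
Context {R : realType} {O : completeMetricType R}.

Definition lifetime (p : cadlag_path R (cem O)) : \bar R :=
  ereal_inf [set t%:E | t in [set t : R | 0 <= t /\ p t = None]].

Definition time_change (l : R -> R) :=
  set_bij [set t : R | 0 <= t] [set t : R | 0 <= t] l /\
  (forall s t, 0 <= s -> s < t -> l s < l t).

(* A neighbourhood base of p in the Skorokhod (J1) topology of D(R^+; O_C)
   (Ethier-Kurtz, Markov Processes, Proposition III.5.3(c)). *)
Definition skorokhod_nbhd (p : cadlag_path R (cem O)) (T e : R) :
    set (cadlag_path R (cem O)) :=
  [set q | exists2 l, time_change l & forall t, 0 <= t <= T ->
    `|l t - t| < e /\ cem_dist (q t) (p (l t)) < e].

Definition skorokhod_continuous (W : topologicalType)
    (X : W -> cadlag_path R (cem O)) :=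
  forall w (T e : R), 0 < e ->
    \forall w' \near w, skorokhod_nbhd (X w) T e (X w').

End skorokhod.

Section filtered_space.
Context {d : measure_display} {W : measurableType d} {R : realType}.
Variable P : {measure set W -> \bar R}.
Local Open Scope ereal_scope.
Implicit Types (G : set (set W)) (F : R -> set (set W)) (t : R).

Definition meas_wrt G (Y : W -> \bar R) :=
  forall B : set (\bar R), measurable B -> G (Y @^-1` B).

(* Y is a version of E[Z | G], for Z integrable or bounded below. *)
Definition cond_exp G (Z Y : W -> \bar R) :=
  meas_wrt G Y /\
  forall A, G A -> \int[P]_(w in A) Y w = \int[P]_(w in A) Z w.

Definition usual_filtration F :=
  [/\ forall t, (0 <= t)%R ->
        sigma_algebra setT (F t) /\ F t `<=` measurable,
      forall s t, (0 <= s)%R -> (s <= t)%R -> F s `<=` F t,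
      forall t, (0 <= t)%R -> \bigcap_(s in [set s | (t < s)%R]) F s `<=` F t
    & P.-negligible `<=` F 0%R].

Definition stopping_time F : set (W -> R) :=
  [set sigma | (forall w, (0 <= sigma w)%R) /\
    forall t, (0 <= t)%R -> F t [set w | (sigma w <= t)%R]].

Definition stopping_time_ge F t : set (W -> R) :=
  [set sigma | stopping_time F sigma /\ forall w, (t <= sigma w)%R].

Definition nonneg_time : set (R * W) := [set z | (0 <= z.1)%R].

(* Jointly measurable Z with (Z_sigma) uniformly integrable over all stopping
   times. *)
Definition classB F (Z : R -> W -> R) :=
  measurable_fun nonneg_time (fun z : R * W => Z z.1 z.2) /\
  forall e : R, (0 < e)%R -> exists K : R, forall sigma, stopping_time F sigma ->
    \int[P]_(w in [set w | (K < `|Z (sigma w) w|)%R]) `|Z (sigma w) w|%:E <= e%:E.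

Definition martingale F (M : R -> W -> R) :=
  (forall t, (0 <= t)%R -> P.-integrable setT (EFin \o M t)) /\
  forall s t, (0 <= s)%R -> (s <= t)%R ->
    cond_exp (F s) (EFin \o M t) (EFin \o M s).

Definition ess_supremum G (C : set (W -> \bar R)) (Y : W -> \bar R) :=
  [/\ meas_wrt G Y,
      forall Z, C Z -> {ae P, forall w, Z w <= Y w}
    & forall Y', measurable_fun setT Y' ->
        (forall Z, C Z -> {ae P, forall w, Z w <= Y' w}) ->
        {ae P, forall w, Y w <= Y' w}].

Definition predictable_gen F : set (set (R * W)) :=
  [set C | exists2 A, F 0%R A & C = [set 0%R] `*` A] `|`
  [set C | exists s t A, [/\ (0 <= s)%R, (s <= t)%R, F s A
                           & C = [set` `]s, t]%R] `*` A]].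

Definition predictable_sets F := <<s nonneg_time, predictable_gen F >>.

Definition predictable F (Y : R -> W -> \bar R) :=
  forall B : set (\bar R), measurable B ->
    predictable_sets F (nonneg_time `&` [set z | B (Y z.1 z.2)]).

Definition predictable_time F (sigma : W -> \bar R) :=
  (forall w, 0 <= sigma w) /\
  predictable_sets F [set z | (0 <= z.1)%R /\ sigma z.2 <= z.1%:E].

(* The sigma-algebra F_{sigma-}. *)
Definition strict_past F (sigma : W -> \bar R) : set (set W) :=
  <<s F 0%R `|` [set C | exists t A, [/\ (0 <= t)%R, F t A
                           & C = A `&` [set w | t%:E < sigma w]]] >>.

(* For predictable Y, the integral identity says that
   Y_sigma = E[Z_sigma | F_{sigma-}] a.s. on {sigma < +oo}. *)
Definition predictable_projection F (Z : R -> W -> R) (Y : R -> W -> \bar R) :=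
  predictable F Y /\
  forall sigma, predictable_time F sigma ->
  forall A, strict_past F sigma A ->
    \int[P]_(w in A `&` [set w | sigma w < +oo]) Y (fine (sigma w)) w =
    \int[P]_(w in A `&` [set w | sigma w < +oo]) (Z (fine (sigma w)) w)%:E.

End filtered_space.

Section semicontinuous_paths.
Context {R : realType}.
Local Open Scope ereal_scope.

Definition right_lsc (y : R -> \bar R) :=
  forall t a : R, (0 <= t)%R -> a%:E < y t -> \forall s \near t^'+, a%:E < y s.

Definition left_lsc (y : R -> \bar R) :=
  forall t a : R, (0 < t)%R -> a%:E < y t -> \forall s \near t^'-, a%:E < y s.

End semicontinuous_paths.

Section transport.
Context {R : realType} {O : completeMetricType R}.
Context {d : measure_display} {W : measurableType d}.
Variables (P : {measure set W -> \bar R}) (F : R -> set (set W)).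
Variables (X : W -> cadlag_path R (cem O)) (nu : probability (borel (cem O)) R).
Variable S : R -> W -> R.
Local Open Scope ereal_scope.

Definition adapted :=
  forall t (B : set (borel (cem O))), (0 <= t)%R -> measurable B ->
    F t [set w | B (X w t)].

(* The set T(mu, nu); in the third clause g is the conditional probability of
   {T <= t} given omega. *)
Definition randomized_stopping_time : set (probability (R * W)%type R) :=
  [set Pb |
    [/\ Pb (~` nonneg_time) = 0,
        forall A, measurable A -> Pb (setT `*` A) = P A,
        forall t, (0 <= t)%R -> exists2 g : W -> \bar R, meas_wrt (F t) g &
          forall A, measurable A ->
            Pb ([set s | (s <= t)%R] `*` A) = \int[P]_(w in A) g w,
        {ae Pb, forall z, z.1%:E <= lifetime (X z.2)}
      & forall B : set (borel (cem O)), measurable B ->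
          Pb (nonneg_time `&` [set z | B (X z.2 z.1)]) = nu B]].

Definition expected_cost (Pb : probability (R * W)%type R) : \bar R :=
  \int[Pb]_(z in nonneg_time) (S z.1 z.2)%:E.

Definition primal_value : \bar R :=
  ereal_inf [set expected_cost Pb | Pb in randomized_stopping_time].

Definition dual_admissible : set ((cem O -> R) * (R -> W -> R)) :=
  [set u | [/\ Cb u.1, classB P F u.2, martingale P F u.2
    & forall sigma, stopping_time F sigma ->
        {ae P, forall w,
          (u.1 (X w (sigma w)) - u.2 (sigma w) w <= S (sigma w) w)%R}]].

Definition dual_objective (u : (cem O -> R) * (R -> W -> R)) : \bar R :=
  \int[nu]_x (u.1 x)%:E - \int[P]_w (u.2 0%R w)%:E.

Definition dual_value : \bar R :=
  ereal_sup [set dual_objective u | u in dual_admissible].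

Definition solves_dual (psi : cem O -> R) (M : R -> W -> R) :=
  dual_admissible (psi, M) /\ dual_objective (psi, M) = dual_value.

Definition value_process (psi : cem O -> R) (G : R -> W -> R) :=
  forall t, (0 <= t)%R ->
    ess_supremum P (F t)
      [set Y | exists2 sigma, stopping_time_ge F t sigma &
        cond_exp P (F t)
          (fun w => (psi (X w (sigma w)) - S (sigma w) w)%:E) Y]
      (EFin \o G t).

Definition markov_process
    (Pt : R -> R.-pker borel (cem O) ~> borel (cem O)) :=
  forall s t (B : set (borel (cem O))), (0 <= s)%R -> (s < t)%R ->
    measurable B ->
    cond_exp P (F s) (fun w => (\1_B (X w t))%:E)
                     (fun w => Pt (t - s)%R (X w s) B).

End transport.

(* S_t = t /\ tau *)
Definition killed_clock {R : realType} {O : completeMetricType R} {W : Type}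
    (X : W -> cadlag_path R (cem O)) (t : R) (w : W) : R :=
  fine (Order.min t%:E (lifetime (X w))).

Section feller.
Context {R : realType} {O : completeMetricType R}.
Variable Pt : R -> R.-pker borel (cem O) ~> borel (cem O).
(* Px x is the law, on the path space, of the process started at x. *)
Variable Px : cem O -> probability (path_space R (cem O)) R.
Local Open Scope ereal_scope.

(* The usual augmentation, under Px x, of the filtration of the coordinate
   process; its stopping times form the set S^x. *)
Definition path_filtration (x : cem O) (t : R) :
    set (set (completed_type (Px x))) :=
  \bigcap_(s in [set s | (t < s)%R])
    <<s cylinders_upto s%:E `|` (completed (Px x)).-negligible >>.

Arguments path_filtration x t : clear implicits.

Definition path_stopping_time (x : cem O) :
    set (completed_type (Px x) -> R) :=
  [set sigma | stopping_time (path_filtration x) sigma].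
Arguments path_stopping_time x : clear implicits.

Definition started_at (x : cem O) :=
  [/\ Px x [set p : cadlag_path R (cem O) | p 0%R = x] = 1,
      forall t (B : set (borel (cem O))), (0 < t)%R -> measurable B ->
        Px x [set p : cadlag_path R (cem O) | B (p t)] = Pt t x B
    & markov_process (completed (Px x)) (path_filtration x) id Pt].

Definition chapman_kolmogorov :=
  forall s t x (B : set (borel (cem O))), (0 < s)%R -> (s < t)%R ->
    measurable B -> Pt t x B = \int[Pt s x]_y Pt (t - s)%R y B.

Definition uniformly_continuous_at0 :=
  forall f : cem O -> R, Cb f -> forall e : R, (0 < e)%R ->
    \forall t \near 0%R^'+, forall x,
      `| \int[Pt t x]_y (f y)%:E - (f x)%:E | <= e%:E.

Definition stationary_feller {d : measure_display} {W : measurableType d}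
    (P : {measure set W -> \bar R}) (F : R -> set (set W))
    (X : W -> cadlag_path R (cem O)) :=
  [/\ chapman_kolmogorov, uniformly_continuous_at0, markov_process P F X Pt
    & forall x, started_at x].

Definition reduite (psi : cem O -> R) (x : cem O) : \bar R :=
  ereal_sup [set \int[completed (Px x)]_p
                   (psi ((p : cadlag_path R (cem O)) (sigma p)))%:E
            | sigma in path_stopping_time x].

Definition reduite_order (mu : probability (borel O) R)
    (nu : probability (borel (cem O)) R) :=
  forall psi : cem O -> R, LSCb psi -> (forall x, (psi x)%:E = reduite psi x) ->
    \int[nu]_x (psi x)%:E <= \int[mu]_x (psi (Some x))%:E.

End feller.
Arguments path_filtration {R O} Px x t.
Arguments path_stopping_time {R O} Px x sigma.

Section dirichlet.
Context {R : realType} {O : completeMetricType R}.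
Variable m : {finite_measure set (borel O) -> \bar R}.
Local Open Scope ereal_scope.

Definition L2 : set (O -> R) := [set u | (u : borel O -> R) \in Lfun m 2%:E].

Definition sqnorm2 (u : O -> R) : \bar R := \int[m]_x ((u x) ^+ 2)%:E.

(* Elements of L^2(O; m) are represented by functions; a form is +oo on the
   diagonal outside its domain H. *)
Variable E : (O -> R) -> (O -> R) -> \bar R.

Definition form_domain : set (O -> R) := [set u | L2 u /\ E u u < +oo].

Local Notation H := form_domain.

(* The last three clauses are the density of the domain, the closedness of the
   form, and the unit contraction (Markov) property. *)
Definition dirichlet_form :=
  [/\ [/\ forall u u' v, L2 u -> L2 u' -> L2 v ->
            {ae m, forall x, u x = u' x} -> E u v = E u' v,
          forall u v, L2 u -> L2 v -> E u v = E v u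
        & forall u, L2 u -> 0 <= E u u],
      [/\ forall (a : R) u v, H u -> H v -> H (fun x => a * u x + v x)%R,
          forall u v, H u -> H v -> E u v \is a fin_num
        & forall (a : R) u v w, H u -> H v -> H w ->
            E (fun x => a * u x + v x)%R w = a%:E * E u w + E v w],
      forall f (e : R), L2 f -> (0 < e)%R ->
        exists2 u, H u & sqnorm2 (fun x => f x - u x)%R < e%:E,
      forall u : nat -> O -> R, (forall n, H (u n)) ->
        (forall e : R, (0 < e)%R -> exists N, forall k n : nat,
          (N <= k)%N -> (N <= n)%N ->
          E (fun x => u k x - u n x)%R (fun x => u k x - u n x)%R +
          sqnorm2 (fun x => u k x - u n x)%R < e%:E) ->
        exists2 v, H v &
          (fun n => E (fun x => u n x - v x)%R (fun x => u n x - v x)%R +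
                    sqnorm2 (fun x => u n x - v x)%R) @ \oo --> 0
    & forall u, H u ->
        let v := fun x => Num.min (Num.max (u x) 0%R) 1%R in
        H v /\ E v v <= E u u].

Definition poincare :=
  exists2 Cp : R, (0 < Cp)%R &
    forall u, H u -> (Cp^-1)%:E * sqnorm2 u <= E u u.

Definition in_dual (rho : {measure set (borel O) -> \bar R}) :=
  exists2 U, H U & forall f, Cb f -> H f -> \int[rho]_x (f x)%:E = E f U.

(* The relation Delta f = g in L^2(O; m). *)
Definition generator (f g : O -> R) :=
  [/\ H f, L2 g & forall v, H v -> E f v = \int[m]_x (v x * - g x)%:E].

Definition H0 : set (O -> R) :=
  [set f | [/\ Cb f, H f & exists2 g, Cb g & generator f g]].

Definition generates (Px : cem O -> probability (path_space R (cem O)) R) :=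
  forall f g, H0 f -> Cb g -> generator f g ->
  forall (x : O) sigma, path_stopping_time Px (Some x) sigma ->
    (f x)%:E = \int[completed (Px (Some x))]_p
      ((ext0 f ((p : cadlag_path R (cem O)) (sigma p)))%:E -
       \int[lebesgue_measure]_(t in [set` `[0%R, sigma p]%R])
         (ext0 g ((p : cadlag_path R (cem O)) t))%:E).

Definition viscosity_le (g h : O -> R) :=
  forall f Df x, H0 f -> Cb Df -> generator f Df ->
    f x = g x -> (forall y, (f y <= g y)%R) -> (Df x <= h x)%R.

Definition weak_le (g h : O -> R) :=
  [/\ H g, L2 h & forall f, H0 f -> (forall x, (0 <= f x)%R) ->
                    - (\int[m]_x (h x * f x)%:E) <= E f g].

Definition weak_eq (g h : O -> R) :=
  [/\ H g, L2 h & forall f, H0 f -> E f g = - (\int[m]_x (h x * f x)%:E)].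

(* Membership in H is a property of the m-a.e. class of psi, membership in
   LSC_b(O) one of the function: a bounded above weak supersolution in H is
   required to have a representative in LSC_b(O). *)
Definition viscosity_weak_equivalence :=
  forall h, LSCb h -> L2 h ->
    (forall psi, LSCb psi ->
       (viscosity_le psi h <->
        [/\ H psi, exists c : R, forall x, (psi x <= c)%R & weak_le psi h])) /\
    (forall psi, H psi -> (exists c : R, {ae m, forall x, (psi x <= c)%R}) ->
       weak_le psi h ->
       exists psi', [/\ LSCb psi', viscosity_le psi' h
                      & {ae m, forall x, psi' x = psi x}]).

End dirichlet.

(* Main.v *)
(* Since every point of O is an atom of m (otherwise weak and viscosity
   supersolutions differ), O is countable and "m-almost everywhere" means
   "everywhere".  Minimising E(u, u) + 2 int u dm produces h with Delta h = 1,
   and uniqueness follows from the Poincare inequality, even without the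
   additive constant.  The equivalence of weak and viscosity supersolutions,
   applied to h and - h, makes h continuous and bounded.

   The identity h(x) = E^x[h(X_t) - int_0^t 1_{X_r <> C} dr] and the Markov
   property turn M_t = h(X_t) - S_t into a martingale, closed by - tau_C.
   Discretising time on dyadic grids and using right continuity, optional
   stopping extends to stopping times and to randomized stopping times, whence
   E[T] = E[S_T] = int h dnu - int h dmu.  In particular all costs agree.

   For an admissible (psi, M'), put phi = psi - h and let v be the reduite of
   phi.  It is the limit of Snell envelopes on dyadic grids, hence dominates
   its own transition averages and equals its own reduite, so that
   int phi dnu <= int v dnu <= int v dmu.  Each approximation of v is attained
   by a stopping time sigma, and phi(X_sigma) <= M'_sigma - M_sigma gives
   int v dmu <= E[M'_0] - int h dmu. *)

Require Import Defs.
From HB Require Import structures.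
From mathcomp Require Import all_boot all_order all_algebra finmap.
From mathcomp Require Import all_classical all_reals all_analysis measurable_realfun.
From mathcomp Require Import ring lra.

Set Implicit Arguments.
Unset Strict Implicit.
Unset Printing Implicit Defensive.
Import Order.TTheory GRing.Theory Num.Theory.
Import numFieldNormedType.Exports.

Local Open Scope classical_set_scope.
Local Open Scope ring_scope.

(** Countability of O does more than remove null sets. Every subset of O_C is Borel, so the Snell
    envelopes and the reduite need no measurability argument, and an identity between conditional
    expectations given X_s can be checked on the events {X_s = x}, where the transition kernel is
    constant.

    The obstacle in the duality step is that an admissible M' is a martingale without any path
    regularity, so it cannot be stopped at arbitrary times. This is why the reduite is approached
    through stopping times assembled from finitely many deterministic times, for which optional
    stopping needs only the martingale identity. Moreover the reduite is defined on the path spaces,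
    while M' lives on the given space; hence each approximation is shown to be attained in every
    Markov system with the same kernels.

    For M itself all limits rest on one bound: almost surely |M_t| <= C + tau_C for all t, where C
    bounds |h| and tau_C is integrable. *)

Lemma countable_measure_gt0 d (T : measurableType d) (R : realType)
    (mu : {finite_measure set T -> \bar R}) :
  (forall x : T, measurable [set x]) ->
  countable [set x | (0 < mu [set x])%E].
Proof.
move=> m1; have mufin x : mu [set x] \is a fin_num by exact: fin_num_measure.
pose r x := fine (mu [set x]).
rewrite [X in countable X](_ : _ = \bigcup_n [set x | n.+1%:R^-1 < r x]); last first.
  apply/seteqP; split=> x /=; rewrite -(fineK (mufin x)) lte_fin.
    by move=> /ltr_add_invr[k /[!add0r] kr]; exists k.
  by move=> [k _]; exact: lt_trans.
apply: bigcup_countable => // n _; apply: finite_set_countable.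
(* An infinite level would contain a finite set of more than (n + 1) mu(T) points, each of mass
   above 1 / (n + 1); its mass would exceed mu(T). *)
apply: contrapT => /infinite_set_fset.
move=> /(_ (Num.truncn (n.+1%:R * fine (mu setT))).+1)[B BA Bn].
have : (mu (\bigcup_(x in [set` B]) [set x]) <= mu setT)%E.
  apply: le_measure => //; apply: mem_set => //.
  exact: (fin_bigcup_measurable (finite_fset B) (fun x _ => m1 x)).
rewrite measure_fin_bigcup//; last by move=> x y _ _ [z [/= <- <-]].
rewrite fsbig_finite/=; last exact: finite_fset.
rewrite leNgt => /negP; apply.
rewrite set_fsetK.
under eq_bigr do rewrite -(fineK (mufin _)).
have muT : mu setT \is a fin_num by exact: fin_num_measure.
rewrite sumEFin -(fineK muT) lte_fin.
apply: (@lt_le_trans _ _ (\sum_(i <- B) n.+1%:R^-1)); last first.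
  by rewrite big_seq [leRHS]big_seq ler_sum// => x xB; apply/ltW/BA.
rewrite big_const_seq iter_addr_0 count_predT -[ltRHS]mulr_natl ltr_pdivlMr ?ltr0n// mulrC.
by rewrite (lt_le_trans (truncnS_gt _))// ler_nat.
Qed.

Section bounded_functions.
Context {R : realType} {T : topologicalType}.

Lemma Cb_cst (c : R) : Cb (fun _ : T => c).
Proof. by split; [exact: cst_continuous|exists `|c|]. Qed.

Lemma LSCb_cst (c : R) : LSCb (fun _ : T => c).
Proof.
split; last by exists `|c|.
by move=> x a /= ac; exists setT; [exact: filterT|].
Qed.

Lemma CbB (f g : T -> R) : Cb f -> Cb g -> Cb (fun x => f x - g x).
Proof.
move=> [cf [c fc]] [cg [c' gc]]; split; last first.
  by exists (c + c') => x; rewrite (le_trans (ler_normB _ _))// lerD.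
by move=> x; apply: cvgB; [exact: cf|exact: cg].
Qed.

Lemma Cb_LSCb (f : T -> R) : Cb f -> LSCb f.
Proof.
move=> [cf fc]; split => // x a /=; rewrite lte_fin => ax.
exists [set y | a < f y] => [|y /=]; last by rewrite lte_fin.
exact: (cvgr_gt (f x) (cf x)).
Qed.

End bounded_functions.

(** * Atoms of the reference measure *)

Section atoms.
Context {R : realType} {O : completeMetricType R}.
Variable m : {finite_measure set (borel O) -> \bar R}.
Variable E : (O -> R) -> (O -> R) -> \bar R.

Lemma closed_set1_metric (x : O) : closed [set x].
Proof. exact/accessible_closed_set1/hausdorff_accessible/metric_hausdorff. Qed.

Lemma borel_measurable_set1 (x : borel O) : measurable [set x].
Proof.
rewrite -[X in measurable X]setCK; apply: measurableC.
by apply: sub_sigma_algebra; exact/closed_openC/closed_set1_metric.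
Qed.

Lemma L2P (u : O -> R) : L2 m u <->
  measurable_fun [set: borel O] u /\ (sqnorm2 m u < +oo)%E.
Proof.
rewrite /L2/=; split=> [uL|[mu fu]].
  move: (uL); rewrite inE => /andP[/set_mem mu _]; split => //.
  exact: integrable_lty (Lfun2_integrable_sqr uL).
rewrite inE; apply/andP; split; first exact: mem_set.
apply: mem_set => /=; rewrite /finite_norm unlock poweR_lty//.
rewrite (eq_integral (fun x : borel O => (u x ^+ 2)%:E))// => x _.
by rewrite -[LHS]/((`|u x| `^ 2)%:E) powR_mulrn// real_normK ?num_real.
Qed.

(** The axioms do not name 0. Density supplies some u in the domain, and linearity then gives - u +
    u. *)
Lemma form_domain0 : dirichlet_form m E -> form_domain m E (fun=> 0).
Proof.
case=> -[ext sym pos] [lin _ _] dense _ _.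
have L20 : L2 m (fun=> 0).
  rewrite /L2/=; exact: Lfun_cst.
have [u Hu _] := dense _ 1 L20 ltr01.
have := lin (-1) u u Hu Hu.
by congr (form_domain m E _); apply/funext => x; ring.
Qed.

(** Linearity in 0 = 1 * 0 + 0 gives E(0, u) = E(0, u) + E(0, u), and finiteness cancels one
    term. *)
Lemma dirichlet0r u : dirichlet_form m E -> form_domain m E u ->
  E u (fun=> 0) = 0%E.
Proof.
move=> dE Hu; have H0 := form_domain0 dE.
case: dE => -[ext sym pos] [lin fin bil] _ _ _.
have /(_ 0 _ _ _ H0 H0 Hu) := bil.
rewrite mul0e add0e => _.
rewrite sym; [|exact: (proj1 Hu)|exact: (proj1 H0)].
have := bil 1 _ _ _ H0 H0 Hu.
rewrite mul1e (_ : (fun x => _) = (fun=> 0)); last by apply/funext => x; ring.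
have := fin _ _ H0 Hu; case: (E _ _) => // r _ /eqP.
by rewrite -EFinD eqe -subr_eq0 opprD addrA subrr add0r oppr_eq0 => /eqP ->.
Qed.

Lemma generator0 : dirichlet_form m E -> generator m E (fun=> 0) (fun=> 0).
Proof.
move=> dE; split; [exact: form_domain0|exact: Lfun_cst|move=> v Hv].
case: (dE) => -[ext sym pos] _ _ _ _.
rewrite sym; [|exact: (proj1 (form_domain0 dE))|exact: (proj1 Hv)].
rewrite dirichlet0r//; apply/esym/integral0_eq => x _.
by rewrite oppr0 mulr0.
Qed.

(* The function [- 1_{x}] is lower semicontinuous.  If [x] were m-null, the
   weak inequality [Delta 0 <= - 1_{x}] would hold, whereas the viscosity one
   fails at [x], where 0 touches itself from below. *)
Lemma viscosity_weak_gt0 : dirichlet_form m E ->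
  viscosity_weak_equivalence m E -> forall x, (0 < m [set x])%E.
Proof.
move=> dE ve x; rewrite lt0e measure_ge0 andbT; apply/negP => /eqP mx0.
pose h : O -> R := fun y => - \1_[set x] y.
have h0 y : y != x -> h y = 0.
  by move=> yx; rewrite /h indicE in_set1 (negbTE yx) oppr0.
have hx : h x = -1 by rewrite /h indicE in_set1 eqxx.
have mh : measurable_fun [set: borel O] h.
  apply: measurableT_comp => //; apply: measurable_indic.
  exact: borel_measurable_set1.
have aeh : ae_eq m setT (EFin \o h) (EFin \o cst 0).
  exists [set x]; split => //; first exact: borel_measurable_set1.
  move=> y /= nh; apply: contrapT => /eqP yx; apply: nh => _ /=.
  by rewrite h0.
have Ch : LSCb h.
  split; last first.
    by exists 1 => y; rewrite /h normrN indicE; case: (_ \in _); rewrite ?normr1 ?normr0.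
  move=> y a /=; rewrite lte_fin => ay.
  have [yx|yx] := eqVneq y x.
    exists setT; first exact: filterT.
    move=> z _; rewrite lte_fin (lt_le_trans ay)// yx hx /h lerN2 indicE.
    by case: (_ \in _).
  exists (~` [set x]); last first.
    by move=> z /eqP zx; rewrite lte_fin h0// -(h0 _ yx).
  by apply: open_nbhs_nbhs; split; [exact/closed_openC/closed_set1_metric|exact/eqP].
have sqh : sqnorm2 m h = 0%E.
  rewrite /sqnorm2 (ae_eq_integral (cst 0%E))//=; first by rewrite integral0.
    by apply/measurable_EFinP; exact: measurable_funX.
  by apply: filterS aeh => y /= yh _; have [->] := yh I; rewrite expr0n.
have L2h : L2 m h by apply/L2P; split => //; rewrite sqh.
have Hf0 := form_domain0 dE.
have [/(_ (fun=> 0) (LSCb_cst 0))[_ weak_visc] _] := ve _ Ch L2h.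
have H00 : H0 m E (fun=> 0).
  split => //; first exact: Cb_cst.
  by exists (fun=> 0); [exact: Cb_cst|exact: generator0].
suff /weak_visc/(_ (fun=> 0) (fun=> 0) x H00 (Cb_cst 0) (generator0 dE) erefl
    (fun=> lexx _)) : [/\ form_domain m E (fun=> 0),
    exists c : R, forall y : O, 0 <= c & weak_le m E (fun=> 0) h].
  by rewrite hx oppr_ge0 ler10.
split => //; first by exists 0.
split => // f [_ Hf _] f0; rewrite dirichlet0r//.
rewrite (ae_eq_integral (cst 0%E))//=; first by rewrite integral0 oppe0.
- by apply/measurable_EFinP; apply: measurable_funM => //; case: Hf => /L2P[].
- by apply: filterS aeh => y /= yh _; have [->] := yh I; rewrite mul0r.
Qed.

End atoms.

(** * Energy minimisation *)

Section energy.
Context {R : realType} {O : completeMetricType R}.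
Variable m : {finite_measure set (borel O) -> \bar R}.
Variable E : (O -> R) -> (O -> R) -> \bar R.
Hypothesis dE : dirichlet_form m E.

Let H := form_domain m E.
Let e u v := fine (E u v).
Let I (u : O -> R) : R := \int[m]_x (u : borel O -> R) x.
Let q (u : O -> R) : R := \int[m]_x ((u : borel O -> R) x ^+ 2).

Lemma form_domainDZ a u v : H u -> H v -> H (fun x => a * u x + v x).
Proof. by case: dE => _ [+ _ _] _ _ _; apply. Qed.

Lemma form_domainB u v : H u -> H v -> H (fun x => u x - v x).
Proof.
move=> Hu Hv; have := form_domainDZ (-1) Hv Hu.
by congr (H _); apply/funext => x; ring.
Qed.

Lemma form_domainZ a u : H u -> H (fun x => a * u x).
Proof.
move=> Hu; have := form_domainDZ a Hu (form_domain0 dE).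
by congr (H _); apply/funext => x; ring.
Qed.

Lemma form_finE u v : H u -> H v -> E u v = (e u v)%:E.
Proof. by move=> Hu Hv; rewrite fineK//; case: dE => _ [_ + _] _ _ _; apply. Qed.

Let eC u v : H u -> H v -> e u v = e v u.
Proof.
by move=> [Lu _] [Lv _]; congr fine; case: dE => -[_ + _] _ _ _ _; apply.
Qed.

Let eDZ a u v w : H u -> H v -> H w ->
  e (fun x => a * u x + v x) w = a * e u w + e v w.
Proof.
move=> Hu Hv Hw; apply: EFin_inj; rewrite EFinD EFinM -!form_finE//; last first.
  exact: form_domainDZ.
by case: dE => _ [_ _ +] _ _ _; apply.
Qed.

Let e_ge0 u : H u -> 0 <= e u u.
Proof. by move=> [Lu _]; rewrite fine_ge0//; case: dE => -[_ _ +] _ _ _ _; apply. Qed.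

Let eDZ2 a u v : H u -> H v -> e (fun x => a * u x + v x) (fun x => a * u x + v x)
  = a ^+ 2 * e u u + 2 * a * e u v + e v v.
Proof.
move=> Hu Hv; have Hw := form_domainDZ a Hu Hv.
by rewrite eDZ// [e u _]eC// [e v _]eC// !eDZ// [e v u]eC//; ring.
Qed.

Lemma form_domain_integrable u : H u -> m.-integrable setT (EFin \o u).
Proof.
by move=> [Lu _]; apply/Lfun1_integrable/Lfun_subset12 => //; exact: fin_num_measure.
Qed.

Let HI u : H u -> m.-integrable setT (EFin \o u).
Proof. exact: form_domain_integrable. Qed.

Let Hq u : H u -> m.-integrable setT (EFin \o (fun x : borel O => u x ^+ 2)).
Proof. by move=> [Lu _]; exact: Lfun2_integrable_sqr Lu. Qed.

Let sqnorm2E u : H u -> sqnorm2 m u = (q u)%:E.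
Proof. by move=> Hu; rewrite /q /Rintegral fineK//; apply/integrable_fin_num/Hq. Qed.

Let IDZ a u v : H u -> H v -> I (fun x => a * u x + v x) = a * I u + I v.
Proof.
move=> Hu Hv; rewrite /I RintegralD//; last 2 first.
- exact: HI (form_domainZ a Hu).
- exact: HI.
by rewrite RintegralZl//; exact: HI.
Qed.

(** The direct method for J(u) = E(u, u) + 2 int u dm: J is bounded below, a minimising sequence is
    Cauchy by the parallelogram law, the closedness of the form gives a limit, and the first
    variation of J vanishes there. *)
Lemma riesz_total_mass : poincare m E ->
  exists2 h, H h & forall v, H v -> (E h v = \int[m]_x (v x * -1)%:E)%E.
Proof.
move=> [Cp Cp0 pE].
have {}pE u : H u -> Cp^-1 * q u <= e u u.
  move=> Hu; have := pE _ Hu.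
  by rewrite sqnorm2E// form_finE// -EFinM lee_fin.
pose J u := e u u + 2 * I u.
pose mO := fine (m setT).
(* After the Poincare inequality, complete the square pointwise: u^2 / Cp + 2 u + Cp = (u + Cp)^2 /
   Cp >= 0. *)
have J_ge u : H u -> - (Cp * mO) <= J u.
  move=> Hu; have := pE _ Hu; rewrite /J.
  suff: - (Cp^-1 * q u + Cp * mO) <= 2 * I u by lra.
  rewrite /I /q /mO -(RintegralZl _ measurableT (Hq Hu)).
  rewrite -Rintegral_cst// -RintegralD//; last 2 first.
    exact: (integrableZl _ _ (Hq Hu)).
    exact: finite_measure_integrable_cst.
  have iS : m.-integrable setT (EFin \o (fun x : borel O => Cp^-1 * u x ^+ 2 + Cp)).
    apply: (@integrableD _ _ _ _ _ _ (fun x : borel O => (Cp^-1 * u x ^+ 2)%:E)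
      (cst Cp%:E)) => //.
    exact: (integrableZl _ _ (Hq Hu)).
    exact: finite_measure_integrable_cst.
  rewrite -mulN1r -(RintegralZl _ measurableT iS) -(RintegralZl _ measurableT (HI Hu)).
  apply: le_Rintegral => //.
  - exact: (integrableZl _ _ iS).
  - exact: (integrableZl _ _ (HI Hu)).
  - move=> x _; rewrite -subr_ge0.
    have -> : 2 * u x - -1 * (Cp^-1 * u x ^+ 2 + Cp) = Cp^-1 * (u x + Cp) ^+ 2.
      by field; lra.
    by rewrite mulr_ge0// ?sqr_ge0// invr_ge0 ltW.
have infJ : has_inf [set J u | u in H].
  split; first by exists (J (fun=> 0)); exists (fun=> 0) => //; exact: form_domain0.
  by exists (- (Cp * mO)) => _ [u Hu <-]; exact: J_ge.
set J0 := inf [set J u | u in H].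
have J0_le u : H u -> J0 <= J u.
  by move=> Hu; apply: ge_inf; [exact: infJ.2|exists u].
have /choice[u_ Hu_] : forall n : nat, exists u, H u /\ J u < J0 + n.+1%:R^-1.
  move=> n; have [|_ [u Hu <-] Ju] := @inf_adherent _ _ n.+1%:R^-1 _ infJ.
    by rewrite invr_gt0.
  by exists u.
have Hu n : H (u_ n) by case: (Hu_ n).
(* With the midpoint [w2], the parallelogram law reads e(u_k - u_n) = 2 J(u_k) + 2 J(u_n) - 4 J(w2),
   since the linear parts of J cancel; and J(w2) >= J0. *)
have cauchy k n : e (fun x => u_ k x - u_ n x) (fun x => u_ k x - u_ n x) <=
    2 * (k.+1%:R^-1 + n.+1%:R^-1).
  pose w := fun x => 1 * u_ k x + u_ n x.
  have Hw : H w by exact: form_domainDZ.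
  pose w2 := fun x => 2^-1 * w x.
  have Hw2 : H w2 by exact: form_domainZ.
  have Ew2 : e w2 w2 = 4^-1 * (e (u_ k) (u_ k) + 2 * e (u_ k) (u_ n) + e (u_ n) (u_ n)).
    have -> : w2 = fun x => 2^-1 * w x + (fun=> 0) x by apply/funext => x; rewrite addr0.
    have H00 := form_domain0 dE.
    rewrite eDZ2// eDZ2//.
    have -> : e w (fun=> 0) = 0 by rewrite /e (dirichlet0r dE Hw).
    have -> : e (fun=> 0) (fun=> 0) = 0 by rewrite /e (dirichlet0r dE H00).
    by field.
  have Iw2 : I w2 = 2^-1 * (I (u_ k) + I (u_ n)).
    by rewrite /I (RintegralZl _ measurableT (HI Hw)) -/(I w) IDZ// mul1r.
  have Ed : e (fun x => u_ k x - u_ n x) (fun x => u_ k x - u_ n x) =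
      e (u_ k) (u_ k) - 2 * e (u_ k) (u_ n) + e (u_ n) (u_ n).
    have -> : (fun x => u_ k x - u_ n x) = (fun x => -1 * u_ n x + u_ k x).
      by apply/funext => x; ring.
    by rewrite eDZ2// [e (u_ n) (u_ k)]eC//; ring.
  have := J0_le _ Hw2; have := (Hu_ k).2; have := (Hu_ n).2.
  rewrite Ed /J Ew2 Iw2.
  set kk := k.+1%:R^-1; set nn := n.+1%:R^-1; lra.
have [|v Hv uv] := (let: And5 _ _ _ c _ := dE in c) u_ Hu.
  move=> r r0.
  (* Closedness is stated for the energy plus the squared L^2 norm. The latter costs a factor Cp by
     the Poincare inequality, and (1 + Cp) * 2 * (c0 + c0) = r for this bound c0 on both
     inverses. *)
  have c0 : 0 < r / (4 * (1 + Cp)) by rewrite divr_gt0// mulr_gt0//; lra.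
  have [N _ N_] := near_infty_natSinv_lt (PosNum c0).
  exists N => k n Nk Nn.
  have Hd : H (fun x => u_ k x - u_ n x) by exact: form_domainB.
  rewrite form_finE// sqnorm2E// -EFinD lte_fin.
  have := pE _ Hd; rewrite ler_pdivrMl// => qd.
  have := cauchy k n; have := N_ _ Nk; have := N_ _ Nn => /=.
  set kk := k.+1%:R^-1; set nn := n.+1%:R^-1 => n_ k_ c_.
  apply: le_lt_trans (lerD (lexx _) qd) _.
  rewrite -[X in X + _]mul1r -mulrDl.
  have Cp10 : 0 < 1 + Cp by lra.
  apply: (@le_lt_trans _ _ ((1 + Cp) * (2 * (kk + nn)))).
    by rewrite ler_pM2l.
  rewrite -ltr_pdivlMl//.
  have -> : (1 + Cp)^-1 * r = 4 * (r / (4 * (1 + Cp))) by field; lra.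
  lra.
exists v => // w Hw.
suff: e v w = - I w.
  move=> evw; rewrite form_finE// evw.
  rewrite (eq_integral (fun x : borel O => (-1)%:E * (w x)%:E)%E); last first.
    by move=> x _; rewrite -EFinM mulrC.
  rewrite integralZl//; last exact: HI.
  by rewrite mulN1e /I /Rintegral EFinN fineK//; apply/integrable_fin_num/HI.
set c := e w w; pose a := e v w + I w.
have c0 : 0 <= c by exact: e_ge0.
(* This is the first variation of J in the direction w. The coefficient of t^2 is 2 c instead of c
   because half of it pays for replacing the minimising sequence by its limit v. *)
suff key t : 0 <= 2 * t ^+ 2 * c + 2 * t * a.
  have c1 : c + 1 != 0 by lra.
  (* Up to the shift of c by 1, which avoids dividing by 0 when w has no energy, this t minimises
     the quadratic up to a constant factor; a negative multiple of a^2 results. *)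
  have := key (- a / (2 * (c + 1))).
  have -> : 2 * (- a / (2 * (c + 1))) ^+ 2 * c + 2 * (- a / (2 * (c + 1))) * a
    = - (a ^+ 2 * ((c + 2) / (2 * (c + 1) ^+ 2))).
    by field.
  rewrite oppr_ge0 pmulr_lle0; last by rewrite divr_gt0 ?mulr_gt0 ?exprn_gt0//; lra.
  move=> a2; have : a ^+ 2 == 0 by rewrite eq_le a2 sqr_ge0.
  by rewrite sqrf_eq0 => /eqP; rewrite /a; lra.
apply/ler_addgt0Pr => r r0.
pose d n := fun x => u_ n x - v x.
have Hd n : H (d n) by exact: form_domainB.
have r20 : 0 < r / 2 by lra.
have near_d : \forall n \near \oo, e (d n) (d n) < r / 2.
  have : \forall n \near \oo,
      (E (d n) (d n) + sqnorm2 m (d n) < (r / 2)%:E)%E.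
    apply: (uv [set x | x < (r / 2)%:E]%E); apply: open_nbhs_nbhs.
    by split; [exact: open_ereal_lt_ereal|rewrite /= lte_fin].
  apply: filterS => n; rewrite form_finE// sqnorm2E// -EFinD lte_fin.
  apply: le_lt_trans; rewrite lerDl; apply: Rintegral_ge0 => x _.
  exact: sqr_ge0.
have [n [dn nn]] : exists n, e (d n) (d n) < r / 2 /\ n.+1%:R^-1 < r / 2.
  near \oo => n; exists n; split; near: n => //.
  exact: near_infty_natSinv_lt (PosNum r20).
have Htw : H (fun x => t * w x + u_ n x) by exact: form_domainDZ.
have := J0_le _ Htw; have := (Hu_ n).2.
rewrite /J eDZ2// IDZ// => Jn J0n.
have ewu : e w (u_ n) = e w (d n) + e v w.
  have -> : u_ n = fun x => 1 * d n x + v x by apply/funext => x; rewrite /d; ring.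
  by rewrite eC ?eDZ//; [rewrite eC// mul1r|exact: form_domainDZ].
(* Positivity bounds the cross term 2 t e(w, d_n) by t^2 c + e(d_n, d_n), so neither continuity of e
   nor the Cauchy-Schwarz inequality has to be invoked. *)
have : 0 <= e (fun x => - t * w x + d n x) (fun x => - t * w x + d n x).
  by apply: e_ge0; exact: form_domainDZ.
rewrite eDZ2//; move: J0n Jn nn dn; rewrite ewu -/c /a.
set N := n.+1%:R^-1; nra.
Unshelve. all: by end_near. Qed.

(* Truncating [k = - h] to [0, n] does not increase the energy, so that
   minimality of [h] gives [int k_n <= int k]; let [n] tend to infinity. *)
Lemma potential_total_mass_le0 h : H h ->
  (forall v, H v -> E h v = \int[m]_x (v x * -1)%:E)%E ->
  {ae m, forall x, h x <= 0}.
Proof.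
move=> Hh hE.
have ehv v : H v -> e h v = - I v.
  move=> Hv; rewrite /e hE// (eq_integral (fun x : borel O => (-1)%:E * (v x)%:E)%E).
    rewrite integralZl//; last exact: HI.
    by rewrite fineM//; [rewrite /= mulN1r|apply/integrable_fin_num/HI].
  by move=> x _; rewrite -EFinM mulrC.
have eZ a u : H u -> e (fun x => a * u x) (fun x => a * u x) = a ^+ 2 * e u u.
  move=> Hu; have H00 := form_domain0 dE.
  have -> : (fun x => a * u x) = fun x => a * u x + (fun=> 0) x.
    by apply/funext => x; rewrite addr0.
  by rewrite eDZ2// /e (dirichlet0r dE Hu) (dirichlet0r dE H00) mulr0 !addr0.
pose k := fun x => -1 * h x.
have Hk : H k by exact: form_domainZ.
(* The Markov property only clips to [0, 1]. Dividing k by n + 1, clipping and scaling back clips k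
   to [0, n + 1], again without raising the energy. *)
pose kn (n : nat) x := n.+1%:R * Num.min (Num.max (n.+1%:R^-1 * k x) 0) 1.
have Hkn_ n : H (kn n) /\ e (kn n) (kn n) <= e h h.
  have Hc : H (fun x => n.+1%:R^-1 * k x) by exact: form_domainZ.
  have [Hc' Ec] := (let: And5 _ _ _ _ c := dE in c) _ Hc.
  have Hkn : H (kn n) by exact: form_domainZ.
  split => //; rewrite eZ//.
  move: Ec; rewrite !form_finE// lee_fin eZ// eZ// sqrrN expr1n mul1r => Ec.
  apply: le_trans (ler_wpM2l _ Ec) _; first exact: sqr_ge0.
  by rewrite mulrA -exprMn divff ?expr1n ?mul1r// pnatr_eq0.
have Hkn n : H (kn n) by case: (Hkn_ n).
(* Positivity of the energy of h + k_n gives 0 <= e(h, h) - 2 I(k_n) + e(k_n, k_n) <= 2 e(h, h) - 2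
   I(k_n), and e(h, h) = - I(h) = I(k). *)
have Ikn n : I (kn n) <= I k.
  have := e_ge0 (form_domainDZ 1 Hh (Hkn n)).
  rewrite eDZ2// ehv// ehv//.
  have := (Hkn_ n).2; rewrite [e h h]ehv//.
  rewrite [X in _ -> _ -> _ <= X](_ : _ = - I h); last first.
    by rewrite /I (RintegralZl _ measurableT (HI Hh)) mulN1r.
  lra.
have knE n x : `|k x| <= n%:R -> kn n x = Num.max (k x) 0.
  move=> kxn; have n0 : 0 < n.+1%:R :> R by rewrite ltr0n.
  rewrite /kn; have -> : Num.max (n.+1%:R^-1 * k x) 0 = n.+1%:R^-1 * Num.max (k x) 0.
    by rewrite maxr_pMr ?mulr0// invr_ge0 ltW.
  rewrite minr_pMr ?ltW// mulr1 mulrA divff ?gt_eqF// mul1r min_l//.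
  rewrite ge_max ler0n andbT (le_trans (ler_norm _))// (le_trans kxn)//.
  by rewrite ler_nat.
have knk n x : `|kn n x| <= `|k x|.
  have n0 : 0 < n.+1%:R :> R by rewrite ltr0n.
  rewrite /kn normrM gtr0_norm// -ler_pdivlMl//.
  rewrite -[leRHS](_ : `|n.+1%:R^-1 * k x| = _); last first.
    by rewrite normrM gtr0_norm// invr_gt0.
  set y := _^-1 * _; rewrite ger0_norm; last first.
    by rewrite le_min ler01 le_max lexx orbT.
  by rewrite ge_min ge_max ler_norm normr_ge0.
have mI u : H u -> measurable_fun [set: borel O] (EFin \o u).
  by move=> /HI /measurable_int.
have [||||ikp _ cvgI] := @dominated_convergence _ (borel O) R m setT measurableT
    (fun n => EFin \o kn n) (fun x => (Num.max (k x) 0)%:E)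
    (fun x => `|k x|%:E) (fun n => mI _ (Hkn n)).
- apply/measurable_EFinP; apply: measurable_maxr => //.
  by have /measurable_EFinP := mI _ Hk.
- apply: aeW => x _; apply: cvg_near_cst.
  exists (Num.truncn `|k x|).+1 => // n /= xn; rewrite knE//.
  by rewrite (le_trans (ltW (truncnS_gt _)))// ler_nat.
- exact: (integrable_abse (HI Hk)).
- by apply: aeW => x n _; rewrite lee_fin knk.
have Ikp : \int[m]_x (Num.max (k x) 0) <= I k.
  rewrite -lee_fin {1}/Rintegral fineK; last exact: integrable_fin_num.
  rewrite -(cvg_lim _ cvgI)//; apply: lime_le; first by apply/cvg_ex; eexists; exact: cvgI.
  apply: nearW => n; apply: le_trans (_ : (I (kn n))%:E <= _)%E; last by rewrite lee_fin.
  by rewrite /I /Rintegral fineK//; apply/integrable_fin_num/HI.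
pose w x := Num.max (k x) 0 - k x.
have w0 x : 0 <= w x by rewrite subr_ge0 le_max lexx.
have iw : m.-integrable setT (EFin \o (w : borel O -> R)).
  exact: (integrableB _ ikp (HI Hk)).
have Iw : \int[m]_x (w : borel O -> R) x = 0.
  apply/eqP; rewrite eq_le Rintegral_ge0 ?andbT; last by move=> x _; exact: w0.
  by rewrite /w RintegralB// ?subr_le0//; exact: HI.
have /(ae_eq_integral_abs _ measurableT (measurable_int _ iw)) aew :
    (\int[m]_x `|(EFin \o w) x| = 0)%E.
  rewrite (eq_integral (EFin \o (w : borel O -> R))).
    by rewrite -[RHS](congr1 EFin Iw) /Rintegral fineK//; exact: integrable_fin_num.
  by move=> x _; rewrite gee0_abs// lee_fin.
apply: filterS aew => x /(_ Logic.I) [] /eqP.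
rewrite /w subr_eq0 => /eqP kx; have : 0 <= k x by rewrite -kx le_max lexx orbT.
by rewrite /k mulN1r oppr_ge0.
Qed.

End energy.

(** * From classes to functions: existence and uniqueness of the potential *)

Lemma ae_gt0_all d (T : measurableType d) (R : realType)
    (mu : {measure set T -> \bar R}) (Q : T -> Prop) :
  (forall x : T, measurable [set x]) -> (forall x, (0 < mu [set x])%E) ->
  {ae mu, forall x, Q x} -> forall x, Q x.
Proof.
move=> m1 mu1 [N [mN N0 QN]] x; apply: contrapT => nQ.
have : (mu [set x] <= mu N)%E.
  apply: le_measure; rewrite ?mem_set// => y ->; exact: QN.
by rewrite N0 leNgt mu1.
Qed.

Lemma continuous_lscN (R : realType) (T : topologicalType) (f : T -> R) :
  lower_semicontinuous (EFin \o f) ->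
  lower_semicontinuous (EFin \o (fun x => - f x)) -> continuous f.
Proof.
move=> lf lNf x; apply/cvgrPdist_lt => e e0.
have [V Vx fV] := lf x (f x - e) (ltac:(rewrite /= lte_fin; lra)).
have [V' Vx' fV'] := lNf x (- f x - e) (ltac:(rewrite /= lte_fin; lra)).
apply: filterS (filterI Vx Vx') => y [/fV /= + /fV' /=].
by rewrite !lte_fin ltr_norml => ? ?; apply/andP; split; lra.
Qed.

Section solution.
Context {R : realType} {O : completeMetricType R}.
Variable m : {finite_measure set (borel O) -> \bar R}.
Variable E : (O -> R) -> (O -> R) -> \bar R.
Hypothesis dE : dirichlet_form m E.
Hypothesis pE : poincare m E.
Hypothesis veE : viscosity_weak_equivalence m E.

Let H := form_domain m E.

Lemma generator_weak_eq h : generator m E h (fun=> 1) -> weak_eq m E h (fun=> 1).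
Proof.
move=> [Hh L1 hE]; split => // f [_ Hf _].
have -> : E f h = E h f.
  by case: dE => -[_ + _] _ _ _ _; apply; [case: Hf|case: Hh].
rewrite hE//.
rewrite -integralN; last first.
  apply: integrable_add_def => //.
  by under eq_fun do rewrite mul1r; exact: form_domain_integrable Hf.
by apply: eq_integral => x _; rewrite -EFinN mul1r mulrN1.
Qed.

(** The equivalence asks for an upper bound before it yields a lower semicontinuous version. For h
    the bound is 0, by the sign of the potential; for - h it is the bound of the version of h just
    found, so the two applications must come in this order. Both versions agree with h and - h at
    every point because every point is charged. *)
Lemma exists_solution : exists h, H0 m E h /\ generator m E h (fun=> 1).
Proof.
have m1 := viscosity_weak_gt0 dE veE.
have [h Hh hE] := riesz_total_mass dE pE.
have LN1 : LSCb (fun _ : O => -1 : R) := LSCb_cst _.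
have L1 : LSCb (fun _ : O => 1 : R) := LSCb_cst _.
have L2c (c : R) : L2 m (fun=> c) by exact: Lfun_cst.
have Ch : generator m E h (fun=> 1) by split.
have fh f : H0 m E f -> E f h = (- (\int[m]_x (1 * f x)%:E))%E.
  by move=> Hf; have [_ _ ->] := generator_weak_eq Ch.
have [hs [Lhs _ hsh]] : exists psi', [/\ LSCb psi', viscosity_le m E psi' (fun=> 1)
    & {ae m, forall x, psi' x = h x}].
  apply: (veE L1 (L2c _)).2 => //.
    by exists 0; exact: potential_total_mass_le0 Hh hE.
  by split => // f Hf f0; rewrite fh.
have {hsh} hsE := ae_gt0_all (@borel_measurable_set1 _ _) m1 hsh.
have HNh : H (fun x => - h x).
  have := form_domainZ dE (-1) Hh.
  by congr (H _); apply/funext => x; rewrite mulN1r.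
have [hi [Lhi _ hih]] : exists psi', [/\ LSCb psi', viscosity_le m E psi' (fun=> -1)
    & {ae m, forall x, psi' x = - h x}].
  apply: (veE LN1 (L2c _)).2 => //.
    have [_ [c hc]] := Lhs; exists c; apply: aeW => x.
    by rewrite -hsE (le_trans (ler_norm _))// normrN.
  split => // f Hf f0.
  have -> : E f (fun x => - h x) = (- E f h)%E.
    have Hf' : H f by case: Hf.
    have L2f := proj1 Hf'; have L2h := proj1 Hh; have L2Nh := proj1 HNh.
    case: (dE) => -[_ sym _] [_ fin bil] _ _ _.
    rewrite sym//; have := bil (-1) _ _ f Hh (form_domain0 dE) Hf'.
    rewrite (_ : (fun x => _) = (fun x => - h x)); last by apply/funext => x; ring.
    move=> ->; rewrite (sym _ _ (L2c 0) L2f) (dirichlet0r dE Hf').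
    by rewrite adde0 mulN1e sym.
  rewrite fh// oppeK -integralN; last first.
    apply: integrable_add_def => //.
    under eq_fun do rewrite mulN1r.
    by apply: (integrableN (form_domain_integrable _)); case: Hf => _ + _; exact.
  rewrite le_eqVlt; apply/orP; left; apply/eqP; apply: eq_integral => x _.
  by rewrite -EFinN mulN1r opprK mul1r.
have {hih} hiE := ae_gt0_all (@borel_measurable_set1 _ _) m1 hih.
exists h; split => //; split => //; last by exists (fun=> 1); [exact: Cb_cst|].
have hsh : hs = h by apply/funext.
split; last by rewrite -hsh; case: Lhs.
apply: continuous_lscN; first by rewrite -hsh; case: Lhs.
by have <- : hi = (fun x => - h x); [apply/funext|case: Lhi].
Qed.

Lemma solution_unique h h' : H0 m E h -> weak_eq m E h (fun=> 1) ->
  H0 m E h' -> weak_eq m E h' (fun=> 1) -> h' = h.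
Proof.
move=> Hh [_ _ hE] Hh' [_ _ hE'].
have m1 := viscosity_weak_gt0 dE veE.
have [Ch Dh _] := Hh; have [Ch' Dh' _] := Hh'.
pose w x := h' x - h x.
have Hw : H w by exact: form_domainB.
have Ew : E w w = 0%E.
  have L2h := proj1 Dh; have L2h' := proj1 Dh'; have L2w := proj1 Hw.
  case: (dE) => -[_ sym _] [_ fin bil] _ _ _.
  have wE u : H u -> (E w u = (-1)%:E * E h u + E h' u)%E.
    move=> Hu; have := bil (-1) _ _ _ Dh Dh' Hu.
    by rewrite (_ : (fun x => _) = w)//; apply/funext => x; rewrite /w; ring.
  (* Both weak equations may be tested with both functions, so E(f, h) = E(f, h') for f = h and f =
     h'. The four terms of E(w, w) therefore cancel. *)
  rewrite wE// [E h w]sym// [E h' w]sym// !wE//.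
  rewrite [E h h']hE'// [E h' h']hE'// [E h' h]hE// [E h h]hE//.
  set a := (- _)%E; set b := (- \int[m]_x (1 * h' x)%:E)%E.
  have afin : a \is a fin_num by rewrite /a -hE//; exact: fin.
  have bfin : b \is a fin_num by rewrite /b -hE//; exact: fin.
  rewrite -(fineK afin) -(fineK bfin) -!EFinM -!EFinD.
  by congr EFin; ring.
have [Cp Cp0 /(_ _ Hw)] := pE.
rewrite Ew pmule_rle0 ?lte_fin ?invr_gt0// => w2le.
have iw : m.-integrable setT (EFin \o (fun x : borel O => w x ^+ 2)).
  by apply: Lfun2_integrable_sqr; case: Hw.
have /(ae_eq_integral_abs _ measurableT (measurable_int _ iw)) aew :
    (\int[m]_x `|(EFin \o (fun x : borel O => (w x ^+ 2)%R)) x| = 0)%E.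
  apply/eqP; rewrite eq_le integral_ge0//= andbT.
  apply: le_trans w2le; rewrite /sqnorm2 le_eqVlt; apply/orP; left; apply/eqP.
  by apply: eq_integral => x _; rewrite ger0_norm ?sqr_ge0.
have w0 x : w x = 0.
  have := ae_gt0_all (@borel_measurable_set1 _ _) m1 aew x.
  by move=> /(_ I) [] /eqP; rewrite sqrf_eq0 => /eqP.
by apply/funext => x; apply/eqP; rewrite -subr_eq0; apply/eqP; exact: w0.
Qed.

End solution.

(** * Topology and Borel sets of the state space with its cemetery *)

Section cemetery_topology.
Context {R : realType} {O : completeMetricType R}.

Lemma Cb_ext0 (h : O -> R) : Cb h -> Cb (ext0 h : cem O -> R).
Proof.
move=> [ch [c hc]]; split; last first.
  exists `|c| => -[x|] /=; last by rewrite normr0.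
  by rewrite (le_trans (hc x))// ler_norm.
apply/continuousP => A oA.
by move/continuousP : ch => /(_ _ oA); exact.
Qed.

Lemma borel_cem_measurable_set1 (x : borel (cem O)) : measurable [set x].
Proof.
case: x => [x|].
  rewrite -[X in measurable X]setCK; apply: measurableC.
  apply: sub_sigma_algebra; rewrite /open/= /cem_open.
  rewrite (_ : _ @^-1` _ = ~` [set x]).
    exact/closed_openC/closed_set1_metric.
  by apply/seteqP; split => y /=; [apply: contra_not => ->|apply: contra_not => -[]].
apply: sub_sigma_algebra; rewrite /open/= /cem_open.
by rewrite (_ : _ @^-1` _ = set0); [exact: open0|apply/seteqP; split].
Qed.

Lemma cem_countable : countable [set: O] -> countable [set: cem O].
Proof.
move=> cO; rewrite (_ : setT = \bigcup_(b in [set: bool])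
   (if b then [set None] else Some @` setT)).
  apply: bigcup_countable => // -[] _; first exact: countable1.
  exact: sub_countable (card_image_le _ _) cO.
apply/seteqP; split => // -[x|] _; first by exists false => //; exists x.
by exists true.
Qed.

(** This is how countability of O is used: every function of the state is Borel, in particular one
    obtained as a supremum over stopping times. *)
Lemma cem_measurable (B : set (borel (cem O))) : countable [set: O] -> measurable B.
Proof.
move=> cO; apply: countable_measurable; first exact: borel_cem_measurable_set1.
apply: sub_countable (cem_countable cO); exact: subset_card_le.
Qed.

End cemetery_topology.

Section rays.
Context d (T : measurableType d) (R : realType).

Lemma measurable_fun_ge_rays (f : T -> R) :
  (forall a, measurable [set x | f x <= a]) -> measurable_fun setT f.
Proof.
move=> mf; apply: (measurability _ (RGenOInfty.measurableE R)) => //.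
move=> _ [_ [a ->] <-]; rewrite setTI.
rewrite (_ : _ @^-1` _ = ~` [set x | f x <= a]); first exact: measurableC.
by apply/seteqP; split => x /=; rewrite in_itv/= andbT ltNge => /negP.
Qed.

Lemma emeasurable_fun_ge_rays (f : T -> \bar R) :
  (forall a : R, measurable [set x | (f x <= a%:E)%E]) -> measurable_fun setT f.
Proof.
move=> mf; apply: (measurability _ (ErealGenOInfty.measurableE R)) => //.
move=> _ [_ [a ->] <-]; rewrite setTI.
rewrite (_ : _ @^-1` _ = ~` [set x | (f x <= a%:E)%E]); first exact: measurableC.
by apply/seteqP; split => x /=; rewrite in_itv/= andbT ltNge => /negP.
Qed.

End rays.

(** * Processes in continuous time *)

Section dyadic_times.
Context {R : realType}.
Implicit Types (t : R) (n k : nat).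

Definition dyadic_index n t : nat := `|Num.ceil (2 ^+ n * t)|%N.

(* The event [dyadic_up n t <= k / 2 ^ n] only involves [t <= (k - 1) / 2 ^ n],
   so that [dyadic_up n] maps stopping times to stopping times. *)
Definition dyadic_up n t : R := (dyadic_index n t).+1%:R / 2 ^+ n.

Lemma dyadic_index_le n k t : 0 <= t ->
  (dyadic_index n t <= k)%N = (t <= k%:R / 2 ^+ n).
Proof.
move=> t0; have p0 : 0 < 2 ^+ n :> R by rewrite exprn_gt0.
have c0 : 0 <= Num.ceil (2 ^+ n * t).
  by rewrite ceil_ge0// (lt_le_trans (ltrN10 _))// mulr_ge0// ltW.
rewrite /dyadic_index -lez_nat gez0_abs//.
by rewrite ceil_le_int// ler_pdivlMr// mulrC.
Qed.

Lemma dyadic_up_gt n t : 0 <= t -> t < dyadic_up n t.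
Proof.
move=> t0; have := dyadic_index_le n (dyadic_index n t) t0.
rewrite leqnn => /esym/le_lt_trans; apply.
by rewrite ltr_pM2r ?ltr_nat// invr_gt0 exprn_gt0.
Qed.

Lemma dyadic_up_le n t : 0 <= t -> dyadic_up n t <= t + 2 / 2 ^+ n.
Proof.
move=> t0; have p0 : 0 < 2 ^+ n :> R by rewrite exprn_gt0.
rewrite /dyadic_up; case E : (dyadic_index n t) => [|k].
  by rewrite -[leLHS]add0r lerD// ler_pM2r ?invr_gt0// ler1n.
have : ~~ (dyadic_index n t <= k)%N by rewrite E ltnn.
rewrite dyadic_index_le// -ltNge => /ltW kt.
rewrite -addn2 natrD mulrDl lerD//.
Qed.

Lemma dyadic_up_ge0 n t : 0 <= dyadic_up n t.
Proof. by rewrite divr_ge0// exprn_ge0. Qed.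

(** The filter [t^'+] excludes t, so the approximation has to stay strictly above t. This is a
    second reason for adding 1 to the index in [dyadic_up]. *)
Lemma cvg_dyadic_up t : 0 <= t -> dyadic_up n t @[n --> \oo] --> t^'+.
Proof.
move=> t0 A; rewrite /at_right /within /= => tA.
have [e /= e0 eA] := tA.
have e20 : 0 < e / 2 by rewrite divr_gt0.
have : (fun n => 2^-1 ^+ n : R) @ \oo --> 0.
  by apply: cvg_expr; rewrite ger0_norm// invf_lt1// ltr1n.
move=> /cvgrPdist_lt /(_ _ e20) [N _ NP]; exists N => // n Nn.
apply: eA; last exact: dyadic_up_gt.
rewrite /= ltr_distlC; have := NP _ Nn; rewrite /= sub0r normrN ger0_norm ?exprn_ge0//.
rewrite exprVn => h; have := dyadic_up_gt n t0; have := dyadic_up_le n t0.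
move=> h1 h2; apply/andP; split; first by lra.
by apply: le_lt_trans h1 _; rewrite ltrD2l; lra.
Qed.

End dyadic_times.

Section joint_measurability.
Context d (W : measurableType d) (R : realType).

Lemma measurable_nonneg_time : measurable (@nonneg_time d W R).
Proof.
rewrite (_ : nonneg_time = `[0, +oo[%classic `*` setT); first exact: measurableX.
by apply/seteqP; split => -[t w]; rewrite /nonneg_time/= in_itv/= andbT// => -[].
Qed.

(** Evaluated at [dyadic_up n t], the process is on each dyadic strip of times a function of the
    second variable alone, hence jointly measurable; right continuity makes it the pointwise
    limit. *)
Lemma measurable_fun_right_continuous (Y : R -> W -> R) :
  (forall t, 0 <= t -> measurable_fun setT (Y t)) ->
  (forall w t, 0 <= t -> Y s w @[s --> t^'+] --> Y t w) ->
  measurable_fun nonneg_time (fun z : R * W => Y z.1 z.2).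
Proof.
move=> mY rY.
apply: (@measurable_fun_cvg _ _ _ _ (fun n z => Y (dyadic_up n z.1) z.2)); last first.
  by move=> -[t w] /= t0; exact: (cvg_comp _ _ (cvg_dyadic_up t0) (rY w t t0)).
move=> n _ B mB.
rewrite (_ : _ `&` _ = \bigcup_k ((nonneg_time `&`
    ([set s | dyadic_index n s = k] `*` setT)) `&`
    (setT `*` (Y (k.+1%:R / 2 ^+ n) @^-1` B)))).
  apply: bigcupT_measurable => k; apply: measurableI; last first.
    apply: measurableX => //; rewrite -[X in measurable X]setTI.
    by apply: mY => //; rewrite divr_ge0// exprn_ge0.
  have mle j : measurable [set z : R * W | 0 <= z.1 /\ (dyadic_index n z.1 <= j)%N].
    rewrite (_ : mkset _ = `[0, j%:R / 2 ^+ n] `*` setT); first exact: measurableX.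
    apply/seteqP; split => -[t w] /=; rewrite in_itv/=.
      by move=> [t0]; rewrite dyadic_index_le// t0 => ->.
    by move=> [/andP[t0 tj] _]; rewrite dyadic_index_le.
  case: k => [|k].
    rewrite (_ : _ `&` _ = [set z : R * W | 0 <= z.1 /\ (dyadic_index n z.1 <= 0)%N])//.
    apply/seteqP; split => -[t w] /=; first by move=> [? [-> _]].
    by rewrite leqn0 => -[? /eqP ->].
  rewrite (_ : _ `&` _ = [set z : R * W | 0 <= z.1 /\ (dyadic_index n z.1 <= k.+1)%N] `\`
    [set z : R * W | 0 <= z.1 /\ (dyadic_index n z.1 <= k)%N]); first exact: measurableD.
  apply/seteqP; split => -[t w] /=; rewrite /nonneg_time/=.
    by move=> [? [-> _]]; split => // -[_]; rewrite ltnn.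
  move=> [[t0 tk] ntk]; split => //; split => //; apply/eqP; rewrite eqn_leq tk ltnNge.
  by apply/negP => h; apply: ntk.
apply/seteqP; split => -[t w] /=.
  by move=> [t0 YB]; exists (dyadic_index n t).
by move=> [k _ [[t0 [tk _]] [_ YB]]]; split => //; rewrite /dyadic_up tk.
Qed.

End joint_measurability.

Section sub_sigma_algebra.
Context d (W : measurableType d) (R : realType).
Variable G : set (set W).
Hypothesis sG : sigma_algebra setT G.

Let GE : (G.-sigma).-measurable = G :> set (set (g_sigma_algebraType G)).
Proof. exact: sigma_algebra_id. Qed.

(** The measurable sets of [g_sigma_algebraType G] are exactly G, so that general measurability
    results become available for a sub-sigma-algebra. *)
Lemma meas_wrtP (Y : W -> \bar R) :
  meas_wrt G Y <-> measurable_fun setT (Y : g_sigma_algebraType G -> \bar R).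
Proof.
split=> [mY _ B mB|mY B mB]; first by rewrite setTI GE; exact: mY.
by rewrite -GE -[X in measurable X]setTI; exact: mY.
Qed.

Lemma meas_wrt_EFinP (Y : W -> R) :
  meas_wrt G (EFin \o Y) <-> measurable_fun setT (Y : g_sigma_algebraType G -> R).
Proof. by rewrite meas_wrtP; exact: measurable_EFinP. Qed.

Lemma sub_sigma_measurable_fun d' (U : measurableType d') (Y : W -> U) :
  G `<=` measurable -> measurable_fun setT (Y : g_sigma_algebraType G -> U) ->
  measurable_fun setT Y.
Proof.
move=> Gm mY _ B mB; rewrite setTI; apply: Gm; rewrite -GE.
by rewrite -[X in measurable X]setTI; exact: mY.
Qed.

Lemma sigma_setU A B : G A -> G B -> G (A `|` B).
Proof.
rewrite -GE; exact: (@measurableU _ (g_sigma_algebraType G)).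
Qed.

Lemma sigma_setI A B : G A -> G B -> G (A `&` B).
Proof. rewrite -GE; exact: (@measurableI _ (g_sigma_algebraType G)). Qed.

Lemma sigma_setD A B : G A -> G B -> G (A `\` B).
Proof. rewrite -GE; exact: (@measurableD _ (g_sigma_algebraType G)). Qed.

Lemma sigma_setT : G setT.
Proof. rewrite -GE; exact: (@measurableT _ (g_sigma_algebraType G)). Qed.

End sub_sigma_algebra.

Section filtered_process.
Context {d} {W : measurableType d} {R : realType} {O : completeMetricType R}.

Definition filtration (F : R -> set (set W)) :=
  (forall t, 0 <= t -> sigma_algebra setT (F t) /\ F t `<=` measurable) /\
  (forall s t, 0 <= s -> s <= t -> F s `<=` F t).

Lemma measurable_stopping_time F (sigma : W -> R) :
  filtration F -> stopping_time F sigma -> measurable_fun setT sigma.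
Proof.
move=> [Fs _] [s0 sF]; apply: measurable_fun_ge_rays => a.
have [a0|a0] := leP 0 a; first exact/(Fs _ a0).2/sF.
rewrite (_ : mkset _ = set0)//; apply/seteqP; split => // w /= wa.
by have := s0 w; lra.
Qed.

Lemma stopping_time_cst F (t : R) : filtration F -> 0 <= t ->
  stopping_time F (fun=> t).
Proof.
move=> [Fs _] t0; split => // s s0; have [sF _] := Fs _ s0.
have [ts|ts] := leP t s.
  rewrite (_ : mkset _ = setT); first exact: sigma_setT.
  by apply/seteqP; split.
rewrite (_ : mkset _ = set0); first by case: sF.
by apply/seteqP; split => // w /=; rewrite leNgt ts.
Qed.

Lemma cadlag_Cb (X : W -> cadlag_path R (cem O)) (f : cem O -> R) w t : Cb f ->
  0 <= t -> f (X w s) @[s --> t^'+] --> f (X w t).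
Proof.
move=> [cf _] t0; have [rc _] := path_cadlag (X w).
by apply: continuous_cvg; [exact: cf|exact: rc].
Qed.

Variables (F : R -> set (set W)) (X : W -> cadlag_path R (cem O)).
Hypothesis fF : filtration F.
Hypothesis aX : adapted F X.
Hypothesis cO : countable [set: O].

Lemma adapted_fun (f : cem O -> R) t : 0 <= t ->
  measurable_fun setT ((fun w => f (X w t)) : g_sigma_algebraType (F t) -> R).
Proof.
move=> t0 _ B mB; rewrite setTI.
have [sF _] := fF.1 _ t0.
suff : F t ((fun w => f (X w t)) @^-1` B).
  by rewrite -[X in X _ -> _](sigma_algebra_id sF).
exact: (aX t0 (cem_measurable (f @^-1` B) cO)).
Qed.

Lemma measurable_adapted (f : cem O -> R) t : 0 <= t ->
  measurable_fun setT (fun w => f (X w t)).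
Proof.
move=> t0; have [sF Fm] := fF.1 _ t0.
exact: (sub_sigma_measurable_fun sF Fm (adapted_fun f t0)).
Qed.

Lemma measurable_process_Cb (f : cem O -> R) : Cb f ->
  measurable_fun nonneg_time (fun z : R * W => f (X z.2 z.1)).
Proof.
move=> Cf.
apply: (measurable_fun_right_continuous (Y := fun t w => f (X w t))).
  by move=> t; exact: measurable_adapted.
by move=> w t t0; exact: cadlag_Cb Cf t0.
Qed.

End filtered_process.

Section lifetime.
Context {R : realType} {O : completeMetricType R}.
Implicit Types (p : cadlag_path R (cem O)) (t : R).

(** The extension by 0 of Delta h = 1. Its time integral is the compensator of h along a path, and
    it measures the time spent before killing. *)
Definition alive (x : cem O) : R := ext0 (fun=> 1) x.

Lemma Cb_alive : Cb alive.
Proof. exact/Cb_ext0/Cb_cst. Qed.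

Lemma aliveE x : alive x = \1_[set y : cem O | y <> None] x.
Proof.
rewrite /alive indicE; case: x => [x|] /=; first by rewrite mem_set.
by rewrite memNset.
Qed.

Lemma lifetime_ge0 p : (0 <= lifetime p)%E.
Proof. by apply: le_ereal_inf_tmp => _ [t [t0 _] <-]; rewrite lee_fin. Qed.

Lemma lifetime_le p t : 0 <= t -> p t = None -> (lifetime p <= t%:E)%E.
Proof. by move=> t0 pt; apply: ereal_inf_lbound; exists t. Qed.

End lifetime.

Section killed_clock.
Context {W : Type} {R : realType} {O : completeMetricType R}.
Variable X : W -> cadlag_path R (cem O).
Implicit Types (w : W) (t : R).

Lemma killed_clock_EFin t w :
  (killed_clock X t w)%:E = Order.min t%:E (lifetime (X w)).
Proof.
rewrite /killed_clock fineK//; have := lifetime_ge0 (X w).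
by case: (lifetime _) => [r| |]//= _; [rewrite -EFin_min|rewrite min_l// leey].
Qed.

Lemma killed_clock_le t w : killed_clock X t w <= t.
Proof. by rewrite -lee_fin killed_clock_EFin ge_min lexx. Qed.

Lemma killed_clock_ge0 t w : 0 <= t -> 0 <= killed_clock X t w.
Proof. by move=> t0; rewrite -lee_fin killed_clock_EFin le_min lee_fin t0 lifetime_ge0. Qed.

Lemma killed_clock_minE t w : lifetime (X w) \is a fin_num ->
  killed_clock X t w = Num.min t (fine (lifetime (X w))).
Proof.
move=> fw; apply: EFin_inj; rewrite killed_clock_EFin EFin_min fineK//.
Qed.

Lemma killed_clock_right_continuous w t :
  killed_clock X s w @[s --> t^'+] --> killed_clock X t w.
Proof.
apply: cvg_at_right_filter.
have [fw|nfw] := boolP (lifetime (X w) \is a fin_num).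
  have -> : (killed_clock X)^~ w = fun s => Num.min s (fine (lifetime (X w))).
    by apply/funext => s; exact: killed_clock_minE.
  rewrite killed_clock_minE//; set c := fine _.
  exact: (@continuous_min R R id (cst c) t (@cvg_id _ _) (@cvg_cst _ _ _ _ _)).
have kE s : killed_clock X s w = s.
  apply: EFin_inj; rewrite killed_clock_EFin.
  move: nfw (lifetime_ge0 (X w)); case: (lifetime _) => [r| |]//= _ _.
  by rewrite min_l// leey.
have -> : (killed_clock X)^~ w = id by apply/funext.
by rewrite kE; exact: cvg_id.
Qed.

End killed_clock.

(** * Image measures and integrals over countable partitions *)

Section change_of_variables.
Context d1 d2 (Z : measurableType d1) (Y : measurableType d2) (R : realType).
Variables (mu : {measure set Z -> \bar R}) (nu : {measure set Y -> \bar R}).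
Variables (D : set Z) (mD : measurable D) (phi : Z -> Y) (c : {nonneg R}).
Hypothesis mphi : measurable_fun setT phi.
Hypothesis law : forall B, measurable B ->
  mu (D `&` phi @^-1` B) = (c%:num%:E * nu B)%E.
Local Open Scope ereal_scope.

(** The image under phi of mu restricted to D is c nu. The factor c is there for the Markov
    property, where D = A [&] {X_s = x}, c = P(D) and nu is the transition kernel at x; for the law
    of X_T it is 1. *)
Lemma ge0_integral_law (f : Y -> \bar R) : measurable_fun setT f ->
  (forall y, 0 <= f y) ->
  \int[mu]_(z in D) f (phi z) = c%:num%:E * \int[nu]_y f y.
Proof.
move=> mf f0; have mfphi : measurable_fun setT (f \o phi) by exact: measurableT_comp.
have mCD : measurable (~` D) by exact: measurableC.
transitivity (\int[mrestr mu mD]_z (f \o phi) z).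
  rewrite -(setUv D) ge0_integral_setU//; last 3 first.
  - by rewrite setUv.
  - by move=> z _; exact: f0.
  - by apply/disj_set2P; rewrite setICr.
  rewrite [X in _ = _ + X]null_set_integral//; last 2 first.
  - exact: measurable_funTS.
  - by rewrite /= /mrestr setICl measure0.
  rewrite adde0; apply: eq_measure_integral => A mA AD.
  by rewrite /= /mrestr setIidl.
rewrite -[LHS](ge0_integral_pushforward mphi (mrestr mu mD) measurableT)//.
rewrite -ge0_integral_mscale//.
apply: eq_measure_integral => B mB _.
by rewrite /= /pushforward /mrestr /mscale/= setIC law.
Qed.

Lemma integral_law (f : Y -> R) : measurable_fun setT f ->
  nu.-integrable setT (EFin \o f) ->
  \int[mu]_(z in D) (f (phi z))%:E = c%:num%:E * \int[nu]_y (f y)%:E.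
Proof.
move=> mf intf; rewrite integralE [in RHS]integralE.
have mEf : measurable_fun setT (EFin \o f) by exact/measurable_EFinP.
rewrite muleBr//; last exact: integrable_add_def.
rewrite -(ge0_integral_law (measurable_funepos mEf) (fun y => funepos_ge0 _ y)).
rewrite -(ge0_integral_law (measurable_funeneg mEf) (fun y => funeneg_ge0 _ y)).
by congr (_ - _); apply: eq_integral => z _; rewrite ?funeposE ?funenegE.
Qed.

End change_of_variables.

(** The fibres of phi, numbered through an injection into nat, partition A into countably many
    pieces, and integrability allows summing over them. It serves with phi = X_s and with phi the
    dyadic index of a stopping time. *)
Lemma eq_integral_fibers d (W : measurableType d) (R : realType) (U : Type)
    (P : {measure set W -> \bar R}) (A : set W) (phi : W -> U) (f g : W -> \bar R) :
  countable [set: U] -> measurable A ->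
  (forall u, measurable (A `&` phi @^-1` [set u])) ->
  P.-integrable A f -> P.-integrable A g ->
  (forall u, \int[P]_(w in A `&` phi @^-1` [set u]) f w =
             \int[P]_(w in A `&` phi @^-1` [set u]) g w)%E ->
  (\int[P]_(w in A) f w = \int[P]_(w in A) g w)%E.
Proof.
move=> /countable_injP[nm nm_inj] mA mphi intf intg fg.
pose B n := A `&` [set w | nm (phi w) = n].
have BE u : B (nm u) = A `&` phi @^-1` [set u].
  congr (_ `&` _); apply/seteqP; split => w /= => [/nm_inj|->//].
  by apply; exact: mem_set.
have B0 n : (exists u, nm u = n) \/ B n = set0.
  have [[u un]|nu] := pselect (exists u, nm u = n); first by left; exists u.
  by right; apply/seteqP; split => // w [_ /= wn]; apply: nu; exists (phi w).
have mB n : measurable (B n).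
  by have [[u <-]|->//] := B0 n; rewrite BE; exact: mphi.
have tB : trivIset setT B.
  by move=> i j _ _ [w [[_ /= <-] [_ /= <-]]].
have AE : A = \bigcup_n B n.
  by apply/seteqP; split => [w Aw|w [n _ []//]]; exists (nm (phi w)).
rewrite AE !integral_bigcup -?AE//.
apply: eq_eseriesr => n _.
by have [[u <-]|->] := B0 n; rewrite ?BE// !integral_set0.
Qed.

Lemma le_ae_integrable d (W : measurableType d) (R : realType)
    (P : {measure set W -> \bar R}) (D : set W) (f g : W -> \bar R) :
  measurable D -> measurable_fun D f ->
  {ae P, forall w, D w -> (`|f w| <= `|g w|)%E} ->
  P.-integrable D g -> P.-integrable D f.
Proof.
move=> mD mf fg /integrableP[mg ig]; apply/integrableP; split => //.
apply: le_lt_trans ig; apply: ae_ge0_le_integral => //; exact: measurableT_comp.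
Qed.

Lemma bounded_integrable d (W : measurableType d) (R : realType)
    (P : {measure set W -> \bar R}) (f : W -> R) c A :
  P setT = 1%E -> measurable A -> measurable_fun setT f ->
  (forall w, `|f w| <= c) -> P.-integrable A (EFin \o f).
Proof.
move=> P1 mA mf fc; apply: measurable_bounded_integrable => //.
- apply: (@le_lt_trans _ _ (P setT)); last by rewrite P1 ltry.
  by apply: le_measure => //; exact: mem_set.
- exact: measurable_funTS.
- exists c; split; [exact: num_real|move=> x cx w _ /=].
  by rewrite (le_trans (fc w))// ltW.
Qed.

(** * Expected time spent in O, by Tonelli's theorem *)

Section occupation_time.
Context {d} {W : measurableType d} {R : realType} {O : completeMetricType R}.
Variables (P : probability W R) (F : R -> set (set W)).
Variable X : W -> cadlag_path R (cem O).
Hypothesis fF : filtration F.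
Hypothesis aX : adapted F X.
Hypothesis cO : countable [set: O].
Local Open Scope ereal_scope.

(** Tonelli's theorem is applied on full products. Therefore [g] fills negative times with 0, and
    [f] below carries the domains A and ]0, u] as indicators. *)
Let g (z : R * W) : R := if (0 <= z.1)%R then alive (X z.2 z.1) else 0%R.

Let mg : measurable_fun setT g.
Proof.
rewrite (_ : g = (fun z : R * W => alive (X z.2 z.1)) \_ nonneg_time).
  apply/(measurable_restrictT _ _).1; first exact: measurable_nonneg_time.
  exact: (measurable_process_Cb fF aX cO Cb_alive).
apply/funext => z; rewrite /g /patch; case: ifPn => z0; first by rewrite mem_set.
by rewrite memNset//; exact/negP.
Qed.

Lemma measurable_alive_path w (u : R) :
  measurable_fun `]0%R, u] (fun r => alive (X w r) : R).
Proof.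
apply: (@eq_measurable_fun _ _ _ _ _ (fun r => g (r, w))).
  by move=> r; rewrite inE/= in_itv/= /g/= => /andP[/ltW ->].
by apply: measurable_funTS; apply: (measurableT_comp mg); exact: measurable_pair2.
Qed.

Let f (A : set W) (s u : R) (z : W * R) : \bar R :=
  (\1_A z.1)%:E * (\1_(`]0%R, u]%classic) z.2)%:E * (g (s + z.2, z.1)%R)%:E.

Let mf A s u : measurable A -> measurable_fun setT (f A s u).
Proof.
move=> mA; apply: emeasurable_funM; first apply: emeasurable_funM.
- apply/measurable_EFinP.
  by apply: (@measurableT_comp _ _ _ _ _ _ (\1_A : W -> R) _ fst).
- apply/measurable_EFinP.
  by apply: (@measurableT_comp _ _ _ _ _ _ (\1_(`]0%R, u]%classic) : R -> R) _ snd).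
- apply/measurable_EFinP; apply: (measurableT_comp mg).
  apply/measurable_fun_pairP; split => /=; last exact: measurable_fst.
  by apply: measurable_funD => //; exact: measurable_snd.
Qed.

Let f0 A s u z : 0 <= f A s u z.
Proof. by rewrite /f !mule_ge0 ?lee_fin// /g; case: ifP => // _; rewrite aliveE. Qed.

Let fE A s u w : (0 <= s)%R ->
  \int[lebesgue_measure]_r f A s u (w, r) = ((fun w => \int[lebesgue_measure]_(r in
    `]0%R, u]) (alive (X w (s + r)))%:E) \_ A) w.
Proof.
move=> s0; rewrite /patch /f/= [\1_A w]indicE; case: (boolP (w \in A)) => wA; last first.
  by apply: integral0_eq => y _; rewrite !mul0e.
rewrite [RHS]integral_mkcond; apply: eq_integral => r _.
rewrite mul1e /patch indicE; case: ifPn; last by rewrite mul0e.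
rewrite inE/= in_itv/= mul1e /g/= => /andP[r0 _].
by rewrite addr_ge0// ltW.
Qed.

Lemma measurable_occupation_time (s u : R) : (0 <= s)%R ->
  measurable_fun setT (fun w =>
    \int[lebesgue_measure]_(r in `]0%R, u]) (alive (X w (s + r)))%:E).
Proof.
move=> s0; have := @measurable_fun_fubini_tonelli_F _ _ W (measurableTypeR R) R
  (@lebesgue_measure R) _ (mf s u measurableT) (f0 setT s u).
by apply: eq_measurable_fun => w _; rewrite /fubini_F fE// patchT// mem_set.
Qed.

Let gE A s u r : (0 <= s)%R -> measurable A ->
  \int[P]_w f A s u (w, r) =
  ((fun r => P (A `&` [set w | X w (s + r)%R <> None])) \_ `]0%R, u]) r.
Proof.
move=> s0 mA; rewrite /patch /f/= [\1_(_ : set R) r]indicE.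
case: (boolP (r \in _)) => rI; last first.
  by apply: integral0_eq => w _; rewrite mule0 mul0e.
move: rI; rewrite inE/= in_itv/= => /andP[r0 _].
have sr0 : (0 <= s + r)%R by rewrite addr_ge0// ltW.
have mr : measurable [set w | X w (s + r)%R <> None].
  have [_ Fm] := fF.1 _ sr0.
  exact/Fm/(aX sr0 (cem_measurable [set y | y <> None] cO)).
rewrite -[X in _ = P X]setIT -integral_indic//; last exact: measurableI.
apply: eq_integral => w _.
by rewrite mule1 /g/= sr0 aliveE -EFinM indicI.
Qed.

Lemma measurable_survival A (s u : R) : measurable A -> (0 <= s)%R ->
  measurable_fun `]0%R, u] (fun r => P (A `&` [set w | X w (s + r)%R <> None])).
Proof.
move=> mA s0; apply/(measurable_restrictT _ _).2 => //.
have := @measurable_fun_fubini_tonelli_G _ _ W (measurableTypeR R) R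
  P _ (mf s u mA) (f0 A s u).
by apply: eq_measurable_fun => r _; rewrite /fubini_G gE.
Qed.

(** A pathwise time integral becomes an integral of survival probabilities, the form on which the
    Markov property acts and in which the kernel enters. *)
Lemma integral_occupation_time A (s u : R) : measurable A -> (0 <= s)%R ->
  \int[P]_(w in A) \int[lebesgue_measure]_(r in `]0%R, u]) (alive (X w (s + r)))%:E =
  \int[lebesgue_measure]_(r in `]0%R, u]) P (A `&` [set w | X w (s + r)%R <> None]).
Proof.
move=> mA s0; have := @fubini_tonelli _ _ W (measurableTypeR R) R P
  (@lebesgue_measure R) _ (mf s u mA) (f0 A s u).
under eq_integral do rewrite fE//.
rewrite -integral_mkcond => ->.
by rewrite [RHS]integral_mkcond; apply: eq_integral => r _; rewrite gE.
Qed.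

End occupation_time.

Section states.
Context {R : realType} {O : completeMetricType R}.

Lemma cem_measurable_fun d (U : measurableType d) (f : cem O -> U) :
  countable [set: O] -> measurable_fun setT (f : borel (cem O) -> U).
Proof. by move=> cO _ B mB; exact: cem_measurable. Qed.

End states.

(** * The Markov property and the killing time *)

Section markov.
Context {d} {W : measurableType d} {R : realType} {O : completeMetricType R}.
Variables (P : probability W R) (F : R -> set (set W)).
Variable X : W -> cadlag_path R (cem O).
Variable Pt : R -> R.-pker borel (cem O) ~> borel (cem O).
Hypothesis fF : filtration F.
Hypothesis aX : adapted F X.
Hypothesis cO : countable [set: O].
Hypothesis mX : markov_process P F X Pt.
Local Open Scope ereal_scope.

Lemma measurable_state t : (0 <= t)%R ->
  measurable_fun setT (fun w => X w t : borel (cem O)).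
Proof.
move=> t0 _ B mB; rewrite setTI; have [_ Fm] := fF.1 _ t0.
exact/Fm/(aX t0 mB).
Qed.

Lemma adapted_state s x : (0 <= s)%R -> F s [set w | X w s = x].
Proof. by move=> s0; exact: (aX s0 (cem_measurable [set x] cO)). Qed.

(** On {X_s = x} the conditional probability of B is the constant [Pt (t - s) x B]. *)
Lemma markov_law s t x A (B : set (borel (cem O))) :
  (0 <= s)%R -> (s < t)%R -> F s A -> measurable B ->
  P ((A `&` [set w | X w s = x]) `&` [set w | B (X w t)]) =
  P (A `&` [set w | X w s = x]) * Pt (t - s)%R x B.
Proof.
move=> s0 st FA mB; have [sF Fm] := fF.1 _ s0.
have FAx : F s (A `&` [set w | X w s = x]) by apply: sigma_setI => //; exact: adapted_state.
have mAx := Fm _ FAx.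
have t0 : (0 <= t)%R by rewrite (le_trans s0)// ltW.
have mBt : measurable [set w | B (X w t)].
  by have [_ Fmt] := fF.1 _ t0; exact/Fmt/(aX t0 mB).
have [_ /(_ _ FAx)] := mX s0 st mB.
rewrite (eq_integral (cst (Pt (t - s)%R x B))); last first.
  by move=> w /set_mem[_ /= ->].
rewrite integral_cst// muleC => ->.
by rewrite [X in P X = _]setIC -integral_indic.
Qed.

Lemma markov_integral s t x A f c : (0 <= s)%R -> (s < t)%R -> F s A ->
  (forall y, `|f y| <= c)%R ->
  \int[P]_(w in A `&` [set w | X w s = x]) (f (X w t))%:E =
  P (A `&` [set w | X w s = x]) * \int[Pt (t - s)%R x]_y (f y)%:E.
Proof.
move=> s0 st FA fc; have [sF Fm] := fF.1 _ s0.
have mAx : measurable (A `&` [set w | X w s = x]).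
  exact/Fm/(sigma_setI sF FA)/adapted_state.
have t0 : (0 <= t)%R by rewrite (le_trans s0)// ltW.
have pfin : P (A `&` [set w | X w s = x]) \is a fin_num by exact: fin_num_measure.
have p0 : (0 <= fine (P (A `&` [set w | X w s = x])))%R by rewrite fine_ge0.
rewrite (@integral_law _ _ _ (borel (cem O)) _ P (Pt (t - s)%R x) _ mAx _
  (NngNum p0) (measurable_state t0))/=.
- by rewrite fineK.
- by move=> B mB; rewrite fineK//; exact: markov_law.
- exact: cem_measurable_fun.
- apply: (bounded_integrable (c := c)) => //; first exact: prob_kernel.
  exact: cem_measurable_fun.
Qed.

End markov.

Section lifetime_measurable.
Context {d} {W : measurableType d} {R : realType} {O : completeMetricType R}.
Variables (P : probability W R) (F : R -> set (set W)).
Variable X : W -> cadlag_path R (cem O).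
Hypothesis fF : filtration F.
Hypothesis nF : P.-negligible `<=` F 0.
Hypothesis aX : adapted F X.
Hypothesis absX : {ae P, forall w, forall t, 0 <= t ->
  (lifetime (X w) <= t%:E)%E -> X w t = None}.

(** The lifetime is an infimum over uncountably many times. But {X_t = None} is contained in the
    event, and by absorption the difference is negligible, hence in F 0. *)
Lemma lifetime_event t : 0 <= t -> F t [set w | (lifetime (X w) <= t%:E)%E].
Proof.
move=> t0; have [sF Fm] := fF.1 _ t0.
have FN : F t [set w | X w t = None].
  exact: (aX t0 (borel_cem_measurable_set1 None)).
rewrite (_ : mkset _ = [set w | X w t = None] `|`
    ([set w | (lifetime (X w) <= t%:E)%E] `\` [set w | X w t = None])).
  apply: (sigma_setU sF) => //; apply: (fF.2 0 t) => //; apply: nF.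
  apply: negligibleS absX => w /= [wt Xw] h; exact/Xw/h.
apply/seteqP; split => w /=; last by move=> [|[]//]; exact: lifetime_le.
by move=> wt; have [|Xw] := pselect (X w t = None); [left|right].
Qed.

Lemma measurable_lifetime : measurable_fun setT (fun w => lifetime (X w)).
Proof.
apply: emeasurable_fun_ge_rays => a; have [a0|a0] := leP 0 a.
  by have [_ Fm] := fF.1 _ a0; exact/Fm/lifetime_event.
rewrite (_ : mkset _ = set0)//; apply/seteqP; split => // w /= wa.
have := le_trans (lifetime_ge0 (X w)) wa; rewrite lee_fin; lra.
Qed.

Lemma adapted_killed_clock t : 0 <= t ->
  measurable_fun setT (killed_clock X t : g_sigma_algebraType (F t) -> R).
Proof.
move=> t0; have [sF Fm] := fF.1 _ t0.
apply: (@measurable_fun_ge_rays _ (g_sigma_algebraType (F t))) => a.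
suff : F t [set w | killed_clock X t w <= a].
  by rewrite -[X in X _ -> _](sigma_algebra_id sF).
have [ta|at_] := leP t a.
  rewrite (_ : mkset _ = setT); first exact: sigma_setT.
  by apply/seteqP; split => // w _ /=; rewrite (le_trans (killed_clock_le _ _ _)).
have [a0|a0] := leP 0 a; last first.
  rewrite (_ : mkset _ = set0); first by case: sF.
  by apply/seteqP; split => // w /= wa; have := killed_clock_ge0 X w t0; lra.
rewrite (_ : mkset _ = [set w | (lifetime (X w) <= a%:E)%E]).
  by apply: (fF.2 a t) => //; [exact: ltW|exact: lifetime_event].
have ta : (t%:E <= a%:E)%E = false by rewrite lee_fin leNgt at_.
by apply/seteqP; split => w /=; rewrite -lee_fin killed_clock_EFin ge_min ta.
Qed.

Lemma measurable_killed_clock t : 0 <= t -> measurable_fun setT (killed_clock X t).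
Proof.
move=> t0; have [sF Fm] := fF.1 _ t0.
exact: (sub_sigma_measurable_fun sF Fm (adapted_killed_clock t0)).
Qed.

Lemma measurable_process_killed_clock :
  measurable_fun nonneg_time (fun z : R * W => killed_clock X z.1 z.2).
Proof.
apply: measurable_fun_right_continuous; first exact: measurable_killed_clock.
by move=> w t _; exact: killed_clock_right_continuous.
Qed.

End lifetime_measurable.

(** Along an absorbed path, [alive] is the indicator of [0, L[ with L the lifetime. The integral is
    the length of the part of ]s, s + u] before L, with three cases according to the position of
    L. *)
Lemma integral_alive_path (R : realType) (O : completeMetricType R)
    (p : cadlag_path R (cem O)) (s u : R) :
  0 <= s -> 0 <= u -> lifetime p \is a fin_num ->
  (forall t, 0 <= t -> (lifetime p <= t%:E)%E -> p t = None) ->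
  (\int[lebesgue_measure]_(r in `]0%R, u]) (alive (p (s + r)%R))%:E =
   (killed_clock id (s + u) p - killed_clock id s p)%:E)%E.
Proof.
move=> s0 u0 pfin absp; set L := fine (lifetime p).
have LE : lifetime p = L%:E by rewrite fineK.
have aliveL r : 0 <= r -> alive (p r) = (r < L)%R%:R.
  move=> r0; rewrite aliveE indicE; have [rL|Lr] := ltP r L.
    rewrite mem_set//= => pr; have := lifetime_le r0 pr.
    by rewrite LE lee_fin leNgt rL.
  by rewrite memNset//=; apply; apply: absp => //; rewrite LE lee_fin.
rewrite !killed_clock_minE// -/L.
rewrite (@eq_integral _ _ _ _ _ (fun r : measurableTypeR R =>
    (\1_[set r : R | r < L - s] r)%:E)); last first.
  move=> r /set_mem /=; rewrite in_itv/= => /andP[r0 _].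
  rewrite aliveL; last by rewrite addr_ge0// ltW.
  rewrite indicE; congr ((_ : nat)%:R%:E).
  have [rL|Lr] := ltP (s + r) L; first by rewrite mem_set//=; lra.
  by rewrite memNset//=; lra.
have itvE : [set r : R | r < L - s] = `]-oo, (L - s)[%classic.
  by apply/seteqP; split => r /=; rewrite in_itv.
rewrite integral_indic//; last by rewrite itvE.
have [Ls|sL] := leP L s.
  rewrite (_ : [set r | _] `&` _ = set0).
    by rewrite measure0 (min_r (_ : L <= s + u)) ?min_r// ?subrr//; lra.
  by apply/seteqP; split => // r /=; rewrite in_itv/= => -[? /andP[? ?]]; lra.
have [suL|Lsu] := ltP (s + u) L.
  rewrite (_ : [set r | _] `&` _ = `]0, u]%classic).
    rewrite -[LHS]/(lebesgue_measure (`]0, u]%classic : set R)).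
    rewrite lebesgue_measure_itv/= lte_fin; case: ltP => u0'.
      by rewrite -EFinB; congr EFin; ring.
    by congr EFin; lra.
  apply/seteqP; split => r /=; rewrite in_itv/=; first by case.
  by move=> /andP[r0 ru]; split; [lra|apply/andP].
rewrite (_ : [set r | _] `&` _ = `]0, L - s[%classic).
  rewrite -[LHS]/(lebesgue_measure (`]0, L - s[%classic : set R)).
  by rewrite lebesgue_measure_itv/= lte_fin subr_gt0 sL -EFinB subr0.
apply/seteqP; split => r /=; rewrite !in_itv/=.
  by move=> [rL /andP[r0 _]]; apply/andP.
by move=> /andP[r0 rL]; split => //; apply/andP; split => //; lra.
Qed.

(** * Path space, and the generator identity in terms of the semigroup *)

Section completed_probability.
Context d (T : measurableType d) (R : realType) (P : probability T R).

Lemma completedE (A : set T) : measurable A -> completed P A = P A.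
Proof. by move=> mA; rewrite /completed_measure_extension measurable_mu_extE. Qed.

Lemma measurable_completed (A : set T) : measurable A ->
  measurable (A : set (completed_type P)).
Proof. exact: caratheodory_measurable_mu_ext. Qed.

Lemma completed_negligible_measurable :
  (completed P).-negligible `<=` (measurable : set (set (completed_type P))).
Proof. exact: measure_is_complete_caratheodory. Qed.

Lemma completed_setT : completed P setT = 1%E.
Proof. by rewrite completedE// probability_setT. Qed.

HB.instance Definition _ := Measure_isProbability.Build _ _ _ (completed P)
  completed_setT.

End completed_probability.

(** The identity for the generator at the constant time u, with its expectation split into two. The
    split is legitimate because the occupation time J lies in [0, u]; dropping the endpoint 0 does
    not change J. *)
Lemma expected_occupation_time d (W : measurableType d) (R : realType)
    (O : completeMetricType R) (P : probability W R) (F : R -> set (set W))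
    (X : W -> cadlag_path R (cem O)) (f : cem O -> R) (a c u : R) :
  filtration F -> adapted F X -> countable [set: O] -> 0 <= u ->
  (forall y, `|f y| <= c) ->
  (a%:E = \int[P]_w ((f (X w u))%:E -
     \int[lebesgue_measure]_(t in [set` `[0%R, u]%R]) (alive (X w t))%:E))%E ->
  (\int[P]_w (f (X w u))%:E =
   a%:E + \int[lebesgue_measure]_(r in `]0%R, u]) P [set w | X w r <> None])%E.
Proof.
move=> fF aX cO u0 fc aE.
pose J w : \bar R := (\int[lebesgue_measure]_(r in `]0%R, u]) (alive (X w (0 + r)))%:E)%E.
have mJ : measurable_fun setT J by exact: (measurable_occupation_time fF aX cO).
have occE : (\int[P]_w J w =
    \int[lebesgue_measure]_(r in `]0%R, u]) P [set w | X w r <> None])%E.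
  rewrite /J (integral_occupation_time P fF aX cO)//.
  by apply: eq_integral => r _; rewrite setTI add0r.
rewrite -occE.
have JE w : (\int[lebesgue_measure]_(t in [set` `[0%R, u]%R])
    (alive (X w t))%:E)%E = J w.
  rewrite -(@integral_itv_obnd_cbnd _ _ (BRight u)); last first.
    apply/measurable_EFinP; exact: (measurable_alive_path fF aX cO).
  by apply: eq_integral => r _; rewrite add0r.
have J0 w : (0 <= J w)%E by apply: integral_ge0 => r _; rewrite lee_fin aliveE.
have Ju w : (J w <= u%:E)%E.
  rewrite [leRHS](_ : _ = \int[lebesgue_measure]_(r in `]0%R, u]) 1)%E; last first.
    rewrite integral_cst// mul1e.
    rewrite -[RHS]/(lebesgue_measure (`]0%R, u]%classic : set R)).
    rewrite lebesgue_measure_itv/= lte_fin oppr0 adde0; case: ltP => // u0'.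
    by congr EFin; apply/eqP; rewrite eq_le u0 u0'.
  apply: ge0_le_integral => //.
  - by move=> r _; rewrite lee_fin aliveE.
  - rewrite [X in measurable_fun _ X](_ : _ = EFin \o (fun r => alive (X w r))).
      apply/measurable_EFinP; exact: (measurable_alive_path fF aX cO).
    by apply/funext => r /=; rewrite add0r.
  - by move=> r _; rewrite lee_fin aliveE indicE; case: (_ \in _).
have iJ : P.-integrable setT J.
  apply: (@le_integrable _ _ _ _ _ measurableT _ (cst u%:E)) => //.
  - by move=> w _; rewrite gee0_abs// gee0_abs/= ?Ju// lee_fin.
  - exact: finite_measure_integrable_cst.
have iF : P.-integrable setT (fun w => (f (X w u))%:E).
  apply: (@bounded_integrable _ _ _ _ (fun w => f (X w u)) c) => //.
    exact: probability_setT.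
  exact: (measurable_adapted fF aX cO).
have -> : (a%:E = \int[P]_w (f (X w u))%:E - \int[P]_w J w)%E.
  rewrite -(integralB measurableT iF iJ) aE.
  by apply: eq_integral => w _; congr (_ - _)%E; exact: JE.
by rewrite subeK//; exact: integrable_fin_num.
Qed.

Section path_filtration.
Context {R : realType} {O : completeMetricType R}.
Variable Px : cem O -> probability (path_space R (cem O)) R.
Hypothesis cO : countable [set: O].

Lemma measurable_coordinate t (B : set (borel (cem O))) : 0 <= t -> measurable B ->
  measurable ([set p | B (p t)] : set (path_space R (cem O))).
Proof.
by move=> t0 mB; apply: sub_sigma_algebra; exists t, B; split => //; exact: leey.
Qed.

Lemma filtration_path x : filtration (path_filtration Px x).
Proof.
split=> [t t0|s t s0 st A FA u /= tu]; last by apply: FA; rewrite /= (le_lt_trans st).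
split; last first.
  (* The filtration at t is an intersection over all s > t. Any single s, here t + 1, bounds it by
     the completed sigma-algebra. *)
  move=> A /(_ (t + 1)); rewrite /= ltrDl ltr01 => /(_ isT).
  apply: smallest_sub; first exact: sigma_algebra_measurable.
  move=> C [[r [B [r0 _ mB ->]]]|].
    by apply: measurable_completed; exact: measurable_coordinate.
  exact: completed_negligible_measurable.
split.
- by move=> s _; exact: sigma_algebra0.
- by move=> A FA s ts; apply: sigma_algebraCD; exact: FA.
- by move=> A FA s ts; apply: sigma_algebra_bigcup => i; exact: FA.
Qed.

Lemma adapted_path x : adapted (path_filtration Px x) id.
Proof.
move=> t B t0 mB s /= ts; apply: sub_sigma_algebra; left.
by exists t, B; split => //; rewrite lee_fin ltW.
Qed.

End path_filtration.

Section potential_identity.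
Context {R : realType} {O : completeMetricType R}.
Variable Pt : R -> R.-pker borel (cem O) ~> borel (cem O).
Variable Px : cem O -> probability (path_space R (cem O)) R.
Hypothesis sPx : forall x, started_at Pt Px x.
Hypothesis cO : countable [set: O].
Variables (m : {finite_measure set (borel O) -> \bar R}).
Variable E : (O -> R) -> (O -> R) -> \bar R.
Hypothesis gE : generates m E Px.
Local Open Scope ereal_scope.

Lemma started_law x u (B : set (borel (cem O))) : (0 < u)%R -> measurable B ->
  completed (Px x) [set p : cadlag_path R (cem O) | B (p u)] = Pt u x B.
Proof.
move=> u0 mB; have [_ + _] := sPx x => <- //.
by rewrite completedE//; apply: measurable_coordinate => //; exact: ltW.
Qed.

Lemma started_integral x u (f : cem O -> R) c : (0 < u)%R ->
  (forall y, `|f y| <= c)%R ->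
  \int[completed (Px x)]_p (f ((p : cadlag_path R (cem O)) u))%:E =
  \int[Pt u x]_y (f y)%:E.
Proof.
move=> u0 fc.
have mu : measurable_fun setT ((fun p => (p : cadlag_path R (cem O)) u) :
    completed_type (Px x) -> borel (cem O)).
  exact: (measurable_state (filtration_path Px x) (@adapted_path _ _ Px x) (ltW u0)).
rewrite (@integral_law _ _ _ (borel (cem O)) _ (completed (Px x)) (Pt u x) setT
  measurableT _ (NngNum (@ler01 R)) mu) ?mul1e//.
- by move=> B mB; rewrite setTI mul1e; exact: started_law.
- exact: cem_measurable_fun.
- apply: (bounded_integrable (c := c)) => //; first exact: prob_kernel.
  exact: cem_measurable_fun.
Qed.

Lemma measurable_semigroup_survival x (u : R) :
  measurable_fun `]0%R, u] (fun r => Pt r x [set y | y <> None]).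
Proof.
have ms := @measurable_survival _ _ _ _ (completed (Px x)) _ _
  (filtration_path Px x) (@adapted_path _ _ Px x) cO setT 0 u measurableT (lexx _).
apply: (eq_measurable_fun _ _ ms) => r; rewrite inE/= in_itv/= => /andP[r0 _].
by rewrite setTI add0r; apply: started_law => //; exact: cem_measurable.
Qed.

(** Dynkin's formula at a constant time: P_u h = h + int_0^u P_r 1_O dr. Being written with the
    kernels only, it can be transferred from the path spaces to the given process through the Markov
    property. *)
Lemma potential_semigroup h x u : H0 m E h -> generator m E h (fun=> 1%R) ->
  (0 < u)%R ->
  \int[Pt u (Some x)]_y (ext0 h y)%:E =
  (h x)%:E + \int[lebesgue_measure]_(r in `]0%R, u])
                Pt r (Some x) [set y | y <> None].
Proof.
move=> Hh gh u0; have [[Ch [c hc]] _ _] := Hh.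
have fF := filtration_path Px (Some x); have aX := @adapted_path _ _ Px (Some x).
have hxE := gE Hh (Cb_cst _) gh (stopping_time_cst fF (ltW u0)).
have hc' y : (`|ext0 h y| <= `|c|)%R.
  case: y => [y|] /=; last by rewrite normr0.
  by rewrite (le_trans (hc y))// ler_norm.
rewrite -(started_integral _ u0 hc').
rewrite (expected_occupation_time fF aX cO (ltW u0) hc' hxE).
congr (_ + _); apply: eq_integral => r /set_mem /=.
rewrite in_itv/= => /andP[r0 _].
by apply: started_law => //; exact: cem_measurable.
Qed.

End potential_identity.

(** * The value martingale *)

Section killed_martingale.
Context {d} {W : measurableType d} {R : realType} {O : completeMetricType R}.
Variables (P : probability W R) (F : R -> set (set W)).
Variable X : W -> cadlag_path R (cem O).
Variable Pt : R -> R.-pker borel (cem O) ~> borel (cem O).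
Hypothesis fF : filtration F.
Hypothesis nF : P.-negligible `<=` F 0.
Hypothesis aX : adapted F X.
Hypothesis cO : countable [set: O].
Hypothesis mX : markov_process P F X Pt.
Hypothesis absX : {ae P, forall w, forall t, 0 <= t ->
  (lifetime (X w) <= t%:E)%E -> X w t = None}.
Hypothesis iL : (\int[P]_w lifetime (X w) < +oo)%E.
Variables (h : O -> R) (C : R).
Hypothesis hC : forall x, `|ext0 h x| <= C.
Hypothesis Ch : Cb (ext0 h).
Hypothesis mPt : forall x (u : R),
  measurable_fun `]0%R, u] (fun r => Pt r x [set y | y <> None]).
Hypothesis potP : forall x u, 0 < u ->
  (\int[Pt u (Some x)]_y (ext0 h y)%:E =
  (h x)%:E + \int[lebesgue_measure]_(r in `]0%R, u])
                Pt r (Some x) [set y | y <> None])%E.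

Definition killed_process t w := ext0 h (X w t) - killed_clock X t w.
Local Notation M := killed_process.
Let L w : R := fine (lifetime (X w)).

Lemma integrable_lifetime : P.-integrable setT (fun w => lifetime (X w)).
Proof.
apply/integrableP; split; first exact: (measurable_lifetime fF nF aX absX).
by under eq_integral do rewrite gee0_abs ?lifetime_ge0//.
Qed.

Lemma lifetime_ae_good : {ae P, forall w, lifetime (X w) \is a fin_num /\
  forall t, 0 <= t -> (lifetime (X w) <= t%:E)%E -> X w t = None}.
Proof.
have := integrable_ae measurableT integrable_lifetime.
by apply: filterS2 absX => w abs /(_ I); split.
Qed.

Let mL : measurable_fun setT L.
Proof.
apply: (measurableT_comp (fine_measurable measurableT)).
exact: (measurable_lifetime fF nF aX absX).
Qed.

Lemma integrable_fine_lifetime : P.-integrable setT (EFin \o L).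
Proof.
apply: le_integrable integrable_lifetime => //; first exact/measurable_EFinP.
move=> w _ /=; rewrite gee0_abs ?lifetime_ge0//.
have := lifetime_ge0 (X w); rewrite /L.
by case: (lifetime _) => [r| |]//=; [rewrite !lee_fin => r0; rewrite ger0_norm|rewrite normr0].
Qed.

(** The bound does not depend on t. As the lifetime is integrable, it dominates in the limits for M
    below and yields uniform integrability over all stopping times. *)
Lemma killed_process_bound t w : 0 <= t -> lifetime (X w) \is a fin_num ->
  `|M t w| <= C + L w.
Proof.
move=> t0 fw; rewrite (le_trans (ler_normB _ _))// lerD//.
by rewrite ger0_norm ?killed_clock_ge0// killed_clock_minE// ge_min lexx orbT.
Qed.

Lemma adapted_killed_process t : 0 <= t ->
  measurable_fun setT (M t : g_sigma_algebraType (F t) -> R).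
Proof.
move=> t0; apply: measurable_funB; first exact: (adapted_fun fF aX cO).
exact: (adapted_killed_clock fF nF aX absX).
Qed.

Lemma measurable_killed_process t : 0 <= t -> measurable_fun setT (M t).
Proof.
move=> t0; have [sF Fm] := fF.1 _ t0.
exact: (sub_sigma_measurable_fun sF Fm (adapted_killed_process t0)).
Qed.

Lemma measurable_joint_killed_process :
  measurable_fun nonneg_time (fun z : R * W => M z.1 z.2).
Proof.
apply: measurable_funB; first exact: (measurable_process_Cb fF aX cO Ch).
exact: (measurable_process_killed_clock fF nF aX absX).
Qed.

Lemma killed_process_right_continuous w t : 0 <= t ->
  M s w @[s --> t^'+] --> M t w.
Proof.
move=> t0; apply: cvgB; first exact: cadlag_Cb Ch t0.
exact: killed_clock_right_continuous.
Qed.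

Let iS t A : 0 <= t -> measurable A -> P.-integrable A (EFin \o killed_clock X t).
Proof.
move=> t0 mA; apply: (bounded_integrable (c := t)) => //; first exact: probability_setT.
  exact: (measurable_killed_clock fF nF aX absX).
by move=> w; rewrite ger0_norm ?killed_clock_ge0 ?killed_clock_le.
Qed.

Let ih t A : 0 <= t -> measurable A ->
  P.-integrable A (EFin \o (fun w => ext0 h (X w t))).
Proof.
move=> t0 mA; apply: (bounded_integrable (c := C)) => //; first exact: probability_setT.
exact: (measurable_adapted fF aX cO).
Qed.

Lemma integrable_killed_process t A : 0 <= t -> measurable A ->
  P.-integrable A (EFin \o M t).
Proof. by move=> t0 mA; exact: (integrableB mA (ih t0 mA) (iS t0 mA)). Qed.

Local Open Scope ereal_scope.

(** The Markov property turns E[h(X_t)] on this event A' into P(A') (h(x) + int_0^(t-s) P_r(x, O)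
    dr). The integral term is the expected occupation time of ]s, t] on A', which is E[S_t - S_s] on
    A'. *)
Let martingale_alive s t x A : (0 <= s)%R -> (s < t)%R -> F s A ->
  \int[P]_(w in A `&` [set w | X w s = Some x]) (M t w)%:E =
  \int[P]_(w in A `&` [set w | X w s = Some x]) (M s w)%:E.
Proof.
move=> s0 st FA; have [sF Fm] := fF.1 _ s0.
have t0 : (0 <= t)%R by rewrite (le_trans s0)// ltW.
have ts0 : (0 < t - s)%R by rewrite subr_gt0.
have mA' : measurable (A `&` [set w | X w s = Some x]).
  exact/Fm/(sigma_setI sF FA)/(adapted_state aX cO).
set A' := A `&` _ in mA' *.
rewrite !integralB_EFin//; try by [exact: ih | exact: iS].
rewrite (markov_integral fF aX cO mX _ s0 st FA hC) -/A' potP//.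
set I := \int[lebesgue_measure]_(r in _) _.
have pA : P A' \is a fin_num by exact: fin_num_measure.
have pI : P A' * I = \int[P]_(w in A') (killed_clock X t w)%:E -
    \int[P]_(w in A') (killed_clock X s w)%:E.
  rewrite -ge0_integralZl//; last exact: mPt.
  rewrite -integralB_EFin//; try exact: iS.
  transitivity (\int[P]_(w in A') \int[lebesgue_measure]_(r in `]0%R, (t - s)%R])
      (alive (X w (s + r)))%:E).
    rewrite (integral_occupation_time P fF aX cO)//.
    apply: eq_integral => r; rewrite inE/= in_itv/= => /andP[r0 _].
    have sr : (s < s + r)%R by rewrite ltrDl.
    have := markov_law fF aX cO mX (Some x) s0 sr FA
      (cem_measurable [set y | y <> None] cO).
    by rewrite (_ : (s + r - s)%R = r) => [<-|]//; ring.
  apply: ae_eq_integral => //.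
  - exact/measurable_funTS/(measurable_occupation_time fF aX cO).
  - apply: measurable_funTS; apply: emeasurable_funB; apply/measurable_EFinP.
      exact: (measurable_killed_clock fF nF aX absX).
    exact: (measurable_killed_clock fF nF aX absX).
  - apply: filterS lifetime_ae_good => w [fw abs] _.
    by rewrite integral_alive_path ?(ltW ts0)// subrKC.
have I_ : P A' * ((h x)%:E + I) = P A' * (h x)%:E + P A' * I.
  by rewrite muleDr// fin_num_adde_defr.
rewrite I_ pI (_ : \int[P]_(w in A') (ext0 h (X w s))%:E = P A' * (h x)%:E).
  have := integrable_fin_num mA' (iS t0 mA').
  have := integrable_fin_num mA' (iS s0 mA').
  move=> /fineK <- /fineK <-; rewrite -(fineK pA) -!(EFinM, EFinB, EFinD).
  by congr EFin; ring.
rewrite (eq_integral (cst (h x)%:E)) ?integral_cst// 1?muleC//.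
by move=> w; rewrite inE => -[_ /= ->].
Qed.

Let martingale_dead s t A : (0 <= s)%R -> (s < t)%R -> F s A ->
  \int[P]_(w in A `&` [set w | X w s = None]) (M t w)%:E =
  \int[P]_(w in A `&` [set w | X w s = None]) (M s w)%:E.
Proof.
move=> s0 st FA; have [sF Fm] := fF.1 _ s0.
have t0 : (0 <= t)%R by rewrite (le_trans s0)// ltW.
have mA' : measurable (A `&` [set w | X w s = None]).
  exact/Fm/(sigma_setI sF FA)/(adapted_state aX cO).
apply: ae_eq_integral => //.
- exact/measurable_EFinP/measurable_funTS/measurable_killed_process.
- exact/measurable_EFinP/measurable_funTS/measurable_killed_process.
apply: filterS lifetime_ae_good => w [fw abs] [_ /= Xs].
have Ls := lifetime_le s0 Xs.
have Lt : lifetime (X w) <= t%:E by rewrite (le_trans Ls)// lee_fin ltW.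
rewrite /M Xs abs// !killed_clock_minE//.
by rewrite !min_r// -lee_fin fineK.
Qed.

Lemma killed_process_martingale_eq s t A : (0 <= s)%R -> (s <= t)%R -> F s A ->
  \int[P]_(w in A) (M t w)%:E = \int[P]_(w in A) (M s w)%:E.
Proof.
move=> s0; rewrite le_eqVlt => /predU1P[->//|st FA].
have t0 : (0 <= t)%R by rewrite (le_trans s0)// ltW.
have [_ Fm] := fF.1 _ s0; have mA := Fm _ FA.
apply: (@eq_integral_fibers _ _ _ (cem O) P A (fun w => X w s)) => //.
- exact: cem_countable.
- by move=> x; apply: measurableI => //; exact/Fm/(adapted_state aX cO).
- exact: integrable_killed_process.
- exact: integrable_killed_process.
by case=> [x|]; [exact: martingale_alive|exact: martingale_dead].
Qed.

(** Once t + n exceeds the lifetime L, the path is dead and M_{t+n} equals - L exactly. The integral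
    over A does not depend on n, so dominated convergence concludes. Comparing all times with the
    single variable - L is what allows unbounded stopping times below. *)
Lemma killed_process_closed t A : (0 <= t)%R -> F t A ->
  \int[P]_(w in A) (M t w)%:E = \int[P]_(w in A) (- L w)%:E.
Proof.
move=> t0 FA; have [_ Fm] := fF.1 _ t0; have mA := Fm _ FA.
have iCL : P.-integrable A (fun w => (C + L w)%:E).
  apply: (@integrableD _ _ _ _ _ mA (cst C%:E) (EFin \o L)).
    exact: finite_measure_integrable_cst.
  by apply: (integrableS _ _ _ integrable_fine_lifetime).
have [|||||_ _] := @dominated_convergence _ W R P A mA
    (fun n w => (M (t + n%:R) w)%:E) (fun w => (- L w)%:E)
    (fun w => (C + L w)%:E).
- move=> n; apply/measurable_EFinP/measurable_funTS/measurable_killed_process.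
  by rewrite addr_ge0.
- by apply/measurable_EFinP/measurable_funTS; exact: measurableT_comp.
- apply: filterS lifetime_ae_good => w [fw abs] _; apply: cvg_near_cst.
  exists (Num.truncn (L w)).+1 => // n /= nL.
  have Ln : (L w <= t + n%:R)%R.
    apply: (@le_trans _ _ n%:R); last by rewrite lerDr.
    by rewrite (le_trans (ltW (truncnS_gt _)))// ler_nat.
  rewrite /M abs ?addr_ge0//=; last by rewrite -(fineK fw) lee_fin.
  by rewrite killed_clock_minE// min_r// sub0r.
- exact: iCL.
- apply: filterS lifetime_ae_good => w [fw abs] n _.
  by rewrite lee_fin killed_process_bound// addr_ge0.
move=> /cvg_lim <- //; apply/esym/cvg_lim => //.
apply: cvg_near_cst; apply: nearW => n.
by apply: killed_process_martingale_eq => //; rewrite lerDl.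
Qed.

End killed_martingale.

(** * Optional stopping *)

Section weighted_integrals.
Context d1 d3 (T1 : measurableType d1) (Y : measurableType d3) (R : realType).
Local Open Scope ereal_scope.
Import HBNNSimple.

Lemma ge0_integral_nnsfun_mul (mu : {measure set T1 -> \bar R}) (phi : T1 -> Y)
    (k : T1 -> R) (f : {nnsfun Y >-> R}) :
  measurable_fun setT phi -> measurable_fun setT k -> (forall x, (0 <= k x)%R) ->
  \int[mu]_x ((f (phi x))%:E * (k x)%:E) =
  \sum_(y \in range f) y%:E * \int[mu]_(x in phi @^-1` (f @^-1` [set y])) (k x)%:E.
Proof.
move=> mphi mk k0.
have mp y : measurable (phi @^-1` (f @^-1` [set y])).
  by rewrite -[X in measurable X]setTI; apply: mphi => //;
    rewrite -[X in measurable X]setTI; exact: measurable_funP.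
under eq_integral.
  move=> x _; rewrite fimfunE -fsumEFin//.
  rewrite ge0_mule_fsuml; last first.
    by move=> y; rewrite EFinM nnfun_muleindic_ge0.
  over.
rewrite ge0_integral_fsum//; last 2 first.
- move=> y; apply: emeasurable_funM; apply/measurable_EFinP => //.
  apply: measurable_funM => //.
  by apply: (@measurableT_comp _ _ _ _ _ _ (\1_(f @^-1` [set y]) : Y -> R) _ phi).
- move=> z x _; apply: mule_ge0; last by rewrite lee_fin.
  by rewrite EFinM; exact: nnfun_muleindic_ge0.
apply: eq_fsbigr => y /set_mem[z _ yz].
have y0 : (0 <= y)%R by rewrite -yz.
under eq_integral do rewrite EFinM -muleA.
rewrite ge0_integralZl//; last 2 first.
- apply: emeasurable_funM; apply/measurable_EFinP => //.
  by apply: (@measurableT_comp _ _ _ _ _ _ (\1_(f @^-1` [set y]) : Y -> R) _ phi).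
- by move=> x _; rewrite mule_ge0// lee_fin.
congr (_ * _); rewrite [RHS]integral_mkcond; apply: eq_integral => x _.
rewrite /patch indicE.
rewrite (_ : (x \in phi @^-1` _) = (phi x \in f @^-1` [set y])).
  by case: ifPn => _; rewrite ?mul1e ?mul0e.
by apply/idP/idP => /set_mem ?; exact: mem_set.
Qed.

End weighted_integrals.

Section eq_weighted_integrals.
Context d1 d2 d3 (T1 : measurableType d1) (T2 : measurableType d2)
  (Y : measurableType d3) (R : realType).
Local Open Scope ereal_scope.
Import HBNNSimple.

(** The weighted measures k1 mu1 and k2 mu2 have the same image on Y; simple functions and monotone
    convergence pass from sets to f. It serves to compare a randomized time with its density, and to
    integrate an F_t-measurable f against weights that agree only on F_t. *)
Lemma eq_weighted_integral (mu1 : {measure set T1 -> \bar R})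
    (mu2 : {measure set T2 -> \bar R}) (phi1 : T1 -> Y) (phi2 : T2 -> Y)
    (k1 : T1 -> R) (k2 : T2 -> R) (f : Y -> \bar R) :
  measurable_fun setT phi1 -> measurable_fun setT phi2 ->
  measurable_fun setT k1 -> measurable_fun setT k2 ->
  (forall x, (0 <= k1 x)%R) -> (forall x, (0 <= k2 x)%R) ->
  (forall B, measurable B -> \int[mu1]_(x in phi1 @^-1` B) (k1 x)%:E =
                             \int[mu2]_(x in phi2 @^-1` B) (k2 x)%:E) ->
  measurable_fun setT f -> (forall y, 0 <= f y) ->
  \int[mu1]_x (f (phi1 x) * (k1 x)%:E) = \int[mu2]_x (f (phi2 x) * (k2 x)%:E).
Proof.
move=> mp1 mp2 mk1 mk2 k10 k20 eqk mf f0.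
pose g := nnsfun_approx measurableT mf.
have lim_g d (T : measurableType d) (mu : {measure set T -> \bar R}) (phi : T -> Y)
    (k : T -> R) : measurable_fun setT phi -> measurable_fun setT k ->
    (forall x, (0 <= k x)%R) ->
    \int[mu]_x ((g n (phi x))%:E * (k x)%:E) @[n --> \oo] -->
    \int[mu]_x (f (phi x) * (k x)%:E).
  move=> mp mk k0.
  have -> : \int[mu]_x (f (phi x) * (k x)%:E) =
      \int[mu]_x limn (fun n => (g n (phi x))%:E * (k x)%:E).
    apply: eq_integral => x _; apply/esym/cvg_lim => //.
    have gf : (g n (phi x))%:E @[n --> \oo] --> f (phi x).
      by apply: cvg_nnsfun_approx => // y _; exact: f0.
    by apply: cvgeZr.
  apply: cvg_monotone_convergence => //.
  - move=> n; apply: emeasurable_funM; apply/measurable_EFinP => //.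
    exact: measurableT_comp.
  - by move=> n x _; rewrite mule_ge0// lee_fin.
  - move=> x _ i j ij; apply: lee_wpmul2r; rewrite lee_fin//.
    exact/lefP/nd_nnsfun_approx.
have := lim_g _ _ mu1 _ _ mp1 mk1 k10.
have := lim_g _ _ mu2 _ _ mp2 mk2 k20.
rewrite (_ : (fun n => \int[mu2]_x _) =
    (fun n => \int[mu1]_x ((g n (phi1 x))%:E * (k1 x)%:E))).
  by move=> /cvg_lim <- // /cvg_lim <-.
apply/funext => n; rewrite !ge0_integral_nnsfun_mul//.
by apply: eq_fsbigr => y _; rewrite eqk.
Qed.

End eq_weighted_integrals.

Lemma measurable_dyadic_index d (Z : measurableType d) (R : realType)
    (T : Z -> R) (D : set Z) n k : measurable D -> measurable_fun D T ->
  (forall z, D z -> 0 <= T z) ->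
  measurable (D `&` [set z | dyadic_index n (T z) = k]).
Proof.
move=> mD mT T0.
have mle j : measurable (D `&` [set z | (dyadic_index n (T z) <= j)%N]).
  rewrite (_ : _ `&` _ = D `&` T @^-1` `]-oo, j%:R / 2 ^+ n]); first exact: mT.
  apply/seteqP; split => z /=; rewrite in_itv/= => -[Dz].
    by rewrite dyadic_index_le ?T0.
  by rewrite dyadic_index_le ?T0.
case: k => [|k].
  rewrite (_ : _ `&` _ = D `&` [set z | (dyadic_index n (T z) <= 0)%N])//.
  by apply/seteqP; split => z /= [Dz]; [move=> ->|rewrite leqn0 => /eqP].
rewrite (_ : _ `&` _ = (D `&` [set z | (dyadic_index n (T z) <= k.+1)%N]) `\`
  (D `&` [set z | (dyadic_index n (T z) <= k)%N])); first exact: measurableD.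
apply/seteqP; split => z /=.
  by move=> [Dz ->]; split => // -[_]; rewrite ltnn.
move=> [[Dz zk] nzk]; split => //; apply/eqP; rewrite eqn_leq zk ltnNge.
by apply/negP => h; apply: nzk.
Qed.

Section optional_stopping.
Context {d} {W : measurableType d} {R : realType}.
Variables (M : R -> W -> R) (L : W -> R) (C : R).
Hypothesis mM : measurable_fun nonneg_time (fun z : R * W => M z.1 z.2).
Hypothesis mL : measurable_fun setT L.
Hypothesis rM : forall w t, 0 <= t -> M s w @[s --> t^'+] --> M t w.

Lemma measurable_stopped d' (Z : measurableType d') (D : set Z) (T : Z -> R)
    (pi : Z -> W) : measurable D -> measurable_fun setT T -> measurable_fun setT pi ->
  (forall z, D z -> 0 <= T z) -> measurable_fun D (fun z => M (T z) (pi z)).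
Proof.
move=> mD mT mpi T0.
have := @measurable_comp _ _ _ _ _ _ nonneg_time (fun z : R * W => M z.1 z.2) D
  (fun z => (T z, pi z)).
apply => //; first exact: measurable_nonneg_time.
  by move=> _ [z Dz <-]; exact: T0.
  by apply: measurable_funTS; exact: measurable_fun_pair.
Qed.

(** One argument for ordinary and randomized times: Z is W or R * W, and pi maps it to W. On each
    cell of the dyadic index the approximating time is constant, so the last hypothesis applies;
    right continuity and the dominating function C + L give the limit. *)
Lemma optional_stopping d' (Z : measurableType d') (Q : {measure set Z -> \bar R})
    (D : set Z) (T : Z -> R) (pi : Z -> W) :
  Q setT = 1%E -> measurable D -> measurable_fun setT T -> measurable_fun setT pi ->
  (forall z, D z -> 0 <= T z) ->
  Q.-integrable D (fun z => (L (pi z))%:E) ->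
  {ae Q, forall z, D z -> forall t, 0 <= t -> `|M t (pi z)| <= C + L (pi z)} ->
  (forall n k, (\int[Q]_(z in D `&` [set z | dyadic_index n (T z) = k])
      (M (k.+1%:R / 2 ^+ n) (pi z))%:E =
    \int[Q]_(z in D `&` [set z | dyadic_index n (T z) = k]) (- L (pi z))%:E)%E) ->
  Q.-integrable D (fun z => (M (T z) (pi z))%:E) /\
  (\int[Q]_(z in D) (M (T z) (pi z))%:E = \int[Q]_(z in D) (- L (pi z))%:E)%E.
Proof.
move=> Q1 mD mT mpi T0 iL bM key.
have mTD : measurable_fun D T by exact: measurable_funTS.
have iCL : Q.-integrable D (fun z => (C + L (pi z))%:E).
  apply: (@integrableD _ _ _ _ _ mD (cst C%:E) (fun z => (L (pi z))%:E)) => //.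
  by apply: (@bounded_integrable _ _ _ _ (cst C) `|C|).
have mup n : measurable_fun D (fun z => M (dyadic_up n (T z)) (pi z)).
  move=> _ B mB.
  rewrite (_ : _ `&` _ = \bigcup_k ((D `&` [set z | dyadic_index n (T z) = k]) `&`
     (fun z => M (k.+1%:R / 2 ^+ n) (pi z)) @^-1` B)).
    apply: bigcupT_measurable => k.
    have mE := measurable_dyadic_index n k mD mTD T0.
    apply: (@measurable_stopped _ _ _ (fun=> k.+1%:R / 2 ^+ n) pi mE) => //.
  apply/seteqP; split => z /=; first by move=> [Dz Bz]; exists (dyadic_index n (T z)).
  by move=> [k _ [[Dz zk] Bz]]; split => //; rewrite /dyadic_up zk.
have imup n : Q.-integrable D (EFin \o (fun z => M (dyadic_up n (T z)) (pi z))).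
  apply: le_ae_integrable iCL => //; first exact/measurable_EFinP.
  apply: filterS bM => z bz Dz; rewrite lee_fin.
  by rewrite (le_trans (bz Dz _ (dyadic_up_ge0 _ _)))// ler_norm.
have upE n : (\int[Q]_(z in D) (M (dyadic_up n (T z)) (pi z))%:E =
    \int[Q]_(z in D) (- L (pi z))%:E)%E.
  apply: (@eq_integral_fibers _ _ _ nat Q D (fun z => dyadic_index n (T z))) => //.
  - by move=> k; exact: measurable_dyadic_index.
  - exact: imup.
  - exact: (integrableN iL).
  - move=> k; rewrite -[RHS]key; apply: eq_integral => z /set_mem[_ /= zk].
    by rewrite /dyadic_up zk.
have [||||| iM _] := @dominated_convergence _ Z R Q D mD
    (fun n z => (M (dyadic_up n (T z)) (pi z))%:E) (fun z => (M (T z) (pi z))%:E)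
    (fun z => (C + L (pi z))%:E).
- by move=> n; exact/measurable_EFinP.
- by apply/measurable_EFinP; exact: measurable_stopped.
- apply: aeW => z Dz; apply/cvg_EFin; first exact: nearW.
  rewrite (_ : _ \o _ = (fun s => M s (pi z)) \o (fun n => dyadic_up n (T z)))//.
  exact: cvg_comp (cvg_dyadic_up (T0 _ Dz)) (@rM (pi z) _ (T0 _ Dz)).
- exact: iCL.
- by apply: filterS bM => z bz n Dz; rewrite lee_fin bz// dyadic_up_ge0.
move=> /cvg_lim <- //; split => //; apply/cvg_lim => //.
by apply: cvg_near_cst; apply: nearW => n; exact: upE.
Qed.

End optional_stopping.

Lemma integralN_EFin d (T : measurableType d) (R : realType)
    (mu : {measure set T -> \bar R}) (D : set T) (f : T -> R) :
  measurable D -> mu.-integrable D (EFin \o f) ->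
  (\int[mu]_(x in D) (- f x)%:E = - \int[mu]_(x in D) (f x)%:E)%E.
Proof. by move=> mD intf; rewrite -integralN//; exact: integrable_add_def. Qed.

Section closed_martingale.
Context {d} {W : measurableType d} {R : realType}.
Variables (P : probability W R) (F : R -> set (set W)).
Variables (M : R -> W -> R) (L : W -> R) (C : R).
Hypothesis fF : filtration F.
Hypothesis mM : measurable_fun nonneg_time (fun z : R * W => M z.1 z.2).
Hypothesis mMt : forall t, 0 <= t -> measurable_fun setT (M t).
Hypothesis iMt : forall t, 0 <= t -> P.-integrable setT (EFin \o M t).
Hypothesis rM : forall w t, 0 <= t -> M s w @[s --> t^'+] --> M t w.
Hypothesis mL : measurable_fun setT L.
Hypothesis iL : P.-integrable setT (EFin \o L).
Hypothesis bM : {ae P, forall w, forall t, 0 <= t -> `|M t w| <= C + L w}.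
Hypothesis cM : forall t A, 0 <= t -> F t A ->
  (\int[P]_(w in A) (M t w)%:E = \int[P]_(w in A) (- L w)%:E)%E.

Lemma optional_stopping_time t sigma A : 0 <= t ->
  stopping_time_ge F t sigma -> F t A ->
  P.-integrable A (fun w => (M (sigma w) w)%:E) /\
  (\int[P]_(w in A) (M (sigma w) w)%:E = \int[P]_(w in A) (M t w)%:E)%E.
Proof.
move=> t0 [ssigma tsigma] FA.
have [_ Fm] := fF.1 _ t0; have mA := Fm _ FA.
have msigma := measurable_stopping_time fF ssigma.
have s0 w : A w -> 0 <= sigma w by case: ssigma.
rewrite (cM t0 FA).
apply: (optional_stopping (C := C) (pi := id) mM rM) => //.
- exact: probability_setT.
- exact: (integrableS measurableT).
- by apply: filterS bM => w bw _.
move=> n k; apply: cM; first by rewrite divr_ge0// exprn_ge0.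
pose r : R := k%:R / 2 ^+ n; pose r' : R := k.+1%:R / 2 ^+ n.
have rr' : r <= r' by rewrite ler_pM2r ?invr_gt0 ?exprn_gt0// ler_nat.
have r0 j : 0 <= j%:R / 2 ^+ n :> R by rewrite divr_ge0// exprn_ge0.
have [sF' Fm'] := fF.1 _ (r0 k.+1).
have Fle j : (j <= k)%N -> F r' [set w | (dyadic_index n (sigma w) <= j)%N].
  move=> jk; rewrite (_ : mkset _ = [set w | sigma w <= j%:R / 2 ^+ n]).
    apply: (fF.2 (j%:R / 2 ^+ n) r') => //; last exact: ssigma.2.
    by rewrite ler_pM2r ?invr_gt0 ?exprn_gt0// ler_nat (leq_trans jk).
  by apply/seteqP; split => w /=; rewrite dyadic_index_le//; case: ssigma.
have Feq : F r' [set w | dyadic_index n (sigma w) = k].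
  case: k => [|k] in r r' rr' sF' Fm' Fle *.
    rewrite (_ : mkset _ = [set w | (dyadic_index n (sigma w) <= 0)%N]); first exact: Fle.
    by apply/seteqP; split => w /=; [move=> ->|rewrite leqn0 => /eqP].
  rewrite (_ : mkset _ = [set w | (dyadic_index n (sigma w) <= k.+1)%N] `\`
      [set w | (dyadic_index n (sigma w) <= k)%N]).
    by apply: sigma_setD => //; exact: Fle.
  apply/seteqP; split => w /=; first by move=> ->; rewrite leqnn ltnn.
  by move=> [wk /negP]; rewrite -ltnNge => kw; apply/eqP; rewrite eqn_leq wk.
(* If t <= k / 2^n, then A already belongs to F at the time (k + 1) / 2^n. Otherwise sigma >= t > k
   / 2^n and the cell is empty. *)
have [tr|rt] := leP t r.
  by apply: sigma_setI => //; apply: (fF.2 t r') => //; exact: le_trans rr'.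
rewrite (_ : _ `&` _ = set0); first by case: sF'.
apply/seteqP; split => // w [_ /= wk].
have : (dyadic_index n (sigma w) <= k)%N by rewrite wk.
rewrite dyadic_index_le; last by case: ssigma.
by have := tsigma w; rewrite -/r; lra.
Qed.

Section randomized.
Variable Pb : probability (R * W)%type R.
Hypothesis Pb0 : Pb (~` nonneg_time) = 0%E.
Hypothesis PbP : forall A, measurable A -> Pb (setT `*` A) = P A.
Hypothesis PbF : forall t, 0 <= t -> exists2 g : W -> \bar R, meas_wrt (F t) g &
  forall A, measurable A -> Pb ([set s | s <= t] `*` A) = (\int[P]_(w in A) g w)%E.

Let S t : set (R * W) := [set s | s <= t] `*` setT.

Let mI t : measurable [set s : R | s <= t].
Proof.
rewrite (_ : mkset _ = `]-oo, t]%classic); first exact: measurable_itv.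
by apply/seteqP; split => s /=; rewrite in_itv.
Qed.

Let mS t : measurable (S t).
Proof. exact: measurableX. Qed.

Let marginal_law B : measurable B ->
  Pb (setT `&` snd @^-1` B) = ((NngNum (@ler01 R))%:num%:E * P B)%E.
Proof.
move=> mB; rewrite setTI mul1e; apply: etrans (PbP mB); congr (Pb _).
by apply/seteqP; split => -[s w] //= [].
Qed.

Let ge0_integral_marginal (Y : W -> \bar R) : measurable_fun setT Y ->
  (forall w, 0 <= Y w)%E -> (\int[Pb]_z Y z.2 = \int[P]_w Y w)%E.
Proof.
by move=> mY Y0; rewrite (ge0_integral_law measurableT measurable_snd marginal_law)// mul1e.
Qed.

Let integral_marginal (Y : W -> R) : measurable_fun setT Y ->
  P.-integrable setT (EFin \o Y) ->
  (\int[Pb]_z (Y z.2)%:E = \int[P]_w (Y w)%:E)%E.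
Proof.
by move=> mY iY; rewrite (integral_law measurableT measurable_snd marginal_law)// mul1e.
Qed.

Let integrable_marginal (Y : W -> R) : measurable_fun setT Y ->
  P.-integrable setT (EFin \o Y) -> Pb.-integrable setT (fun z => (Y z.2)%:E).
Proof.
move=> mY /integrableP[_ iY]; apply/integrableP; split.
  by apply/measurable_EFinP; exact: measurableT_comp.
by rewrite (ge0_integral_marginal (Y := fun w => `|Y w|%:E))//;
  apply/measurable_EFinP; exact: measurableT_comp.
Qed.

(** The conditional probability is given as an extended real function of unspecified sign. Its
    integrals are values of Pb, which forces 0 <= g < +oo almost everywhere; replacing it by
    [fine (maxe g 0)] keeps F_t-measurability and gives a real nonnegative density. *)
Let density t : 0 <= t -> exists g : W -> R, [/\
  measurable_fun setT (g : g_sigma_algebraType (F t) -> R),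
  forall w, 0 <= g w &
  forall A, measurable A -> Pb ([set s | s <= t] `*` A) =
                            (\int[P]_(w in A) (g w)%:E)%E].
Proof.
move=> t0; have [g Fg gE] := PbF t0; have [sF Fm] := fF.1 _ t0.
have /(meas_wrtP sF) mFg := Fg.
have mg : measurable_fun setT g := sub_sigma_measurable_fun sF Fm mFg.
have mrect A : measurable A -> measurable ([set s : R | s <= t] `*` A).
  by move=> mA; exact: measurableX.
have g0 : {ae P, forall w, (0 <= g w)%E}.
  pose N := [set w | (g w < 0)%E].
  have mN : measurable N by rewrite -[N]setTI; exact: emeasurable_fun_infty_o.
  have gN w : N w -> (g w <= 0)%E by move=> /ltW.
  have NgE : (\int[P]_(w in N) g w = - \int[P]_(w in N) (- g w))%E.
    rewrite -integral_ge0N; last by move=> w /gN; rewrite oppe_ge0.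
    by apply: eq_integral => w _; rewrite oppeK.
  have : (\int[P]_(w in N) `|g w| = 0)%E.
    rewrite (eq_integral (fun w => - g w)%E); last first.
      by move=> w /set_mem /gN /lee0_abs.
    apply/eqP; rewrite eq_le integral_ge0 ?andbT; last first.
      by move=> w /gN; rewrite oppe_ge0.
    by rewrite -oppe_ge0 -NgE -gE.
  move=> /(ae_eq_integral_abs _ mN (measurable_funTS mg)).
  apply: filterS => w gw; rewrite leNgt; apply/negP => Nw.
  by have := gw Nw; move: Nw => /[swap] ->; rewrite ltxx.
have goo : {ae P, forall w, (g w < +oo)%E}.
  pose U := [set w | g w = +oo%E].
  have mU : measurable U.
    by rewrite -[U]setTI; exact: (mg measurableT _ (emeasurable_set1 +oo%E)).
  exists U; split => //; last by move=> w /negP; rewrite -leNgt leye_eq => /eqP.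
  apply/eqP; apply: contraT => PU0.
  have : (Pb ([set s : R | (s <= t)%R] `*` U) <= 1)%E by apply: probability_le1; exact: mrect.
  rewrite gE// (eq_integral (cst +oo%E)); last by move=> w /set_mem.
  by rewrite integral_cst// gt0_mulye// lt0e PU0 measure_ge0.
exists (fun w => fine (maxe (g w) 0)%E); split.
- apply: (measurableT_comp (fine_measurable measurableT)).
  exact: measurable_maxe.
- by move=> w; rewrite fine_ge0// le_max lexx orbT.
move=> A mA; rewrite gE//; apply: ae_eq_integral => //.
- exact: measurable_funTS.
- apply/measurable_EFinP/measurable_funTS.
  apply: (measurableT_comp (fine_measurable measurableT)).
  exact: measurable_maxe.
by apply: filterS2 g0 goo => w w0 woo _; rewrite max_l// fineK// ge0_fin_numE.
Qed.

(** The hypothesis says E[f | F_t] = 0, and the integral equals that of g f with g the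
    F_t-measurable density of {T <= t}. This is where the adaptedness of the randomized time
    enters. *)
Let integral_before t (f : W -> R) : 0 <= t -> measurable_fun setT f ->
  P.-integrable setT (EFin \o f) ->
  (forall A, F t A -> \int[P]_(w in A) (f w)%:E = 0)%E ->
  (\int[Pb]_(z in S t) (f z.2)%:E = 0)%E.
Proof.
move=> t0 mf intf f0; have [g [mFg g0 gE]] := density t0.
have [sF Fm] := fF.1 _ t0.
have mg : measurable_fun setT g := sub_sigma_measurable_fun sF Fm mFg.
pose p w := Num.max (f w) 0; pose q w := Num.max (- f w) 0.
have p0 w : 0 <= p w by rewrite le_max lexx orbT.
have q0 w : 0 <= q w by rewrite le_max lexx orbT.
have mp : measurable_fun setT p by exact: measurable_maxr.
have mq : measurable_fun setT q by apply: measurable_maxr => //; exact: measurableT_comp.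
have pE : (EFin \o f)^\+%E = EFin \o p.
  by apply/funext => w; rewrite funeposE/= /p EFin_max.
have qE : (EFin \o f)^\-%E = EFin \o q.
  by apply/funext => w; rewrite funenegE/= /q EFin_max.
have pq A : F t A -> (\int[P]_(w in A) (p w)%:E = \int[P]_(w in A) (q w)%:E)%E.
  move=> FA; have := f0 _ FA; rewrite integralE pE qE => pq.
  have mA := Fm _ FA; have ifA := integrableS measurableT mA (@subsetT _ A) intf.
  have := integrable_pos_fin_num mA ifA; have := integrable_neg_fin_num mA ifA.
  rewrite pE qE => qfin pfin; move: pq => /eqP; rewrite sube_eq ?fin_num_adde_defr//.
  by rewrite add0e => /eqP.
have weighted (Y : W -> R) : measurable_fun setT Y -> (forall w, 0 <= Y w) ->
    (\int[Pb]_(z in S t) (Y z.2)%:E = \int[P]_w ((g w)%:E * (Y w)%:E))%E.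
  move=> mY Y0.
  have := @eq_weighted_integral _ _ _ _ _ W R Pb P snd id \1_(S t) g
    (EFin \o Y) measurable_snd (@measurable_id _ _ _) (measurable_indic (mS t)) mg.
  have -> : (\int[P]_x ((EFin \o Y) (id x) * (g x)%:E) = \int[P]_w ((g w)%:E * (Y w)%:E))%E.
    by apply: eq_integral => w _; rewrite muleC.
  move=> <- //; last 2 first.
  - move=> B mB; rewrite -gE// integral_indic//.
      congr (Pb _); apply/seteqP; split => -[s w] /=; first by case=> -[].
      by case.
    by rewrite -[X in measurable X]setTI; exact: measurable_snd.
  - exact/measurable_EFinP.
  rewrite [LHS]integral_mkcond; apply: eq_integral => z _.
  by rewrite /patch/= indicE; case: ifPn => _; rewrite ?mule1 ?mule0.
(* The positive and negative parts of f, taken as weights, define measures that agree on F_t, hence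
   integrate the F_t-measurable g equally. *)
have pqg : (\int[P]_w ((g w)%:E * (p w)%:E) = \int[P]_w ((g w)%:E * (q w)%:E))%E.
  apply: (@eq_weighted_integral _ _ _ W W (g_sigma_algebraType (F t)) R P P id id p q
    (EFin \o g)) => //.
  - move=> _ B mB; rewrite setTI; apply: Fm.
    by rewrite -[X in X _](sigma_algebra_id sF).
  - move=> _ B mB; rewrite setTI; apply: Fm.
    by rewrite -[X in X _](sigma_algebra_id sF).
  - move=> B mB; apply: pq.
    by rewrite -[X in X _](sigma_algebra_id sF).
  - exact/measurable_EFinP.
have fp : (fun z : R * W => (f z.2)%:E)^\+%E = fun z => (p z.2)%:E.
  by apply/funext => z; rewrite funeposE/= /p EFin_max.
have fq : (fun z : R * W => (f z.2)%:E)^\-%E = fun z => (q z.2)%:E.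
  by apply/funext => z; rewrite funenegE/= /q EFin_max.
rewrite integralE fp fq !weighted// pqg subee// -weighted//.
apply: integrable_fin_num => //; apply: (integrableS measurableT) => //.
apply: integrable_marginal => //.
by rewrite -qE; exact: integrable_funeneg.
Qed.

Let ae_marginal (Q : W -> Prop) : {ae P, forall w, Q w} ->
  {ae Pb, forall z : R * W, Q z.2}.
Proof.
move=> [N [mN PN QN]]; exists (setT `*` N); split.
- exact: measurableX.
- by rewrite PbP.
- by move=> [s w] /= /QN Nw; split.
Qed.

(** The cell of index k >= 1 is {T <= k / 2^n} minus {T <= (k - 1) / 2^n}, and both endpoints
    precede (k + 1) / 2^n. Negative times, which these events contain, are negligible under Pb. *)
Let integral_index n k (f : W -> R) : measurable_fun setT f ->
  P.-integrable setT (EFin \o f) ->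
  (forall A, F (k.+1%:R / 2 ^+ n) A -> \int[P]_(w in A) (f w)%:E = 0)%E ->
  (\int[Pb]_(z in nonneg_time `&` [set z | dyadic_index n z.1 = k]) (f z.2)%:E = 0)%E.
Proof.
move=> mf intf f0.
have r0 j : 0 <= j%:R / 2 ^+ n :> R by rewrite divr_ge0// exprn_ge0.
have mD := @measurable_nonneg_time _ W R.
pose G j := nonneg_time `&` S (j%:R / 2 ^+ n).
have mG j : measurable (G j) by exact: measurableI.
have ifb := integrable_marginal mf intf.
have G0 j : (j <= k.+1)%N -> (\int[Pb]_(z in G j) (f z.2)%:E = 0)%E.
  move=> jk; have := integral_before (r0 j) mf intf.
  rewrite (negligible_integral (N := ~` nonneg_time)) ?setDE ?setCK//; last 2 first.
  - exact: measurableC.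
  - exact: (integrableS measurableT).
  rewrite setIC; apply => A FA; apply: f0.
  suff : j%:R / 2 ^+ n <= k.+1%:R / 2 ^+ n :> R.
    by move=> jk'; exact: (fF.2 _ _ (r0 j) jk').
  by rewrite ler_pM2r ?invr_gt0 ?exprn_gt0// ler_nat.
have GE j : G j = nonneg_time `&` [set z | (dyadic_index n z.1 <= j)%N].
  apply/seteqP; split => -[s w] /=; rewrite /G/S/nonneg_time/=.
    by move=> [s0 [sj _]]; rewrite dyadic_index_le.
  by move=> [s0]; rewrite dyadic_index_le.
have mE : measurable (nonneg_time `&` [set z : R * W | dyadic_index n z.1 = k]).
  by apply: measurable_dyadic_index => //; exact: measurable_funTS.
case: k => [|k] in f0 G0 mE *.
  rewrite -(G0 0%N)// GE (_ : [set z : R * W | dyadic_index n z.1 = 0%N] =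
    [set z : R * W | (dyadic_index n z.1 <= 0)%N])//.
  by apply/seteqP; split => z /=; [move=> ->|rewrite leqn0 => /eqP].
have := G0 k.+1 (leqnSn _); rewrite (_ : G k.+1 = G k `|`
    (nonneg_time `&` [set z | dyadic_index n z.1 = k.+1])).
  rewrite integral_setU//; last 2 first.
  - by apply/measurable_EFinP; apply: measurable_funTS; exact: measurableT_comp.
  - apply/disj_set2P/seteqP; split => // z; rewrite GE => -[[_ /= zk] [_ /= zk1]].
    by rewrite zk1 ltnn in zk.
  by rewrite G0 ?add0e// (leq_trans (leqnSn _)).
rewrite !GE; apply/seteqP; split => z /=.
  by move=> [z0]; rewrite leq_eqVlt ltnS => /predU1P[zk|zk]; [right|left].
by move=> [[z0 zk]|[z0 ->]]; split => //; exact: leqW.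
Qed.

Lemma optional_stopping_randomized :
  Pb.-integrable nonneg_time (fun z => (M z.1 z.2)%:E) /\
  (\int[Pb]_(z in nonneg_time) (M z.1 z.2)%:E = \int[P]_w (M 0 w)%:E)%E.
Proof.
have mD := @measurable_nonneg_time _ W R.
have [sF0 _] := fF.1 _ (lexx 0).
have iLb := integrable_marginal mL iL.
have -> : (\int[P]_w (M 0 w)%:E = \int[Pb]_(z in nonneg_time) (- L z.2)%:E)%E.
  rewrite cM//; last exact: sigma_setT.
  rewrite [RHS](_ : _ = \int[Pb]_z (- L z.2)%:E)%E; last first.
    rewrite [RHS](negligible_integral (N := ~` nonneg_time)) ?setDE ?setCK ?setTI//.
    - exact: measurableC.
    - exact: (integrableN iLb).
  rewrite !integralN_EFin//; congr (- _)%E.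
  by rewrite integral_marginal.
apply: (optional_stopping (C := C) mM rM) => //.
- exact: probability_setT.
- exact: (integrableS measurableT).
- by apply: filterS (ae_marginal bM) => z bz _.
move=> n k; set E := nonneg_time `&` _.
pose t' : R := k.+1%:R / 2 ^+ n.
have t0 : 0 <= t' by rewrite divr_ge0// exprn_ge0.
have mE : measurable E.
  by apply: measurable_dyadic_index => //; exact: measurable_funTS.
have iME : Pb.-integrable E (fun z => (M t' z.2)%:E).
  apply: (integrableS measurableT) => //.
  exact: integrable_marginal (mMt t0) (iMt t0).
have iLE : Pb.-integrable E (fun z => (L z.2)%:E) by exact: (integrableS measurableT).
(* By [cM], the variable M_{t'} + L integrates to 0 over every set of F t'. *)
have := @integral_index n k (fun w => M t' w + L w).
rewrite (@integralD_EFin _ _ _ _ _ mE (fun z => M t' z.2) (fun z => L z.2))//.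
move=> eq0.
have {}eq0 : (\int[Pb]_(z in E) (M t' z.2)%:E + \int[Pb]_(z in E) (L z.2)%:E = 0)%E.
  apply: eq0.
  - by apply: measurable_funD => //; exact: mMt.
  - exact: (integrableD _ (iMt t0) iL).
  - move=> A FA; have [_ Fm] := fF.1 _ t0; have mA := Fm _ FA.
    have iMA : P.-integrable A (EFin \o M t').
      by apply: (integrableS measurableT) => //; exact: iMt.
    have iLA : P.-integrable A (EFin \o L) by exact: (integrableS measurableT).
    rewrite (@integralD_EFin _ _ _ _ _ mA (M t') L)// [X in (X + _)%E](cM t0 FA).
    by rewrite integralN_EFin// addeC subee//; exact: integrable_fin_num.
rewrite integralN_EFin//; move/eqP: eq0.
rewrite -(fineK (integrable_fin_num mE iME)) -(fineK (integrable_fin_num mE iLE)).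
by rewrite -EFinD eqe addr_eq0 => /eqP ->.
Qed.

End randomized.
End closed_martingale.

Lemma integral_setID d (T : measurableType d) (R : realType)
    (mu : {measure set T -> \bar R}) (A B : set T) (f : T -> \bar R) :
  measurable A -> measurable B -> measurable_fun setT f ->
  (\int[mu]_(x in A) f x =
   \int[mu]_(x in A `&` B) f x + \int[mu]_(x in A `\` B) f x)%E.
Proof.
move=> mA mB mf; rewrite -[in LHS](setUIDK A B) integral_setU//.
- exact: measurableI.
- exact: measurableD.
- exact: measurable_funTS.
- by apply/disj_set2P; rewrite setDE setIACA setICr setI0.
Qed.

(** * Snell envelopes and the reduite *)

Section semigroup.
Context {R : realType} {O : completeMetricType R}.
Variable Pt : R -> R.-pker borel (cem O) ~> borel (cem O).
Hypothesis cO : countable [set: O].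

Definition semigroup (t : R) (f : cem O -> R) (x : cem O) : R :=
  \int[Pt t x]_y (f : borel (cem O) -> R) y.

Lemma integrable_semigroup t x (f : cem O -> R) c : (forall y, `|f y| <= c) ->
  (Pt t x).-integrable setT (EFin \o (f : borel (cem O) -> R)).
Proof.
move=> fc; apply: (bounded_integrable (c := c)) => //; first exact: prob_kernel.
exact: cem_measurable_fun.
Qed.

Lemma semigroupE t x (f : cem O -> R) c : (forall y, `|f y| <= c) ->
  (semigroup t f x)%:E = (\int[Pt t x]_y (f y)%:E)%E.
Proof.
by move=> fc; rewrite /semigroup /Rintegral fineK//;
  apply: integrable_fin_num => //; exact: integrable_semigroup fc.
Qed.

Lemma semigroup_bound t x (f : cem O -> R) c : (forall y, `|f y| <= c) ->
  `|semigroup t f x| <= c.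
Proof.
move=> fc; have intf := integrable_semigroup t x fc.
apply: le_trans (le_normr_Rintegral measurableT intf) _.
apply: (@le_trans _ _ (\int[Pt t x]_y (cst c : borel (cem O) -> R) y)).
  apply: le_Rintegral => //; first exact: integrable_norm.
  by apply: (integrable_semigroup t x (f := cst c) (c := `|c|)).
by rewrite Rintegral_cst// (prob_kernel (s := Pt t)) mulr1.
Qed.

Lemma le_semigroup t x (f g : cem O -> R) c : (forall y, `|f y| <= c) ->
  (forall y, `|g y| <= c) -> (forall y, f y <= g y) ->
  semigroup t f x <= semigroup t g x.
Proof.
move=> fc gc fg; apply: le_Rintegral => //.
  exact: integrable_semigroup fc.
exact: integrable_semigroup gc.
Qed.

Fixpoint snell (delta : R) (phi : cem O -> R) (k : nat) (x : cem O) : R :=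
  if k is k'.+1 then Num.max (phi x) (semigroup delta (snell delta phi k') x)
  else phi x.

Lemma snell_bound delta phi k c : (forall y, `|phi y| <= c) ->
  forall x, `|snell delta phi k x| <= c.
Proof.
move=> phic; elim: k => [|k IH] x /=; first exact: phic.
by rewrite /Num.max; case: ifP => _; [exact: semigroup_bound IH|exact: phic].
Qed.

End semigroup.

Section markov_system.
Context {d} {W : measurableType d} {R : realType} {O : completeMetricType R}.
Variables (P : probability W R) (F : R -> set (set W)).
Variable X : W -> cadlag_path R (cem O).
Variable Pt : R -> R.-pker borel (cem O) ~> borel (cem O).
Hypothesis fF : filtration F.
Hypothesis aX : adapted F X.
Hypothesis cO : countable [set: O].
Hypothesis mX : markov_process P F X Pt.
Local Open Scope ereal_scope.

Lemma markov_semigroup s t A (f : cem O -> R) c : (0 <= s)%R -> (s < t)%R -> F s A ->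
  (forall y, `|f y| <= c)%R ->
  \int[P]_(w in A) (f (X w t))%:E =
  \int[P]_(w in A) (semigroup Pt (t - s) f (X w s))%:E.
Proof.
move=> s0 st FA fc; have [_ Fm] := fF.1 _ s0; have mA := Fm _ FA.
have t0 : (0 <= t)%R by rewrite (le_trans s0)// ltW.
have P1 := @probability_setT _ _ _ P.
apply: (@eq_integral_fibers _ _ _ (cem O) P A (fun w => X w s)) => //.
- exact: cem_countable.
- by move=> x; apply: measurableI => //; exact/Fm/(adapted_state aX cO).
- apply: (@bounded_integrable _ _ _ _ (fun w => f (X w t)) c) => //.
  exact: (measurable_adapted fF aX cO).
- apply: (@bounded_integrable _ _ _ _ (fun w => semigroup Pt (t - s) f (X w s)) c) => //.
    exact: (measurable_adapted fF aX cO).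
  by move=> w; exact: semigroup_bound.
move=> x; rewrite (markov_integral fF aX cO mX x s0 st FA fc).
rewrite -(semigroupE Pt cO (t - s) x fc) (eq_integral (cst (semigroup Pt (t - s) f x)%:E)).
  rewrite integral_cst//; first by rewrite muleC.
  by apply: measurableI => //; exact/Fm/(adapted_state aX cO).
by move=> w /set_mem[_ /= ->].
Qed.

Variables (phi : cem O -> R) (c : R).
Hypothesis Cphi : Cb phi.
Hypothesis phic : forall y, (`|phi y| <= c)%R.

Lemma measurable_phi_stopped sigma : stopping_time F sigma ->
  measurable_fun setT (fun w => phi (X w (sigma w))).
Proof.
move=> ssigma; have ms := measurable_stopping_time fF ssigma.
apply: (@measurable_stopped _ _ _ (fun t w => phi (X w t)) _ _ _ setT sigma id) => //.
  exact: (measurable_process_Cb fF aX cO Cphi).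
by move=> w _; case: ssigma.
Qed.

(* [V] is attained if, from any time [s] on, some stopping time has conditional
   expected reward [V (X_s)]; optional stopping of martingales at this time is
   recorded along. *)
Definition attained (V : cem O -> R) := forall s, (0 <= s)%R ->
  exists sigma, [/\ stopping_time_ge F s sigma,
    forall A, F s A -> \int[P]_(w in A) (phi (X w (sigma w)))%:E =
                       \int[P]_(w in A) (V (X w s))%:E
  & forall N, martingale P F N ->
      P.-integrable setT (fun w => (N (sigma w) w)%:E) /\
      forall A, F s A -> \int[P]_(w in A) (N (sigma w) w)%:E =
                         \int[P]_(w in A) (N s w)%:E].

Lemma attained_phi : attained phi.
Proof.
move=> s s0; exists (fun=> s); split => //; first by split=> //; exact: stopping_time_cst.
by move=> N [iN _]; split=> //; exact: iN.
Qed.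

(** Wait for delta, then follow the stopping time that attains V from s + delta on. The martingale
    identity from s to s + delta takes care of N. *)
Lemma attained_semigroup delta V : (0 < delta)%R -> (forall y, `|V y| <= c)%R ->
  attained V -> attained (semigroup Pt delta V).
Proof.
move=> delta0 Vc aV s s0.
have st : (s < s + delta)%R by rewrite ltrDl.
have t0 : (0 <= s + delta)%R by rewrite addr_ge0// ltW.
have [sigma [[ssigma tsigma] phiV mart]] := aV _ t0; exists sigma; split.
- by split => // w; rewrite (le_trans (ltW st)).
- move=> A FA; rewrite phiV; last exact: (fF.2 s _ s0 (ltW st)).
  by rewrite (markov_semigroup s0 st FA Vc) [(s + delta)%R]addrC addrK.
move=> N mN; have [iN NE] := mart _ mN; split => // A FA.
rewrite NE; last exact: (fF.2 s _ s0 (ltW st)).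
by have [_ /(_ _ _ s0 (ltW st))[_ ->]] := mN.
Qed.

(** Decide at time s, by comparing V1(X_s) with V2(X_s), which of the two stopping times to
    follow. *)
Lemma attained_max V1 V2 : attained V1 -> attained V2 ->
  attained (fun x => Num.max (V1 x) (V2 x)).
Proof.
move=> a1 a2 s s0; have [sF Fm] := fF.1 _ s0.
have [s1 [[ss1 ts1] phi1 mart1]] := a1 _ s0.
have [s2 [[ss2 ts2] phi2 mart2]] := a2 _ s0.
pose B := [set w | (V2 (X w s) <= V1 (X w s))%R].
have FB : F s B by exact: (aX s0 (cem_measurable [set x | (V2 x <= V1 x)%R] cO)).
have mB := Fm _ FB.
pose sigma w := if w \in B then s1 w else s2 w.
have ssigma : stopping_time F sigma.
  split=> [w|r r0]; first by rewrite /sigma; case: ifP => _; [case: ss1|case: ss2].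
  have [sFr _] := fF.1 _ r0.
  (* The decision B is known only from time s on, but before s neither stopping time has
     occurred. *)
  have [sr|rs] := leP s r.
    have FrB : F r B by exact: (fF.2 s r).
    rewrite (_ : mkset _ = (B `&` [set w | s1 w <= r]%R) `|`
       ([set w | s2 w <= r]%R `\` B)).
      apply: (sigma_setU sFr); first by apply: (sigma_setI sFr) => //; case: ss1 => _; exact.
      by apply: (sigma_setD sFr) => //; case: ss2 => _; exact.
    apply/seteqP; split => w /=; rewrite /sigma.
      case: ifPn => [/set_mem|/negP nB] h; first by left.
      by right; split => // Bw; apply: nB; exact: mem_set.
    by move=> [[Bw h]|[h nB]]; [rewrite mem_set|rewrite memNset].
  rewrite (_ : mkset _ = set0); first by case: sFr.
  apply/seteqP; split => // w /=; rewrite leNgt (lt_le_trans rs)//.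
  by rewrite /sigma; case: ifP.
have split_at (f g1 g2 : W -> R) A : F s A ->
    measurable_fun setT f -> 
    (forall w, f w = if w \in B then g1 w else g2 w) ->
    \int[P]_(w in A) (f w)%:E = \int[P]_(w in A `&` B) (g1 w)%:E +
                                \int[P]_(w in A `\` B) (g2 w)%:E.
  move=> FA mf fE; rewrite (integral_setID _ (Fm _ FA) mB); last exact/measurable_EFinP.
  congr (_ + _); apply: eq_integral => w /set_mem[_ Bw].
    by rewrite fE mem_set.
  by rewrite fE memNset.
exists sigma; split.
- by split => // w; rewrite /sigma; case: ifP.
- move=> A FA.
  rewrite (split_at (fun w => phi (X w (sigma w))) (fun w => phi (X w (s1 w)))
    (fun w => phi (X w (s2 w))))//; last 2 first.
  - exact: measurable_phi_stopped.
  - by move=> w; rewrite /sigma; case: ifP.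
  rewrite (split_at (fun w => Num.max (V1 (X w s)) (V2 (X w s)))
    (fun w => V1 (X w s)) (fun w => V2 (X w s)))//; last 2 first.
  - exact: (measurable_adapted fF aX cO (fun x => Num.max (V1 x) (V2 x)) s0).
  - move=> w; case: ifPn => [/set_mem Bw|/negP Bw]; first by rewrite max_l.
    by rewrite max_r// ltW// ltNge; apply/negP => h; apply: Bw; exact: mem_set.
  have FAB := sigma_setI sF FA FB; have FAD := sigma_setD sF FA FB; rewrite phi1 // phi2 //.
move=> N mN; have [i1 N1] := mart1 _ mN; have [i2 N2] := mart2 _ mN.
have mN1 : measurable_fun setT (fun w => N (s1 w) w).
  by apply/measurable_EFinP; exact: measurable_int i1.
have mN2 : measurable_fun setT (fun w => N (s2 w) w).
  by apply/measurable_EFinP; exact: measurable_int i2.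
have NsE w : N (sigma w) w = if w \in B then N (s1 w) w else N (s2 w) w.
  by rewrite /sigma; case: ifP.
have mNs : measurable_fun setT (fun w => N (sigma w) w).
  under eq_fun do rewrite NsE.
  apply: measurable_fun_ifT => //.
  apply: (measurable_fun_bool true); rewrite setTI (_ : _ @^-1` _ = B) //.
  by apply/seteqP; split => w; [exact: set_mem|exact: mem_set].
split=> [|A FA].
  apply: (@le_integrable _ _ _ _ _ measurableT _
    (fun w => `|(N (s1 w) w)%:E| + `|(N (s2 w) w)%:E|)).
  - exact/measurable_EFinP.
  - move=> w _; rewrite NsE [leRHS]gee0_abs ?adde_ge0//.
    by case: ifP => _; rewrite ?leeDl ?leeDr.
  - by apply: integrableD => //; exact: integrable_abse.
rewrite (split_at _ _ _ _ FA mNs NsE).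
rewrite N1 ?N2; [|exact: sigma_setD|exact: sigma_setI].
rewrite -integral_setID//; first exact: Fm.
by have [/(_ _ s0) iN _] := mN; exact: measurable_int iN.
Qed.

Lemma attained_snell delta k : (0 < delta)%R -> attained (snell Pt delta phi k).
Proof.
move=> delta0; elim: k => [|k IH]; first exact: attained_phi.
apply: attained_max; first exact: attained_phi.
by apply: attained_semigroup => // y; exact: snell_bound.
Qed.

Lemma integrable_stopped sigma A : stopping_time F sigma -> measurable A ->
  P.-integrable A (EFin \o (fun w => phi (X w (sigma w)))).
Proof.
move=> ss mA; apply: (@bounded_integrable _ _ _ _ _ c) => //.
- exact: probability_setT.
- exact: measurable_phi_stopped.
Qed.

Lemma integrable_state s A (f : cem O -> R) : (0 <= s)%R -> measurable A ->
  (forall y, `|f y| <= c)%R -> P.-integrable A (EFin \o (fun w => f (X w s))).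
Proof.
move=> s0 mA fc; apply: (@bounded_integrable _ _ _ _ (fun w => f (X w s)) c) => //.
- exact: probability_setT.
- exact: (measurable_adapted fF aX cO).
Qed.

Lemma stopping_time_maxr sigma t : (0 <= t)%R -> stopping_time F sigma ->
  stopping_time F (fun w => Num.max (sigma w) t).
Proof.
move=> t0 [sigma0 Fsigma]; split => [w|r r0]; first by rewrite le_max sigma0.
have [sFr _] := fF.1 _ r0.
have [tr|rt] := leP t r.
  rewrite (_ : mkset _ = [set w | sigma w <= r]%R); first exact: Fsigma.
  by apply/seteqP; split => w /=; rewrite ge_max tr andbT.
rewrite (_ : mkset _ = set0); first by case: sFr.
by apply/seteqP; split => // w /=; rewrite ge_max [(t <= r)%R]leNgt rt andbF.
Qed.

(* Backward induction: no stopping time taking its values in the grid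
   [j delta, ..., (j + k) delta] beats the [k]-step Snell envelope. *)
Lemma grid_le_snell delta k : (0 < delta)%R ->
  forall j sigma, stopping_time F sigma ->
  (forall w, exists2 i, (j <= i <= j + k)%N & sigma w = (i%:R * delta)%R) ->
  forall A, F (j%:R * delta)%R A ->
  \int[P]_(w in A) (phi (X w (sigma w)))%:E <=
  \int[P]_(w in A) (snell Pt delta phi k (X w (j%:R * delta)%R))%:E.
Proof.
move=> delta0; elim: k => [|k IH] j sigma ss grid A FA.
  rewrite le_eqVlt; apply/orP; left; apply/eqP.
  apply: eq_integral => w _ /=; have [i] := grid w.
  by rewrite addn0 -eqn_leq => /eqP <- ->.
set s := (j%:R * delta)%R in FA *; pose t := (j.+1%:R * delta)%R.
have s0 : (0 <= s)%R by rewrite mulr_ge0// ltW.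
have st : (s < t)%R by rewrite ltr_pM2r// ltr_nat.
have t0 : (0 <= t)%R by rewrite (le_trans s0)// ltW.
have [sF Fm] := fF.1 _ s0; have mA := Fm _ FA.
pose B := [set w | (sigma w <= s)%R].
have FB : F s B by case: ss => _; exact.
have mB := Fm _ FB.
have FAB := sigma_setI sF FA FB; have FAD := sigma_setD sF FA FB.
(* Off B the grid forces sigma >= t, so that sigma' = sigma there. The maximum makes sigma' a
   stopping time on the shifted grid everywhere, as the induction hypothesis requires. *)
pose sigma' w := Num.max (sigma w) t.
have ss' : stopping_time F sigma' by exact: stopping_time_maxr.
have snellc l : (forall y, `|snell Pt delta phi l y| <= c)%R by exact: snell_bound.
rewrite (integral_setID _ mA mB); last first.
  by apply/measurable_EFinP; exact: measurable_phi_stopped.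
rewrite [leRHS](integral_setID _ mA mB); last first.
  by apply/measurable_EFinP; exact: (measurable_adapted fF aX cO (snell Pt delta phi k.+1) s0).
apply: leeD.
  rewrite (eq_integral (fun w => (phi (X w s))%:E)); last first.
    move=> w /set_mem[_ Bw]; congr (phi (X w _))%:E; apply/eqP.
    rewrite eq_le; apply/andP; split => //; have [i /andP[ji _] ->] := grid w.
    by rewrite ler_pM2r// ler_nat.
  apply: le_integral.
  - exact: Fm.
  - exact: (integrable_state s0 (Fm _ FAB) phic).
  - exact: (integrable_state s0 (Fm _ FAB) (snellc k.+1)).
  - by move=> w _; rewrite lee_fin /= le_max lexx.
rewrite (eq_integral (fun w => (phi (X w (sigma' w)))%:E)); last first.
  move=> w /set_mem[_ nB]; congr (phi (X w _))%:E; rewrite /sigma' max_l//.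
  have [i /andP[_ _] si] := grid w; rewrite si ler_pM2r// ler_nat ltnNge.
  by apply/negP => ij; apply: nB; rewrite /B /= si ler_pM2r// ler_nat.
apply: (@le_trans _ _ (\int[P]_(w in A `\` B) (snell Pt delta phi k (X w t))%:E)).
  apply: (IH j.+1) => // [w|]; last exact: (fF.2 s t s0 (ltW st)).
  have [i /andP[ji ijk] si] := grid w; rewrite /sigma' si.
  have [ij|ij] := leqP i j.
    by exists j.+1; rewrite ?leqnn ?leq_addr// max_r// ler_pM2r// ler_nat leqW.
  by exists i; rewrite ?ij ?addSnnS// max_l// ler_pM2r// ler_nat.
rewrite (markov_semigroup s0 st FAD (snellc k)).
have -> : (t - s = delta)%R by rewrite -mulrBl -natrB// subSnn mul1r.
apply: le_integral.
- exact: Fm.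
- by apply: (integrable_state s0 (Fm _ FAD)) => y; exact: semigroup_bound.
- exact: (integrable_state s0 (Fm _ FAD) (snellc k.+1)).
- by move=> w _; rewrite lee_fin /= le_max lexx orbT.
Qed.

End markov_system.

Lemma integral_as_cst d (W : measurableType d) (R : realType)
    (P : probability W R) (f : W -> R) a (N : set W) :
  measurable N -> P N = 1%E -> (forall w, N w -> f w = a) ->
  measurable_fun setT f -> (\int[P]_w (f w)%:E = a%:E)%E.
Proof.
move=> mN PN fN mf; rewrite (ae_eq_integral (cst a%:E))//.
- by rewrite integral_cst//= probability_setT mule1.
- exact/measurable_EFinP.
exists (~` N); split; first exact: measurableC.
  by apply: etrans (probability_setC P mN) _; rewrite PN subee.
by move=> w; apply: contra_not => Nw _ /=; rewrite fN.
Qed.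

Lemma stopping_time_dyadic_up d (W : measurableType d) (R : realType)
    (F : R -> set (set W)) n (sigma : W -> R) : filtration F ->
  stopping_time F sigma -> stopping_time F (fun w => dyadic_up n (sigma w)).
Proof.
move=> fF [sigma0 Fsigma]; split => [w|r r0]; first exact: dyadic_up_ge0.
have p0 : 0 < 2 ^+ n :> R by rewrite exprn_gt0.
have [sFr _] := fF.1 _ r0.
have upE w : (dyadic_up n (sigma w) <= r) =
    ((dyadic_index n (sigma w)).+1 <= Num.truncn (r * 2 ^+ n))%N.
  by rewrite /dyadic_up ler_pdivrMr// truncn_ge_nat// mulr_ge0// ltW.
have [E|E] := eqVneq (Num.truncn (r * 2 ^+ n)) 0%N.
  rewrite (_ : mkset _ = set0); first by case: sFr.
  by apply/seteqP; split => // w /=; rewrite upE E.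
case K : (Num.truncn (r * 2 ^+ n)) => [|l]; first by rewrite K in E.
have lr : l%:R / 2 ^+ n <= r.
  rewrite ler_pdivrMr// (@le_trans _ _ l.+1%:R)// ?ler_nat//.
  by rewrite -truncn_ge_nat ?K// mulr_ge0// ltW.
have l0 : 0 <= l%:R / 2 ^+ n :> R by rewrite divr_ge0// ltW.
rewrite (_ : mkset _ = [set w | sigma w <= l%:R / 2 ^+ n]).
  by apply: (fF.2 _ _ l0 lr); exact: Fsigma.
by apply/seteqP; split => w /=; rewrite upE K ltnS dyadic_index_le.
Qed.

Lemma stopping_time_minr d (W : measurableType d) (R : realType)
    (F : R -> set (set W)) t (sigma : W -> R) : filtration F -> 0 <= t ->
  stopping_time F sigma -> stopping_time F (fun w => Num.min (sigma w) t).
Proof.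
move=> fF t0 [sigma0 Fsigma]; split => [w|r r0]; first by rewrite le_min sigma0.
have [sFr _] := fF.1 _ r0.
have [tr|rt] := leP t r.
  rewrite (_ : mkset _ = setT); first exact: sigma_setT.
  by apply/seteqP; split => // w /= _; rewrite ge_min tr orbT.
rewrite (_ : mkset _ = [set w | sigma w <= r]); first exact: Fsigma.
by apply/seteqP; split => w /=; rewrite ge_min [t <= r]leNgt rt orbF.
Qed.

Section stopped_payoff.
Context {d} {W : measurableType d} {R : realType} {O : completeMetricType R}.
Variables (P : probability W R) (F : R -> set (set W)).
Variable X : W -> cadlag_path R (cem O).
Variable Pt : R -> R.-pker borel (cem O) ~> borel (cem O).
Hypothesis fF : filtration F.
Hypothesis aX : adapted F X.
Hypothesis cO : countable [set: O].
Hypothesis mX : markov_process P F X Pt.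
Variables (phi : cem O -> R) (c : R).
Hypothesis Cphi : Cb phi.
Hypothesis phic : forall y, `|phi y| <= c.

Lemma cvg_stopped_payoff sigma w : stopping_time F sigma ->
  phi (X w (Num.min (dyadic_up n (sigma w)) n%:R)) @[n --> \oo] -->
  phi (X w (sigma w)).
Proof.
move=> [sigma0 _].
have upX : (phi \o X w) (dyadic_up n (sigma w)) @[n --> \oo] --> phi (X w (sigma w)).
  exact: cvg_comp (cvg_dyadic_up (sigma0 w)) (cadlag_Cb Cphi (sigma0 w)).
apply: cvg_trans upX; apply: near_eq_cvg; near=> n => /=.
rewrite min_l// (le_trans (dyadic_up_le _ (sigma0 w)))//.
have : sigma w + 2 <= n%:R by near: n; exact: nbhs_infty_ger.
apply: le_trans; rewrite lerD2l ler_piMr// invf_le1 ?exprn_gt0//.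
by rewrite exprn_ege1// ler1n.
Unshelve. all: end_near. Qed.

(** A stopping time rounded up to the mesh 2^-n and capped at n takes its values in a finite grid,
    where the Snell envelope dominates. The cap is eventually inactive on each path, and bounded
    convergence removes the rounding. *)
Lemma stopped_payoff_le sigma (u : \bar R) : stopping_time F sigma ->
  (forall n k,
    (\int[P]_w (snell Pt (2 ^+ n)^-1 phi k (X w 0%R))%:E <= u)%E) ->
  (\int[P]_w (phi (X w (sigma w)))%:E <= u)%E.
Proof.
move=> ss snellu.
pose sigma_ n w := Num.min (dyadic_up n (sigma w)) n%:R.
have ss_ n : stopping_time F (sigma_ n).
  by apply: stopping_time_minr => //; exact: stopping_time_dyadic_up.
have cvgI : (\int[P]_w (phi (X w (sigma_ n w)))%:E @[n --> \oo] -->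
    \int[P]_w (phi (X w (sigma w)))%:E)%E.
  apply: (@dominated_cvg _ _ _ P setT measurableT _ _ (cst c%:E)).
  - by move=> n; apply/measurable_EFinP; exact: (measurable_phi_stopped fF aX cO).
  - by move=> w _; apply: cvg_EFin; [exact: nearW|exact: cvg_stopped_payoff].
  - by [].
  - exact: finite_measure_integrable_cst.
  - by move=> n w _; rewrite lee_fin.
rewrite -(cvg_lim _ cvgI)//; apply: lime_le; first by apply/cvg_ex; eexists; exact: cvgI.
(* The horizon n is reached in n * 2^n steps of length 2^-n. *)
apply: nearW => n; apply: le_trans (snellu n (n * 2 ^ n)%N).
have p0 : (0 < 2 ^+ n :> R) by rewrite exprn_gt0.
have := @grid_le_snell _ _ _ _ P F X Pt fF aX cO mX phi c Cphi phic
  (2 ^+ n)^-1 (n * 2 ^ n)%N _ 0%N (sigma_ n) (ss_ n) _ setT.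
rewrite mul0r; apply.
- by rewrite invr_gt0.
- move=> w; rewrite add0n /sigma_.
  have nE : n%:R = (n * 2 ^ n)%:R / 2 ^+ n :> R by rewrite natrM natrX mulfK// gt_eqF.
  have [h|h] := leP (dyadic_up n (sigma w)) n%:R.
    exists (dyadic_index n (sigma w)).+1 => //.
    by move: h; rewrite /dyadic_up nE ler_pM2r ?invr_gt0// ler_nat => ->.
  by exists (n * 2 ^ n)%N; rewrite ?leqnn.
- by have [sF _] := fF.1 _ (lexx 0); exact: sigma_setT.
Qed.

End stopped_payoff.

Section reduite.
Context {R : realType} {O : completeMetricType R}.
Variable Pt : R -> R.-pker borel (cem O) ~> borel (cem O).
Variable Px : cem O -> probability (path_space R (cem O)) R.
Hypothesis cO : countable [set: O].
Hypothesis sPx : forall x, started_at Pt Px x.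

Lemma integral_start x (f : cem O -> R) :
  (\int[completed (Px x)]_p (f ((p : cadlag_path R (cem O)) 0%R))%:E = (f x)%:E)%E.
Proof.
have [Px1 _ _] := sPx x.
have mx : measurable ([set p : cadlag_path R (cem O) | p 0%R = x] :
    set (path_space R (cem O))).
  exact: measurable_coordinate (lexx 0) (borel_cem_measurable_set1 x).
apply: (@integral_as_cst _ _ _ (completed (Px x)) _ _
  [set p : cadlag_path R (cem O) | p 0%R = x]).
- exact: (measurable_completed (Px x) mx).
- exact: etrans (completedE (Px x) mx) Px1.
- by move=> p /= ->.
- exact: (measurable_adapted (filtration_path Px x) (@adapted_path _ _ Px x) cO).
Qed.

Section fixed_payoff.
Variables (phi : cem O -> R) (c : R).
Hypothesis Cphi : Cb phi.
Hypothesis phic : forall y, `|phi y| <= c.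

(* Quantified over all systems: those started at a point bound [V] by the
   reduite, while the given one, started from mu, serves the dual problem. *)
Definition reduite_approximant V := forall d (W : measurableType d)
    (P : probability W R) (F : R -> set (set W)) (X : W -> cadlag_path R (cem O)),
  filtration F -> adapted F X -> markov_process P F X Pt ->
  attained P F X phi V.

(** In the system started at x, the stopping time attaining V from time 0 on is a competitor in the
    reduite, with reward V(x). *)
Lemma approximant_le_reduite V x : reduite_approximant V ->
  ((V x)%:E <= reduite Px phi x)%E.
Proof.
move=> /(_ _ _ (completed (Px x)) _ id (filtration_path Px x) (@adapted_path _ _ Px x)).
have [_ _ mX] := sPx x => /(_ mX) /(_ _ (lexx 0)) [sigma [[ss _] + _]].
have [sF _] := (filtration_path Px x).1 _ (lexx 0).
move=> /(_ _ (sigma_setT sF)); rewrite (integral_start x V) => <-.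
by apply: ereal_sup_ubound; exists sigma.
Qed.

Lemma reduite_le x u : (forall n k, snell Pt (2 ^+ n)^-1 phi k x <= u) ->
  (reduite Px phi x <= u%:E)%E.
Proof.
move=> snellu; apply: ge_ereal_sup => _ [sigma ss <-].
have [_ _ mX] := sPx x.
apply: (stopped_payoff_le (filtration_path Px x) (@adapted_path _ _ Px x) cO mX
  Cphi phic ss) => n k.
by rewrite (integral_start x (snell Pt (2 ^+ n)^-1 phi k)) lee_fin.
Qed.

Lemma snell_approximant n k : reduite_approximant (snell Pt (2 ^+ n)^-1 phi k).
Proof.
move=> d W P F X fF aX mX; apply: (attained_snell fF aX cO mX Cphi phic).
by rewrite invr_gt0 exprn_gt0.
Qed.

Local Notation v := (fun x => fine (reduite Px phi x)).

Lemma reduite_fin x : (v x)%:E = reduite Px phi x.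
Proof.
rewrite fineK// fin_numElt; apply/andP; split.
  apply: lt_le_trans (approximant_le_reduite x (snell_approximant 0 0)).
  exact: ltNyr.
apply: le_lt_trans (ltry c); apply: reduite_le => n k.
by rewrite (le_trans (ler_norm _))//; exact: (snell_bound Pt cO).
Qed.

Lemma reduite_bound x : `|v x| <= c.
Proof.
rewrite ler_norml -!lee_fin reduite_fin; apply/andP; split.
  apply: le_trans (approximant_le_reduite x (snell_approximant 0 0)).
  by rewrite lee_fin /= lerNl (le_trans (ler_norm _))// normrN.
apply: reduite_le => n k.
by rewrite (le_trans (ler_norm _))//; exact: (snell_bound Pt cO).
Qed.

(** Running maxima over an enumeration of the pairs (n, k): a nondecreasing sequence whose limit is
    the supremum of all dyadic Snell envelopes, without any comparison between meshes. Codes of no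
    pair fall back on (0, 0), which only repeats phi. *)
Fixpoint snell_max (J : nat) : cem O -> R :=
  if J is J'.+1 then
    let nk := odflt (0%N, 0%N) (choice.unpickle J') in
    fun x => Num.max (snell_max J' x) (snell Pt (2 ^+ nk.1)^-1 phi nk.2 x)
  else phi.

Lemma snell_max_bound J x : `|snell_max J x| <= c.
Proof.
elim: J => [|J IH] //=.
by rewrite /Num.max; case: ifP => _ //; exact: (snell_bound Pt cO).
Qed.

Lemma snell_max_approximant J : reduite_approximant (snell_max J).
Proof.
move=> d W P F X fF aX mX; elim: J => [|J IH]; first exact: (attained_phi _ _ fF).
by apply: (attained_max fF aX cO) => //; exact: snell_approximant.
Qed.

Lemma snell_max_le x J : snell_max J x <= v x.
Proof.
by rewrite -lee_fin reduite_fin; exact/approximant_le_reduite/snell_max_approximant.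
Qed.

(** The limit dominates every dyadic Snell envelope, so [reduite_le] makes it dominate the reduite;
    the other inequality holds term by term. *)
Lemma cvg_snell_max x : snell_max J x @[J --> \oo] --> v x.
Proof.
have ndS : nondecreasing_seq (snell_max ^~ x).
  by apply/nondecreasing_seqP => J /=; rewrite le_max lexx.
have cvgS : cvgn (snell_max ^~ x).
  apply: nondecreasing_is_cvgn => //; exists (v x) => _ [J _ <-].
  exact: snell_max_le.
suff -> : v x = limn (snell_max ^~ x) by [].
apply/eqP; rewrite eq_le; apply/andP; split; last first.
  by apply: limr_le => //; apply: nearW => J; exact: snell_max_le.
rewrite -lee_fin reduite_fin; apply: reduite_le => n k.
apply: (@le_trans _ _ (snell_max (choice.pickle (n, k)).+1 x)).
  by rewrite /= choice.pickleK /= le_max lexx orbT.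
exact: (nondecreasing_cvgn_le ndS cvgS).
Qed.

(** The average of an approximant is again an approximant, since waiting for delta is allowed, so it
    stays below the reduite. Bounded convergence passes to v. *)
Lemma semigroup_reduite_le delta x : 0 < delta ->
  semigroup Pt delta v x <= v x.
Proof.
move=> delta0; rewrite -lee_fin (semigroupE Pt cO delta x reduite_bound).
have cvgI : (\int[Pt delta x]_y (snell_max J y)%:E @[J --> \oo] -->
    \int[Pt delta x]_y (v y)%:E)%E.
  apply: (@dominated_cvg _ _ _ (Pt delta x) setT measurableT _ _ (cst c%:E)).
  - by move=> J; apply/measurable_EFinP; exact: cem_measurable_fun.
  - by move=> y _; apply: cvg_EFin; [exact: nearW|exact: cvg_snell_max].
  - by [].
  - exact: (integrable_semigroup Pt cO delta x (f := cst c) (fun=> lexx `|c|)).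
  - by move=> J y _; rewrite lee_fin; exact: snell_max_bound.
rewrite -(cvg_lim _ cvgI)//; apply: lime_le; first by apply/cvg_ex; eexists; exact: cvgI.
apply: nearW => J; rewrite -(semigroupE Pt cO delta x (snell_max_bound J)).
rewrite reduite_fin; apply: approximant_le_reduite => d W P F X fF aX mX.
apply: (attained_semigroup fF aX cO mX delta0 (snell_max_bound J)).
exact: snell_max_approximant.
Qed.

End fixed_payoff.

(** As v dominates its own averages, its Snell envelope on every mesh stays below v, by induction on
    the number of steps. Continuity of v then lets [reduite_le] bound all stopping times. *)
Lemma reduite_reduite phi x : Cb phi ->
  Cb (fun x => fine (reduite Px phi x)) ->
  (fine (reduite Px phi x))%:E =
  reduite Px (fun x => fine (reduite Px phi x)) x.
Proof.
move=> Cphi Cv; have [_ [c phic]] := Cphi.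
have vc := reduite_bound Cphi phic.
apply/eqP; rewrite eq_le; apply/andP; split.
  apply: (@approximant_le_reduite _ (fun x => fine (reduite Px phi x))).
  by move=> d W P F X fF aX mX; exact: (attained_phi _ _ fF).
apply: (reduite_le Cv vc) => n k; elim: k x => [|k IH] x //=.
rewrite ge_max lexx /=.
have p0 : 0 < (2 ^+ n)^-1 :> R by rewrite invr_gt0 exprn_gt0.
apply: le_trans (semigroup_reduite_le Cphi phic x p0).
apply: (le_semigroup Pt cO _ _ _ vc) => // y.
exact: (snell_bound Pt cO).
Qed.

End reduite.

(** * Almost sure comparison of integrals and conditional expectations *)

Section almost_everywhere.
Context d (W : measurableType d) (R : realType) (P : {measure set W -> \bar R}).
Local Open Scope ereal_scope.

Lemma le_integral_ae D (f g : W -> \bar R) : measurable D ->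
  P.-integrable D f -> P.-integrable D g -> {ae P, forall w, f w <= g w} ->
  \int[P]_(w in D) f w <= \int[P]_(w in D) g w.
Proof.
move=> mD intf intg [N [mN PN fgN]].
rewrite (negligible_integral mN mD intf PN) (negligible_integral mN mD intg PN).
have mDN : measurable (D `\` N) by exact: measurableD.
have DND : D `\` N `<=` D by move=> w [].
apply: le_integral => //; [exact: integrableS intf|exact: integrableS intg|].
by move=> w /set_mem[_ nN]; apply: contrapT => /fgN.
Qed.

Lemma integrable_tail (g : W -> R) : P.-integrable setT (EFin \o g) ->
  (forall w, (0 <= g w)%R) -> forall e : R, (0 < e)%R ->
  exists n : nat, \int[P]_(w in [set w | (n%:R < g w)%R]) (g w)%:E <= e%:E.
Proof.
move=> ig g0 e e0; have mg := measurable_int _ ig.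
pose B n := [set w | (n%:R < g w)%R].
have mB n : measurable (B n).
  rewrite -[B n]setTI (_ : B n = [set w | n%:R%:E < (EFin \o g) w]).
    exact: emeasurable_fun_o_infty.
  by apply/seteqP; split => w; rewrite /B /= lte_fin.
have cvgI : (\int[P]_w ((EFin \o g) \_ (B n)) w @[n --> \oo] --> \int[P]_w cst 0 w).
  apply: (@dominated_cvg _ _ _ P setT measurableT _ _ (EFin \o g)) => //.
  - by move=> n; apply/(measurable_restrictT _ (mB n)).1; exact: measurable_funTS.
  - move=> w _; apply: cvg_near_cst; near=> n; rewrite patchE memNset//.
    by apply/negP; rewrite -leNgt; near: n; exact: nbhs_infty_ger.
  - move=> n w _; rewrite patchE; case: ifP => _; last by rewrite abse0 lee_fin.
    by rewrite gee0_abs// lee_fin.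
apply: contrapT => /forallNP tail; suff : e%:E <= 0 by rewrite lee_fin leNgt e0.
have -> : 0 = \int[P]_w cst 0 w :> \bar R by rewrite integral0.
rewrite -(cvg_lim _ cvgI)//; apply: lime_ge; first by apply/cvg_ex; eexists; exact: cvgI.
apply: nearW => n; have /negP := tail n; rewrite -ltNge => /ltW.
by rewrite [in X in _ <= X -> _]integral_mkcond.
Unshelve. all: end_near. Qed.

(** Z need not be integrable a priori. On the G-set A = {Y < Z} its negative part is bounded by that
    of Y, and its integral equals the finite integral of Y, so Z is integrable there. Then Z - Y > 0
    on A has integral 0, and A is negligible. *)
Lemma cond_exp_ae_le (G : set (set W)) (Z : W -> \bar R) (Y : W -> R) :
  sigma_algebra setT G -> G `<=` measurable ->
  P.-integrable setT (EFin \o Y) -> meas_wrt G (EFin \o Y) -> meas_wrt G Z ->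
  (forall A, G A -> \int[P]_(w in A) Z w = \int[P]_(w in A) (Y w)%:E) ->
  {ae P, forall w, Z w <= (Y w)%:E}.
Proof.
move=> sG Gm iY GY GZ ZY; pose A := [set w | (Y w)%:E < Z w].
have GA : G A.
  rewrite -(sigma_algebra_id sG) -[A]setTI.
  by apply: (@measurable_lte _ (g_sigma_algebraType G) R setT measurableT
    (EFin \o Y) Z); exact/meas_wrtP.
have mA := Gm _ GA; have mY := measurable_int _ iY.
have mZ : measurable_fun setT Z.
  by apply: (sub_sigma_measurable_fun sG Gm); exact/meas_wrtP.
have mAZ : measurable_fun A Z by exact: measurable_funTS.
have iAY : P.-integrable A (EFin \o Y) by exact: integrableS iY.
have negZ : \int[P]_(w in A) Z^\- w < +oo.
  apply: le_lt_trans (integral_funeneg_lt_pinfty mA iAY).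
  apply: ge0_le_integral => //; try exact: measurable_funeneg.
    by apply: measurable_funeneg; exact: measurable_funTS.
  move=> w Aw; rewrite !funenegE ge_max !le_max lexx orbT andbT.
  by rewrite leeN2 ltW.
have negZ0 : 0 <= \int[P]_(w in A) Z^\- w by exact: integral_ge0.
have posZ : \int[P]_(w in A) Z^\+ w < +oo.
  have := integrable_fin_num mA iAY; rewrite -(ZY _ GA) integralE.
  move: negZ negZ0; case: (\int[P]_(w in A) Z^\- w) => // r _ _.
  by case: (\int[P]_(w in A) Z^\+ w) => // s; rewrite ltry.
have iZ : P.-integrable A Z.
  apply/integrableP; split => //.
  rewrite (eq_integral (Z^\+ \+ Z^\-)); last first.
    by move=> w _; exact: (congr1 (fun f => f w) (fune_abse Z)).
  rewrite ge0_integralD//; first exact: lte_add_pinfty.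
    exact: measurable_funepos.
  exact: measurable_funeneg.
have iD : P.-integrable A (Z \- (EFin \o Y)) by exact: integrableB.
have D0 w : A w -> 0 < Z w - (Y w)%:E by rewrite sube_gt0.
have : \int[P]_(w in A) `|Z w - (Y w)%:E| = 0.
  rewrite (eq_integral (Z \- (EFin \o Y))); last first.
    by move=> w /set_mem Aw; rewrite gee0_abs// ltW// D0.
  by rewrite integralB// ZY// subee// integrable_fin_num.
move/(ae_eq_integral_abs _ mA (measurable_int _ iD)).1.
apply: filterS => w ZY0; rewrite leNgt; apply/negP => Aw.
by have := D0 _ Aw; rewrite ZY0// ltxx.
Qed.

End almost_everywhere.

(** * Measurability of the state at a random time *)

Section metric_process.
Context {R : realType} {O : completeMetricType R}.

(** Capping the distance at 1 gives a bounded continuous function with zero set {y}. Singletons thus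
    become level sets of functions for which joint measurability follows from the right continuity
    of paths. *)
Lemma Cb_min_mdist (y : O) : Cb (fun x : O => Num.min (mdist y x) 1).
Proof.
have dist_near (x x' : O) (e : R) : mdist x x' < e ->
    `|mdist y x - mdist y x'| < e.
  move=> xx'; rewrite ltr_distl; apply/andP; split.
    rewrite ltrBlDr (le_lt_trans (metric_triangle _ x _))// ltrD2l //.
  rewrite (le_lt_trans (metric_triangle _ x' _))// ltrD2l metric_sym//.
split; last first.
  exists 1 => x; rewrite ger0_norm ?ge_min ?lexx ?orbT//.
  by rewrite le_min mdist_ge0 ler01.
move=> x; apply/cvgrPdist_lt => e e0; near=> x'.
have xx' : mdist x x' < e.
  by near: x'; have := nbhsx_ballx x e e0; rewrite ballEmdist.
apply: le_lt_trans (dist_near _ _ _ xx').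
set a := mdist y x; set b := mdist y x'.
have ab := ler_norm (a - b); have ba := ler_norm (b - a); rewrite distrC in ba.
rewrite ler_norml; apply/andP.
by case: (leP a 1) => ?; case: (leP b 1) => ?; split; lra.
Unshelve. all: end_near. Qed.

Context {d} {W : measurableType d}.
Variables (F : R -> set (set W)) (X : W -> cadlag_path R (cem O)).
Hypothesis fF : filtration F.
Hypothesis aX : adapted F X.
Hypothesis cO : countable [set: O].

Lemma measurable_process_set1 (x : cem O) :
  measurable (nonneg_time `&` [set z : R * W | X z.2 z.1 = x]).
Proof.
have mD := @measurable_nonneg_time _ W R.
have levelP (f : cem O -> R) a : Cb f ->
    measurable (nonneg_time `&` [set z : R * W | f (X z.2 z.1) = a]).
  by move=> Cf; have := measurable_process_Cb fF aX cO Cf mD (measurable_set1 a); exact.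
case: x => [x|]; last first.
  rewrite (_ : [set z : R * W | _] = [set z | alive (X z.2 z.1) = 0]).
    exact: levelP Cb_alive.
  apply/seteqP; split => z /=; first by move=> ->.
  by rewrite /alive; case: (X _ _) => //= y /eqP; rewrite oner_eq0.
(* The condition [alive] = 1 is required as well, because the extended distance also vanishes at the
   cemetery. *)
rewrite (_ : _ `&` _ = (nonneg_time `&` [set z : R * W | alive (X z.2 z.1) = 1]) `&`
    (nonneg_time `&` [set z : R * W |
      ext0 (fun y => Num.min (mdist x y) 1) (X z.2 z.1) = 0])).
  by apply: measurableI; apply: levelP; [exact: Cb_alive|exact/Cb_ext0/Cb_min_mdist].
apply/seteqP; split => z /=.
  by move=> [z0 ->]; split; split => //=; rewrite mdistxx min_l.
move=> [[z0 a1] [_ d0]]; split => //; move: a1 d0; rewrite /alive.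
case: (X _ _) => [y|] /= a1 d0; last by move/eqP: a1; rewrite eq_sym oner_eq0.
move: d0; rewrite /Num.min; case: ifP => [_ /mdist_positivity ->//|_ /eqP].
by rewrite oner_eq0.
Qed.

(* Paths are only meaningful at nonnegative times. *)
Definition stopped_state (z : R * W) : cem O :=
  if 0 <= z.1 then X z.2 z.1 else None.

Let measurable_level x : measurable (stopped_state @^-1` [set x]).
Proof.
have mD := @measurable_nonneg_time _ W R.
rewrite (_ : _ @^-1` _ =
    (nonneg_time `&` [set z : R * W | X z.2 z.1 = x]) `|`
    (~` nonneg_time `&` [set z | None = x])).
  apply: measurableU; first exact: measurable_process_set1.
  apply: measurableI; first exact: measurableC.
  have [<-|nx] := pselect (None = x).
    by rewrite (_ : mkset _ = setT)//; apply/seteqP.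
  by rewrite (_ : mkset _ = set0)//; apply/seteqP; split => // z /nx.
apply/seteqP; split => z; rewrite /stopped_state /nonneg_time /=.
  by case: ifP => z0 zx; [left|right; split => //; rewrite z0].
by move=> [[-> //]|[/negP/negbTE ->]].
Qed.

Lemma measurable_stopped_state :
  measurable_fun setT (stopped_state : R * W -> borel (cem O)).
Proof.
move=> _ B mB; rewrite setTI.
rewrite (_ : _ @^-1` B =
    \bigcup_(x : cem O) (if x \in B then stopped_state @^-1` [set x] else set0)).
  apply: countable_bigcupT_measurable => [|x]; first exact: cem_countable.
  by case: ifP => // _; exact: measurable_level.
apply/seteqP; split => [z Bz|z [x _]].
  by exists (stopped_state z) => //; rewrite mem_set.
by case: ifPn => [/set_mem Bx /= ->|].
Qed.

End metric_process.

(** * Verification of optimality *)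

Section verification.
Context {d} {W : measurableType d} {R : realType} {O : completeMetricType R}.
Variables (P : probability W R) (F : R -> set (set W)).
Variable X : W -> cadlag_path R (cem O).
Variable Pt : R -> R.-pker borel (cem O) ~> borel (cem O).
Variable Px : cem O -> probability (path_space R (cem O)) R.
Variables (mu : probability (borel O) R) (nu : probability (borel (cem O)) R).
Variable m : {finite_measure set (borel O) -> \bar R}.
Variable E : (O -> R) -> (O -> R) -> \bar R.
Hypothesis fF : filtration F.
Hypothesis nF : P.-negligible `<=` F 0.
Hypothesis aX : adapted F X.
Hypothesis cO : countable [set: O].
Hypothesis mX : markov_process P F X Pt.
Hypothesis sPx : forall x, started_at Pt Px x.
Hypothesis gE : generates m E Px.
Hypothesis absX : {ae P, forall w, forall t, 0 <= t ->
  (lifetime (X w) <= t%:E)%E -> X w t = None}.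
Hypothesis iL : (\int[P]_w lifetime (X w) < +oo)%E.
Hypothesis muX : forall B : set (borel (cem O)), measurable B ->
  P [set w | B (X w 0)] = mu (Some @^-1` B).
Variable h : O -> R.
Hypothesis Hh : H0 m E h.
Hypothesis gh : generator m E h (fun=> 1).
Variable C : R.
Hypothesis Ch : Cb (ext0 h).
Hypothesis hC : forall x, `|ext0 h x| <= C.
Local Notation M := (killed_process X h).
Local Notation L := (fun w => fine (lifetime (X w))).
Local Notation S := (killed_clock X).

Lemma measurable_Some : measurable_fun setT (Some : borel O -> borel (cem O)).
Proof.
apply: measurability; first exact: erefl.
by move=> _ [B oB <-]; rewrite setTI; apply: sub_sigma_algebra.
Qed.

Lemma integral_initial_law (f : cem O -> R) c : (forall x, `|f x| <= c) ->
  (\int[P]_w (f (X w 0))%:E = \int[mu]_x (f (Some x))%:E)%E.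
Proof.
move=> fc; have mf : measurable_fun setT (f : borel (cem O) -> R).
  exact: cem_measurable_fun.
pose mu0 : {measure set (borel (cem O)) -> \bar R} :=
  measure_function_pushforward__canonical__measure_function_Measure mu measurable_Some.
have mu01 : mu0 setT = 1%E by exact: (probability_setT mu).
have intf : mu0.-integrable setT (EFin \o (f : borel (cem O) -> R)).
  exact: (bounded_integrable (c := c)).
transitivity (1%:E * \int[mu0]_y (f y)%:E)%E.
  apply: (@integral_law _ _ _ (borel (cem O)) _ P mu0 setT measurableT
    (fun w => X w 0) (NngNum (@ler01 R)) (measurable_state fF aX (lexx 0))) => //.
  by move=> B mB; rewrite setTI mul1e; exact: muX.
apply/esym; apply: (@integral_law _ _ _ (borel (cem O)) _ mu mu0 setT measurableT
    Some (NngNum (@ler01 R)) measurable_Some) => //.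
by move=> B mB; rewrite setTI mul1e.
Qed.

Let mPt := measurable_semigroup_survival sPx cO.
Let potP x u (u0 : 0 < u) := potential_semigroup sPx cO gE x Hh gh u0.

Lemma value_optional_stopping t sigma A : 0 <= t ->
  stopping_time_ge F t sigma -> F t A ->
  P.-integrable A (fun w => (M (sigma w) w)%:E) /\
  (\int[P]_(w in A) (M (sigma w) w)%:E = \int[P]_(w in A) (M t w)%:E)%E.
Proof.
have mM := measurable_joint_killed_process fF nF aX cO absX Ch.
have mMt t' := @measurable_killed_process _ _ _ _ _ _ _ fF nF aX cO absX h t'.
have iMt t' (t0 : 0 <= t') := integrable_killed_process fF nF aX cO absX hC t0 measurableT.
have iLf := integrable_fine_lifetime fF nF aX absX iL.
apply: (@optional_stopping_time _ _ _ P F M L C) => //.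
- by move=> w s; exact: killed_process_right_continuous.
- apply: filterS (lifetime_ae_good fF nF aX absX iL) => w [fw _] s s0.
  exact: killed_process_bound.
- by move=> s B; exact: (killed_process_closed fF nF aX cO mX absX iL hC mPt potP).
Qed.

Lemma value_randomized Pb : randomized_stopping_time P F X nu Pb ->
  Pb.-integrable nonneg_time (fun z => (M z.1 z.2)%:E) /\
  (\int[Pb]_(z in nonneg_time) (M z.1 z.2)%:E = \int[P]_w (M 0 w)%:E)%E.
Proof.
move=> [Pb0 PbP PbF _ _].
have mM := measurable_joint_killed_process fF nF aX cO absX Ch.
have mMt t' := @measurable_killed_process _ _ _ _ _ _ _ fF nF aX cO absX h t'.
have iMt t' (t0 : 0 <= t') := integrable_killed_process fF nF aX cO absX hC t0 measurableT.
have iLf := integrable_fine_lifetime fF nF aX absX iL.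
apply: (@optional_stopping_randomized _ _ _ P F M L C) => //.
- by move=> w s; exact: killed_process_right_continuous.
- by apply/measurable_EFinP; exact: measurable_int iLf.
- apply: filterS (lifetime_ae_good fF nF aX absX iL) => w [fw _] s s0.
  exact: killed_process_bound.
- by move=> s B; exact: (killed_process_closed fF nF aX cO mX absX iL hC mPt potP).
Qed.

Lemma killed_clock0 w : S 0 w = 0.
Proof. by apply/eqP; rewrite eq_le killed_clock_le killed_clock_ge0. Qed.

Lemma integral_value0 : (\int[P]_w (M 0 w)%:E = \int[mu]_x (h x)%:E)%E.
Proof.
rewrite -(integral_initial_law hC); apply: eq_integral => w _.
by rewrite /killed_process killed_clock0 subr0.
Qed.

Lemma integral_terminal_law Pb : randomized_stopping_time P F X nu Pb ->
  Pb.-integrable nonneg_time (fun z => (ext0 h (X z.2 z.1))%:E) /\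
  (\int[Pb]_(z in nonneg_time) (ext0 h (X z.2 z.1))%:E =
   \int[nu]_x (ext0 h x)%:E)%E.
Proof.
move=> [_ _ _ _ lawT]; have mD := @measurable_nonneg_time _ W R.
have mh : measurable_fun setT (ext0 h : borel (cem O) -> R).
  exact: cem_measurable_fun.
have mT := measurable_stopped_state fF aX cO.
have TE z : z \in (@nonneg_time d W R) -> X z.2 z.1 = stopped_state X z.
  by move=> /set_mem z0; rewrite /stopped_state ifT.
have iT : Pb.-integrable nonneg_time (EFin \o (fun z => ext0 h (stopped_state X z))).
  apply: (bounded_integrable (c := C)) => //; first exact: probability_setT.
  exact: (measurableT_comp mh mT).
split.
  by apply: eq_integrable iT => // z zD /=; rewrite TE.
rewrite (eq_integral (fun z => (ext0 h (stopped_state X z))%:E)); last first.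
  by move=> z zD; rewrite TE.
rewrite (@integral_law _ _ _ (borel (cem O)) _ Pb nu nonneg_time mD
  (stopped_state X) (NngNum (@ler01 R)) mT) ?mul1e//.
- move=> B mB; rewrite mul1e; apply: etrans (lawT _ mB); congr (Pb _).
  by apply/seteqP; split => z [z0]; rewrite /= -TE ?mem_set.
- by apply: (bounded_integrable (c := C)) => //; exact: probability_setT.
Qed.

(** Pointwise S_T = h(X_T) - M_T; the law of X_T gives the first integral, and optional stopping
    reduces the second to M_0. *)
Lemma randomized_expected_cost Pb : randomized_stopping_time P F X nu Pb ->
  (expected_cost S Pb = \int[nu]_x (ext0 h x)%:E - \int[mu]_x (h x)%:E)%E.
Proof.
move=> rPb; have mD := @measurable_nonneg_time _ W R.
have [iM ME] := value_randomized rPb; have [iT TE] := integral_terminal_law rPb.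
rewrite /expected_cost -TE -integral_value0 -ME -integralB//.
by apply: eq_integral => z _; rewrite -EFinB /killed_process subKr.
Qed.

(** T does not exceed the lifetime almost surely, so the clock has not yet stopped at T. *)
Lemma randomized_expected_time Pb : randomized_stopping_time P F X nu Pb ->
  (\int[Pb]_(z in nonneg_time) z.1%:E = expected_cost S Pb)%E.
Proof.
move=> [_ _ _ Tle _]; have mD := @measurable_nonneg_time _ W R.
apply: ae_eq_integral => //.
- by apply/measurable_EFinP; exact: measurable_funTS.
- apply/measurable_EFinP; exact: (measurable_process_killed_clock fF nF aX absX).
by apply: filterS Tle => z zL _; rewrite killed_clock_EFin min_l.
Qed.

Lemma meas_wrt_value t : 0 <= t -> meas_wrt (F t) (EFin \o M t).
Proof.
move=> t0; have [sF _] := fF.1 _ t0; apply/(meas_wrt_EFinP sF).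
exact: (adapted_killed_process fF nF aX cO absX).
Qed.

Lemma value_martingale : martingale P F M.
Proof.
split=> [t t0|s t s0 st].
  exact: (integrable_killed_process fF nF aX cO absX hC t0 measurableT).
split=> [|A FA]; first exact: meas_wrt_value.
by rewrite -(killed_process_martingale_eq fF nF aX cO mX absX iL hC mPt potP s0 st FA).
Qed.

(** The single integrable variable C + L dominates |M_sigma| almost surely for every sigma, so its
    tail controls all of theirs. *)
Lemma value_classB : classB P F M.
Proof.
split; first exact: (measurable_joint_killed_process fF nF aX cO absX Ch).
pose g w := C + L w.
have C0 : 0 <= C by rewrite (le_trans _ (hC None)).
have g0 w : 0 <= g w by rewrite addr_ge0// fine_ge0// lifetime_ge0.
have ig : P.-integrable setT (EFin \o g).
  apply: (@integrableD _ _ _ P _ measurableT (cst C%:E) (EFin \o L)).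
    exact: finite_measure_integrable_cst.
  exact: (integrable_fine_lifetime fF nF aX absX iL).
have mg : measurable_fun setT g by apply/measurable_EFinP; exact: measurable_int ig.
move=> e e0; have [n tail] := integrable_tail ig g0 e0.
exists n%:R => sigma ss; apply: le_trans tail.
have mMs : measurable_fun setT (fun w => M (sigma w) w).
  have [sF _] := fF.1 _ (lexx 0).
  have [iMs _] := value_optional_stopping (lexx 0) (conj ss ss.1) (sigma_setT sF).
  by apply/measurable_EFinP; exact: measurable_int iMs.
have mA (f : W -> R) : measurable_fun setT f -> measurable [set w | n%:R < f w].
  move=> mf; rewrite -[mkset _]setTI.
  rewrite (_ : mkset _ = f @^-1` `]n%:R, +oo[%classic).
    exact: mf (measurable_itv _).
  by apply/seteqP; split => w /=; rewrite in_itv /= andbT.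
have mN : measurable_fun setT (fun w => `|M (sigma w) w|) by exact: measurableT_comp.
rewrite integral_mkcond [leRHS]integral_mkcond.
apply: ae_ge0_le_integral => //.
- by move=> w _; rewrite patchE; case: ifP.
- apply/(measurable_restrictT _ (mA _ mN)).1.
  by apply: measurable_funTS; exact/measurable_EFinP.
- by move=> w _; rewrite patchE; case: ifP => //; rewrite lee_fin.
- apply/(measurable_restrictT _ (mA _ mg)).1.
  by apply: measurable_funTS; exact/measurable_EFinP.
apply: filterS (lifetime_ae_good fF nF aX absX iL) => w [fw _] _.
have Mg : `|M (sigma w) w| <= g w by apply: killed_process_bound => //; case: ss.
rewrite !patchE; case: ifPn => [/set_mem nM|_].
  by rewrite mem_set ?lee_fin//; exact: lt_le_trans nM Mg.
by case: ifP => _; rewrite lee_fin.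
Qed.

Lemma value_dual_admissible : dual_admissible P F X S (ext0 h, M).
Proof.
split => //=; [exact: value_classB|exact: value_martingale|].
by move=> sigma _; apply: aeW => w; rewrite /killed_process subKr.
Qed.

(** The reward of a stopping time sigma is M_sigma. By optional stopping every sigma >= t has
    conditional reward M_t, which is therefore an upper bound; the constant time t attains it, which
    makes it the least one. *)
Lemma value_process_killed : value_process P F X S (ext0 h) M.
Proof.
move=> t t0; have [sF Fm] := fF.1 _ t0.
have stt : stopping_time_ge F t (fun=> t) by split => //; exact: stopping_time_cst.
split; first exact: meas_wrt_value.
  move=> Z [sigma ssigma [mZ ZM]].
  apply: (cond_exp_ae_le sF Fm) => //.
  - exact: (integrable_killed_process fF nF aX cO absX hC t0 measurableT).
  - exact: meas_wrt_value.
  move=> A FA; rewrite ZM//.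
  exact: (value_optional_stopping t0 ssigma FA).2.
move=> Y' _; apply; exists (fun=> t) => //; split => //.
exact: meas_wrt_value.
Qed.

Section duality.
Hypothesis reduiteC : forall phi : cem O -> R, Cb phi ->
  Cb (fun x => fine (reduite Px phi x)).
Hypothesis mu_nu : reduite_order Px mu nu.

Lemma dual_objective_le psi M' : dual_admissible P F X S (psi, M') ->
  (dual_objective P nu (psi, M') <= dual_objective P nu (ext0 h, M))%E.
Proof.
move=> [/= Cpsi _ mM' psiM'].
have [_ [cp psib]] := Cpsi.
pose phi x := psi x - ext0 h x.
have phic x : `|phi x| <= cp + C.
  by rewrite (le_trans (ler_normB _ _))// lerD.
have Cphi : Cb phi by exact: CbB.
pose v x := fine (reduite Px phi x).
have vc := reduite_bound cO sPx Cphi phic.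
have Cv : Cb v by exact: reduiteC.
have LSCv : LSCb v by exact: Cb_LSCb.
have vre x : (v x)%:E = reduite Px v x by exact: (reduite_reduite cO sPx).
have phiv x : phi x <= v x by exact: (snell_max_le cO sPx Cphi phic x 0%N).
have mcem (f : cem O -> R) : measurable_fun setT (f : borel (cem O) -> R).
  exact: cem_measurable_fun.
have inu (f : cem O -> R) c : (forall x, `|f x| <= c) ->
    nu.-integrable setT (EFin \o (f : borel (cem O) -> R)).
  by move=> fc; apply: (bounded_integrable (c := c)) => //; exact: probability_setT.
(* Since S = h(X) - M, admissibility at sigma reads phi(X_sigma) <= M'_sigma - M_sigma. Stopping M'
   at sigma is justified by the martingale clause of [attained], as its paths may be irregular. *)
have approxle J : (\int[mu]_x (snell_max Pt phi J (Some x))%:E <=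
    \int[P]_w (M' 0%R w)%:E - \int[P]_w (M 0 w)%:E)%E.
  have aJ := snell_max_approximant cO Cphi phic J fF aX mX.
  have Jc := snell_max_bound Pt cO phic J.
  rewrite -(integral_initial_law Jc).
  have [sF _] := fF.1 _ (lexx 0); have FT := sigma_setT sF.
  have [sigma [[ssigma _] phiJ mart]] := aJ _ (lexx 0).
  rewrite -(phiJ _ FT).
  have [iM' /(_ _ FT) <-] := mart _ mM'.
  have [iM /(_ _ FT) <-] := mart _ value_martingale.
  rewrite -integralB//; apply: le_integral_ae => //.
  - exact: (integrable_stopped P fF aX cO Cphi phic ssigma measurableT).
  - exact: integrableB.
  apply: filterS (psiM' _ ssigma) => w.
  by rewrite /= -EFinB lee_fin /phi /killed_process; lra.
have vle : (\int[mu]_x (v (Some x))%:E <=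
    \int[P]_w (M' 0%R w)%:E - \int[P]_w (M 0 w)%:E)%E.
  have mS (f : cem O -> R) : measurable_fun setT (fun x : borel O => f (Some x)).
    exact: (measurableT_comp (mcem f) measurable_Some).
  have cvgI : (\int[mu]_x (snell_max Pt phi J (Some x))%:E @[J --> \oo] -->
      \int[mu]_x (v (Some x))%:E)%E.
    apply: (@dominated_cvg _ _ _ mu setT measurableT _ _ (cst (cp + C)%:E)).
    - by move=> J; exact/measurable_EFinP.
    - move=> x _; apply: cvg_EFin; [exact: nearW|].
      exact: (cvg_snell_max cO sPx Cphi phic).
    - by [].
    - exact: finite_measure_integrable_cst.
    - by move=> J x _; rewrite lee_fin; exact: (snell_max_bound Pt cO phic).
  rewrite -(cvg_lim _ cvgI)//; apply: lime_le; first by apply/cvg_ex; eexists; exact: cvgI.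
  exact: nearW.
rewrite /dual_objective /= integral_value0 in vle *.
have psiE : (\int[nu]_x (psi x)%:E =
    \int[nu]_x (ext0 h x)%:E + \int[nu]_x (phi x)%:E)%E.
  rewrite -(integralD measurableT (inu _ _ hC) (inu _ _ phic)).
  by apply: eq_integral => x _; rewrite -EFinD /phi addrC subrK.
have phi_le : (\int[nu]_x (phi x)%:E <= \int[P]_w (M' 0%R w)%:E - \int[mu]_x (h x)%:E)%E.
  apply: le_trans vle; apply: le_trans (mu_nu LSCv vre).
  apply: le_integral => //; [exact: inu phic|exact: inu vc|].
  by move=> x _; rewrite lee_fin.
have [iM0 _] := mM'; have M0fin := integrable_fin_num measurableT (iM0 _ (lexx 0)).
have nufin := integrable_fin_num measurableT (inu _ _ hC).
rewrite psiE -addeA; apply: leeD => //.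
by rewrite leeBlDr// addeC; exact: phi_le.
Qed.

Lemma value_solves_dual : solves_dual P F X nu S (ext0 h) M.
Proof.
split; first exact: value_dual_admissible.
apply/eqP; rewrite eq_le; apply/andP; split.
  by apply: ereal_sup_ubound; exists (ext0 h, M) => //; exact: value_dual_admissible.
by apply: ge_ereal_sup => _ [[psi M'] adm <-]; exact: dual_objective_le.
Qed.

End duality.

End verification.

(** * Assembly of the results over an arbitrary probability space *)

Section conclusion.
Context {d} {W : measurableType d} {R : realType} {O : completeMetricType R}.
Variables (P : probability W R) (F : R -> set (set W)).
Variable X : W -> cadlag_path R (cem O).
Variable Pt : R -> R.-pker borel (cem O) ~> borel (cem O).
Variable Px : cem O -> probability (path_space R (cem O)) R.
Variables (mu : probability (borel O) R) (nu : probability (borel (cem O)) R).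
Variable m : {finite_measure set (borel O) -> \bar R}.
Variable E : (O -> R) -> (O -> R) -> \bar R.
Local Notation S := (killed_clock X).

Theorem dirichlet_solution_optimal :
  usual_filtration P F ->
  adapted F X ->
  (forall B : set (borel (cem O)), measurable B ->
     P [set w | B (X w 0)] = mu (Some @^-1` B)) ->
  (\int[P]_w lifetime (X w) < +oo)%E ->
  {ae P, forall w, forall t, 0 <= t -> (lifetime (X w) <= t%:E)%E ->
     X w t = None} ->
  dirichlet_form m E ->
  generates m E Px ->
  stationary_feller Pt Px P F X ->
  (forall phi : cem O -> R, Cb phi -> Cb (fun x => fine (reduite Px phi x))) ->
  poincare m E ->
  viscosity_weak_equivalence m E ->
  reduite_order Px mu nu ->
  let is_solution (h : O -> R) :=
    [/\ H0 m E h,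
        weak_eq m E h (fun=> 1)
      & forall Pb, randomized_stopping_time P F X nu Pb ->
          (\int[Pb]_(z in nonneg_time) z.1%:E =
           \int[nu]_x (ext0 h x)%:E - \int[mu]_x (h x)%:E)%E] in
  exists h : O -> R,
    let M := fun t w => ext0 h (X w t) - S t w in
    [/\ is_solution h,
        forall h', is_solution h' -> exists c : R, forall x, h' x = h x + c,
        forall Pb, randomized_stopping_time P F X nu Pb ->
          expected_cost S Pb = primal_value P F X nu S,
        solves_dual P F X nu S (ext0 h) M
      & value_process P F X S (ext0 h) M].
Proof.
move=> [Fs Fmono _ nF] aX muX iL absX dE gE [_ _ mX sPx] redC pE veE mu_nu.
have fF : filtration F by split.
have cO : countable [set: O].
  apply: sub_countable (countable_measure_gt0 m (@borel_measurable_set1 R O)).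
  by apply: subset_card_le => x _ /=; exact: (viscosity_weak_gt0 dE veE).
have [h [Hh gh]] := exists_solution dE pE veE.
have [Ch [c hc]] := let: And3 Ch _ _ := Hh in Cb_ext0 Ch.
have Ch0 : Cb (ext0 h) by split; [exact: Ch|exists c].
have whE : weak_eq m E h (fun=> 1) by exact: generator_weak_eq.
have costE := randomized_expected_cost fF nF aX cO mX sPx gE absX iL muX Hh gh Ch0 hc.
move=> is_solution; exists h; split.
- split => // Pb rPb.
  by rewrite (randomized_expected_time fF nF aX absX rPb) (costE _ _ rPb).
- move=> h' [Hh' wh' _]; exists 0 => x.
  by rewrite addr0 (solution_unique dE pE veE Hh whE Hh' wh').
- move=> Pb rPb; apply/eqP; rewrite eq_le; apply/andP; split; last first.
    by apply: ereal_inf_lbound; exists Pb.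
  by apply: le_ereal_inf_tmp => _ [Pb' rPb' <-]; rewrite (costE _ _ rPb) (costE _ _ rPb').
- exact: (value_solves_dual fF nF aX cO mX sPx gE absX iL muX Hh gh Ch0 hc redC mu_nu).
- exact: (value_process_killed fF nF aX cO mX sPx gE absX iL Hh gh Ch0 hc).
Qed.

End conclusion.
Theorem proposition5p8 (R : realType) (O Omega : completeMetricType R)
    (Pmu : probability (borel Omega) R)
    (F : R -> set (set (completed_type Pmu)))
    (X : completed_type Pmu -> cadlag_path R (cem O))
    (mu : probability (borel O) R)
    (nu : probability (borel (cem O)) R)
    (Pt : R -> R.-pker borel (cem O) ~> borel (cem O))
    (Px : cem O -> probability (path_space R (cem O)) R)
    (m : {finite_measure set (borel O) -> \bar R})
    (E : (O -> R) -> (O -> R) -> \bar R)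
    (P := completed Pmu)
    (S := killed_clock X) :
  (exists2 Q : set Omega, countable Q & dense Q) ->
  usual_filtration P F ->
  skorokhod_continuous (X : Omega -> cadlag_path R (cem O)) ->
  adapted F X ->
  (forall B : set (borel (cem O)), measurable B ->
     P [set w | B (X w 0)] = mu (Some @^-1` B)) ->
  (\int[P]_w lifetime (X w) < +oo)%E ->
  {ae P, forall w, forall t, 0 <= t -> (lifetime (X w) <= t%:E)%E ->
     X w t = None} ->
  (forall Q : set O, open Q -> Q !=set0 ->
     exists2 sigma, stopping_time F sigma &
       (0 < P [set w | (Some @` Q) (X w (sigma w))])%E) ->
  dirichlet_form m E ->
  generates m E Px ->
  {ae P, forall w, right_lsc (fun t => (S t w)%:E)} ->
  (exists2 pS, predictable_projection P F S pS &
     {ae P, forall w, left_lsc (fun t => pS t w)}) ->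
  (exists c : R, forall t w, 0 <= t -> c <= S t w) ->
  stationary_feller Pt Px P F X ->
  (forall phi : cem O -> R, Cb phi -> Cb (fun x => fine (reduite Px phi x))) ->
  poincare m E ->
  viscosity_weak_equivalence m E ->
  (exists2 D : R, 0 <= D &
     forall t sigma Y Z, 0 <= t -> stopping_time_ge F t sigma ->
       cond_exp P (F t) (fun w => (S (sigma w) w)%:E) Y ->
       cond_exp P (F t) (fun w => (D * (sigma w - t))%:E) Z ->
       {ae P, forall w, (Y w - (S t w)%:E <= Z w)%E}) ->
  in_dual m E mu ->
  reduite_order Px mu nu ->
  let is_solution (h : O -> R) :=
    [/\ H0 m E h,
        weak_eq m E h (fun=> 1)
      & forall Pb, randomized_stopping_time P F X nu Pb ->
          (\int[Pb]_(z in nonneg_time) z.1%:E =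
           \int[nu]_x (ext0 h x)%:E - \int[mu]_x (h x)%:E)%E] in
  exists h : O -> R,
    let M := fun t w => ext0 h (X w t) - S t w in
    [/\ is_solution h,
        forall h', is_solution h' -> exists c : R, forall x, h' x = h x + c,
        forall Pb, randomized_stopping_time P F X nu Pb ->
          expected_cost S Pb = primal_value P F X nu S,
        solves_dual P F X nu S (ext0 h) M
      & value_process P F X S (ext0 h) M].
Proof.
move=> _ uF _ aX muX iL absX _ dE gE _ _ _ feller redC pE veE _ _ mu_nu.
exact: (@dirichlet_solution_optimal _ _ R O (completed Pmu) F X Pt Px mu nu m E
  uF aX muX iL absX dE gE feller redC pE veE mu_nu).
Qed.
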